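(* If a dynamical system $(\mathcal{X},T)$ has the marker property, then there exists a metric $d$ on $\mathcal{X}$ compatible with the topology such that $$\overline{\mathrm{mdim}}_{\mathrm{M}}(\mathcal{X},T,d)=\mathrm{mdim}(\mathcal{X},T).$$
   Context: A dynamical system $(\mathcal{X},T)$ is a compact metrizable space $\mathcal{X}$ with a homeomorphism $T:\mathcal{X}\to\mathcal{X}$. Logarithms $\log$ are to base two. Quantities take values in $[0,\infty]$. Marker property: for every $N>0$ there is an open set $U\subset\mathcal{X}$ with $\mathcal{X}=\bigcup_{n\in\mathbb{Z}}T^{-n}U$ and $U\cap T^{-n}U=\emptyset$ for all $1\le n\le N$. For a compatible metric $d$ put $d_N(x,y)=\max_{0\le n<N}d(T^nx,T^ny)$. Mean dimension: a continuous map $f:\mathcal{X}\to\mathcal{Y}$ from a compact metric space $(\mathcal{X},d)$ to a topological space is an $\varepsilon$-embedding if $\mathrm{diam}\,f^{-1}(y)<\varepsilon$ for every $y\in\mathcal{Y}$; $\mathrm{Widim}_\varepsilon(\mathcal{X},d)$ is the minimum $n\ge0$ such that there is an $\varepsilon$-embedding of $\mathcal{X}$ into some $n$-dimensional finite simplicial complex. Then $\mathrm{mdim}(\mathcal{X},T)=\lim_{\varepsilon\to0}\big(\lim_{N\to\infty}\mathrm{Widim}_\varepsilon(\mathcal{X},d_N)/N\big)$ for any compatible metric $d$ (limits exist; the value is independent of $d$). Upper metric mean dimension: $\#(\mathcal{X},d,\varepsilon)$ is the minimum $n\ge1$ such that $\mathcal{X}$ has an open cover $\{U_1,\dots,U_n\}$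 with $\mathrm{diam}\,U_i<\varepsilon$ for all $i$; $S(\mathcal{X},T,d,\varepsilon)=\lim_{N\to\infty}\frac{1}{N}\log\#(\mathcal{X},d_N,\varepsilon)$; and $\overline{\mathrm{mdim}}_{\mathrm{M}}(\mathcal{X},T,d)=\limsup_{\varepsilon\to0}\frac{S(\mathcal{X},T,d,\varepsilon)}{\log(1/\varepsilon)}$. *)

(* Defs.v *)
From HB Require Import structures.
From mathcomp Require Import all_boot all_order all_algebra.
From mathcomp Require Import all_classical all_reals all_analysis.

Set Implicit Arguments.
Unset Strict Implicit.
Unset Printing Implicit Defensive.

Import Order.TTheory GRing.Theory Num.Theory.
Import numFieldNormedType.Exports.

Local Open Scope classical_set_scope.
Local Open Scope ring_scope.

Section DynamicalSystems.
Context {R : realType} {X : topologicalType}.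
Implicit Types (d : X -> X -> R) (T : X -> X) (A U : set X).

Definition is_metric d :=
  [/\ forall x, d x x = 0,
      forall x y, d x y = 0 -> x = y,
      forall x y, d x y = d y x
    & forall x y z, d x z <= d x y + d y z].

Definition compatible_metric d :=
  is_metric d /\
  forall x, nbhs x = nbhs_ball_ (fun y r => [set z | d y z < r]) x.

Definition homeomorphism T :=
  exists S : X -> X, [/\ cancel T S, cancel S T, continuous T & continuous S].

(* [T^-n U] for an integer [n]; for [n < 0] it is the direct image of [U] by
   [T^|n|]. *)
Definition iterz_preimage T (n : int) U : set X :=
  match n with
  | Posz k => iter k T @^-1` U
  | Negz k => iter k.+1 T @` U
  end.

Definition marker_property T :=
  forall N : nat, (0 < N)%N ->
  exists U : set X,
    [/\ open U,
        \bigcup_(n in [set: int]) iterz_preimage T n U = [set: X]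
      & forall n : nat, (1 <= n <= N)%N ->
          U `&` iterz_preimage T n%:Z U = set0].

(* The idle value [0] only matters for [N = 0], a metric being nonnegative. *)
Definition dynmetric T d (N : nat) (x y : X) : R :=
  \big[Num.max/0]_(n < N) d (iter n T x) (iter n T y).

(* Adding [0] only serves to give the empty set diameter [0] and not [-oo]. *)
Definition diam d A : \bar R :=
  ereal_sup ([set 0%:E] `|` [set (d x y)%:E | x in A & y in A]).

End DynamicalSystems.

Definition dynamical_system (R : realType) (X : topologicalType) (T : X -> X) :=
  [/\ compact [set: X],
      exists d : X -> X -> R, compatible_metric d
    & homeomorphism T].

(* Abstract finite simplicial complexes; their simplices are nonempty. *)
Record simplicial_complex (m : nat) := SimplicialComplex {
  simplices : {set {set 'I_m}};
  simplices_neq0 : finset.set0 \notin simplices;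
  simplices_face : forall s t : {set 'I_m},
    s \in simplices -> t \subset s -> t != finset.set0 -> t \in simplices
}.

Definition has_dimension (m : nat) (K : simplicial_complex m) (n : nat) :=
  (\max_(s in simplices K) #|s|)%N = n.+1.

(* The points of the standard simplex whose support is a simplex of [K],
   in barycentric coordinates. *)
Definition realization (R : realType) (m : nat) (K : simplicial_complex m) :
    set 'rV[R]_m :=
  [set p | [/\ forall i, 0 <= p ord0 i,
               \sum_i p ord0 i = 1
             & [set i | p ord0 i != 0]%SET \in simplices K]].
Arguments realization R {m} K.

Definition eps_embedding (R : realType) (X Y : topologicalType)
    (d : X -> X -> R) (eps : R) (f : X -> Y) :=
  continuous f /\ forall y : Y, (diam d (f @^-1` [set y]) < eps%:E)%E.

Section MeanDimension.
Context {R : realType} {X : topologicalType}.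
Implicit Types (d : X -> X -> R) (T : X -> X) (eps : R).

(* The infimum of a nonempty set of natural numbers is its minimum; the value
   is [+oo] when there is no embedding. *)
Definition widim eps d : \bar R :=
  ereal_inf [set n%:R%:E | n in [set n : nat |
    exists m (K : simplicial_complex m) (f : X -> set_type (realization R K)),
      has_dimension K n /\ eps_embedding d eps f]].

Definition mdim_of_metric T d : \bar R :=
  lim ((fun eps => limn (fun N : nat =>
    widim eps (dynmetric T d N) * (N%:R^-1)%:E)%E) @ 0^'+).

(* The value does not depend on the chosen compatible metric. *)
Definition mdim T : \bar R :=
  mdim_of_metric T (xget (fun _ _ => 0) [set d | compatible_metric d]).

Definition covering_number d eps : \bar R :=
  ereal_inf [set n%:R%:E | n in [set n : nat | (1 <= n)%N /\
    exists U : 'I_n -> set X,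
      [/\ forall i, open (U i),
          \bigcup_(i in [set: 'I_n]) U i = [set: X]
        & forall i, (diam d (U i) < eps%:E)%E]]].

Definition log2 (x : R) : R := ln x / ln 2.

Definition log2e (x : \bar R) : \bar R := (lne x * ((ln 2)^-1)%:E)%E.

Definition entropy_at_scale T d eps : \bar R :=
  limn (fun N : nat =>
    log2e (covering_number (dynmetric T d N) eps) * (N%:R^-1)%:E)%E.

Definition upper_mmdim T d : \bar R :=
  limf_esup (fun eps : R =>
    entropy_at_scale T d eps * ((log2 eps^-1)^-1)%:E)%E 0^'+.

End MeanDimension.
Arguments mdim R {X} T.

(* Main.v *)
From HB Require Import structures.
From mathcomp Require Import all_boot all_order all_algebra.
From mathcomp Require Import all_classical all_reals all_analysis.
From mathcomp Require Import ring lra zify.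
Require Import Defs.

Set Implicit Arguments.
Unset Strict Implicit.
Unset Printing Implicit Defensive.

Import Order.TTheory GRing.Theory Num.Theory.
Import numFieldNormedType.Exports.

Local Open Scope classical_set_scope.
Local Open Scope ring_scope.

(** Write [D] for the mean dimension.

    That [D] is at most the upper metric mean dimension of every compatible
    metric is the inequality of Lindenstrauss and Weiss,
    [mdim_le_upper_mmdim].  If [X] has few sets of small diameter in its
    orbit metrics, then its image under Lipschitz coordinates along an orbit
    is covered by few small cubes, and there is a grid point to which every
    point of the image is close in few coordinates only ([grid_avoidance]).
    Pushing the image away from this point moves it to a skeleton of low
    dimension.  This settles the case where [D] is infinite, with any
    compatible metric.  Width dimension is handled throughout in an
    equivalent form that does not mention complexes ([cube_embedding],
    [widim_leP]).

    For the other inequality with finite [D] a metric has to be constructed.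
    It is a weighted supremum of pseudometrics [rho k], where [rho k]
    separates points up to [1 / (k + 1)] and, at all scales [e] down to [0],
    orbits of length [N] have about [e ^- ((D + 1 / (k + 1)) * N)] classes of
    [rho k]-diameter [e].  If moreover [rho k] is controlled by [rho k.+1]
    along a bounded piece of the orbit, then [rho k] alone determines the
    metric at scales between two consecutive weights, and if the weights
    decrease fast the constants hidden in the count become negligible
    ([low_dimensional_metric]).

    A pseudometric of this dimension comes from a continuous map to a cube
    that separates points up to a small error and whose coordinates along an
    orbit depend on about [D] real parameters per unit of time
    ([stage_exists]).  Here the marker property is used.  Along each orbit the
    expected time to the next marker decreases by one at each step between
    markers; its residue modulo [L] cuts the orbit into blocks of length [L],
    apart from rare irregularities at the markers, and the ends of the blocks
    move continuously with the point.  In each block a code of the orbit in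
    this block is displayed at all times of the block.  The code is a point in
    the nerve of a cover that is small in the metric of orbits of length [L]
    and has order about [D * L], so that a block costs about [D * L]
    parameters.  However, the code has to move continuously with the ends of
    the blocks, and an interpolation between two consecutive points of the
    nerve would cost twice that dimension.  This is avoided by passing to a
    second, coarser nerve halfway, through maps that the fine cover induces
    because it refines the coarse one at all times ([nested_covers], [code],
    [code_splits], [orbit_splits]).

    Such maps, constructed independently for different [k], do not factor
    through one another.  But the data of one of them, that is, the markers
    and the covers, may be perturbed as long as supports do not grow, without
    any change in the constants.  The data of a map is, up to such a
    perturbation, a Lipschitz function of the image of a much finer one
    ([refine_stage]).  Iterating this replacement over all finer maps
    converges, and in the limit the factorization is exact
    ([dimension_pseudometrics]). *)

(** * Continuous functions and compactness *)

Section Metric.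
Context {R : realType} {X : topologicalType}.
Implicit Types (d : X -> X -> R).

Lemma metric_ge0 d : is_metric d -> forall x y, 0 <= d x y.
Proof.
case=> d0 _ ds dt x y; have := dt x y x; rewrite d0 (ds y x).
by move=> h; lra.
Qed.

Lemma compatible_near d x (e : R) : compatible_metric d -> 0 < e ->
  \forall y \near x, d x y < e.
Proof.
move=> [_ nb] e0; change (nbhs x [set y | d x y < e]).
by rewrite nb; exists e.
Qed.

Definition continuous2 (g : X -> X -> R) :=
  continuous (fun p : X * X => g p.1 p.2).

Lemma metric_continuous2 d : compatible_metric d -> continuous2 d.
Proof.
move=> dc [x y]; have [[d0 _ ds dt] _] := dc.
apply/cvgrPdist_lt => e e0.
have e2 : 0 < e / 2 by lra.
exists ([set x' | d x x' < e / 2], [set y' | d y y' < e / 2]) => /=.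
  by split; apply: compatible_near.
move=> [x' y'] [/= h1 h2].
have := dt x x' y; have := dt x' y' y; have := dt x' x y'; have := dt x y y'.
rewrite (ds x' x) (ds y' y) => *.
by rewrite ltr_norml; apply/andP; split; lra.
Qed.

Lemma continuous2_section (g : X -> X -> R) x : continuous2 g -> continuous (g x).
Proof.
move=> cg y; apply: (@continuous_comp _ _ _ (fun z => (x, z))
  (fun p : X * X => g p.1 p.2)); last exact: cg.
by apply: cvg_pair => //; exact: cvg_cst.
Qed.

Lemma metric_continuous d x : compatible_metric d -> continuous (d x).
Proof. by move=> dc; apply/continuous2_section/metric_continuous2. Qed.

Lemma compatible_closed_neighbour d : compatible_metric d -> forall x (A : set X), nbhs x A ->
  exists2 e : R, 0 < e & forall y, d x y < e -> A y.
Proof. by move=> [_ nb] x A; rewrite nb => -[e /= e0 h]; exists e. Qed.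

(** Most of the uniform constants below (moduli of continuity, Lebesgue numbers,
    bounds) come from the compactness of [X * X] in this form.  A property of
    single points is one that ignores the second component. *)
Lemma compact_pair_uniform (Q : R -> X -> X -> Prop) :
  compact [set: X] ->
  (forall r r' x y, r' <= r -> Q r x y -> Q r' x y) ->
  (forall x y, exists2 r : R, 0 < r &
     nbhs ((x, y) : X * X) [set p : X * X | Q r p.1 p.2]) ->
  exists2 r : R, 0 < r & forall x y, Q r x y.
Proof.
move=> cX Qm Ql.
have cXX : compact [set: X * X] by rewrite -setXTT; apply: compact_setX.
move/compact_near_coveringP : cXX => /(_ R (0^'+) (fun r p => Q r p.1 p.2)).
case.
- move=> [x y] _; have [r r0 h] := Ql x y.
  exists ([set p : X * X | Q r p.1 p.2], [set i | i <= r]) => /=.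
    by split => //; exact: nbhs_right_le.
  by move=> [p i] /= [] hp hi; apply: Qm hp.
- move=> e /= e0 h; exists (e / 2) => /=; first by rewrite divr_gt0.
  move=> x y; apply: (h (e / 2) _ _ (x, y)) => //=; last by rewrite divr_gt0.
  by rewrite sub0r normrN gtr0_norm ?divr_gt0// ltr_pdivrMr// ltr_pMr// ltr1n.
Qed.

End Metric.

Section Continuity.
Context {R : realType} {Y : topologicalType}.
Implicit Types f g : Y -> R.

Lemma cont_add f g : continuous f -> continuous g ->
  continuous (fun y => f y + g y).
Proof. by move=> cf cg y; apply: (@continuousD _ R^o); [apply: cf|apply: cg]. Qed.

Lemma cont_opp f : continuous f -> continuous (fun y => - f y).
Proof. by move=> cf y; apply: (@continuousN _ R^o); apply: cf. Qed.

Lemma cont_sub f g : continuous f -> continuous g ->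
  continuous (fun y => f y - g y).
Proof. by move=> cf cg; apply: cont_add => //; apply: cont_opp. Qed.

Lemma cont_mul f g : continuous f -> continuous g ->
  continuous (fun y => f y * g y).
Proof. by move=> cf cg y; apply: continuousM; [apply: cf|apply: cg]. Qed.

Lemma cont_cst (c : R) : continuous (fun _ : Y => c).
Proof. by move=> y; apply: cst_continuous. Qed.

Lemma cont_max f g : continuous f -> continuous g ->
  continuous (fun y => Num.max (f y) (g y)).
Proof. by move=> cf cg y; apply: continuous_max; [apply: cf|apply: cg]. Qed.

Lemma cont_min f g : continuous f -> continuous g ->
  continuous (fun y => Num.min (f y) (g y)).
Proof. by move=> cf cg y; apply: continuous_min; [apply: cf|apply: cg]. Qed.

Lemma cont_norm f : continuous f -> continuous (fun y => `|f y|).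
Proof.
by move=> cf y; apply: (@continuous_comp _ R^o R^o _ _ y (cf y)); apply: norm_continuous.
Qed.

Lemma cont_inv f : (forall y, f y != 0) -> continuous f ->
  continuous (fun y => (f y)^-1).
Proof. by move=> f0 cf y; apply: continuousV => //; apply: cf. Qed.

Lemma cont_bigmax (I : Type) (s : seq I) (F : I -> Y -> R) c :
  (forall i, continuous (F i)) ->
  continuous (fun y => \big[Num.max/c]_(i <- s) F i y).
Proof.
move=> cF; elim: s => [|i s IH].
  under eq_fun do rewrite big_nil; exact: cont_cst.
by under eq_fun do rewrite big_cons; apply: cont_max.
Qed.

Lemma cont_bigmin (I : Type) (s : seq I) (F : I -> Y -> R) c :
  (forall i, continuous (F i)) ->
  continuous (fun y => \big[Num.min/c]_(i <- s) F i y).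
Proof.
move=> cF; elim: s => [|i s IH].
  under eq_fun do rewrite big_nil; exact: cont_cst.
by under eq_fun do rewrite big_cons; apply: cont_min.
Qed.

Lemma cont_sum (I : Type) (s : seq I) (P : pred I) (F : I -> Y -> R) :
  (forall i, continuous (F i)) ->
  continuous (fun y => \sum_(i <- s | P i) F i y).
Proof.
move=> cF; elim: s => [|i s IH].
  under eq_fun do rewrite big_nil; exact: cont_cst.
under eq_fun do rewrite big_cons; case: (P i) => //; exact: cont_add.
Qed.

Lemma cont_comp (Z : topologicalType) (S : Z -> Y) f :
  continuous f -> continuous S -> continuous (fun z => f (S z)).
Proof. by move=> cf cS z; apply: (continuous_comp (cS z)); apply: cf. Qed.

Lemma cont_near f y e : continuous f -> 0 < e ->
  nbhs y [set z | `|f y - f z| < e].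
Proof. by move=> cf e0; have /cvgrPdist_lt /(_ _ e0) := cf y. Qed.

Lemma cont_near_lt f y c : continuous f -> f y < c -> nbhs y [set z | f z < c].
Proof.
move=> cf h; have h0 : 0 < c - f y by lra.
apply: filterS (cont_near y cf h0) => z /=; rewrite ltr_norml => /andP[]; lra.
Qed.

Lemma cont_near_gt f y c : continuous f -> c < f y -> nbhs y [set z | c < f z].
Proof.
move=> cf h; have h0 : 0 < f y - c by lra.
apply: filterS (cont_near y cf h0) => z /=; rewrite ltr_norml => /andP[]; lra.
Qed.

Lemma cont_open_lt f c : continuous f -> open [set z | f z < c].
Proof. by move=> cf; rewrite openE => y /= h; exact: cont_near_lt. Qed.

End Continuity.

Section Separation.
Context {R : realType} {X : topologicalType}.

Lemma cont_fst (f : X -> R) : continuous f -> continuous (fun p : X * X => f p.1).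
Proof. by move=> cf; apply: (cont_comp cf) => p; apply: cvg_fst. Qed.

Lemma cont_snd (f : X -> R) : continuous f -> continuous (fun p : X * X => f p.2).
Proof. by move=> cf; apply: (cont_comp cf) => p; apply: cvg_snd. Qed.

(** Near a pair with [g x y < e] the conclusion holds by continuity of [g];
    near any other pair some [F i] differs by a definite amount, which makes
    the premise false. *)
Lemma separation_uniform (I : Type) (F : I -> X -> R) (g : X -> X -> R) (e : R) :
  compact [set: X] -> (forall i, continuous (F i)) -> continuous2 g ->
  (forall x y, (forall i, F i x = F i y) -> g x y < e) ->
  exists2 r : R, 0 < r &
    forall x y, (forall i, `|F i x - F i y| < r) -> g x y < e - r.
Proof.
move=> cX cF cg h.
apply: (compact_pair_uniform (Q := fun r x y =>
  (forall i, `|F i x - F i y| < r) -> g x y < e - r)) => //.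
  move=> r r' x y rr' Q /= hr; apply: (@lt_le_trans _ _ (e - r)); last by lra.
  by apply: Q => i; apply: lt_le_trans (hr i) rr'.
move=> x y; have [gxy|gxy] := ltP (g x y) e.
  exists ((e - g x y) / 2); first lra.
  have gxy' : g x y < e - (e - g x y) / 2 by lra.
  have := @cont_near_lt R _ (fun p : X * X => g p.1 p.2) (x, y) _ cg gxy'.
  by apply: filterS => p /= + _.
have : ~ (forall i, F i x = F i y) by move/h; rewrite ltNge gxy.
move=> /existsNP[i Fi]; have F0 : 0 < `|F i x - F i y|.
  by rewrite normr_gt0 subr_eq0; apply/eqP.
exists (`|F i x - F i y| / 2); first lra.
have c2 : continuous (fun p : X * X => `|F i p.1 - F i p.2|).
  by apply: cont_norm; apply: cont_sub; [apply: cont_fst|apply: cont_snd].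
have h2 : `|F i x - F i y| / 2 < `|F i x - F i y| by lra.
have := @cont_near_gt R _ _ (x, y) _ c2 h2.
apply: filterS => p /= h3 /(_ i) h4.
by move: (lt_trans h3 h4); rewrite ltxx.
Qed.

End Separation.

(** * Embeddings into cubes and covers of small order *)

Section DynMetric.
Context {R : realType} {X : topologicalType}.
Variables (T : X -> X) (d : X -> X -> R).

Lemma iter_continuous n : continuous T -> continuous (iter n T).
Proof.
move=> cT; elim: n => [|n IH] x /=; first exact: cvg_id.
by apply: (continuous_comp (IH x)); apply: cT.
Qed.

Lemma dynmetric_ltP N x y c : 0 < c ->
  dynmetric T d N x y < c <->
  forall n, (n < N)%N -> d (iter n T x) (iter n T y) < c.
Proof.
move=> c0; rewrite /dynmetric; split.
  by move/bigmax_ltP => [_ h] n nN; apply: (h (Ordinal nN)).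
by move=> h; apply/bigmax_ltP; split => // i _; apply: h.
Qed.

Lemma dynmetric_leP N x y c : 0 <= c ->
  dynmetric T d N x y <= c <->
  forall n, (n < N)%N -> d (iter n T x) (iter n T y) <= c.
Proof.
move=> c0; rewrite /dynmetric; split.
  by move/bigmax_leP => [_ h] n nN; apply: (h (Ordinal nN)).
by move=> h; apply/bigmax_leP; split => // i _; apply: h.
Qed.

Lemma dynmetric_ge0 N x y : 0 <= dynmetric T d N x y.
Proof. by rewrite /dynmetric; apply: bigmax_ge_id. Qed.

Lemma dynmetric_continuous2 N :
  continuous T -> continuous2 d -> continuous2 (dynmetric T d N).
Proof.
move=> cT cd; apply: cont_bigmax => i.
have cT2 : continuous (fun p : X * X => (iter i T p.1, iter i T p.2)).
  move=> p; apply: cvg_pair.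
    by apply: (continuous_comp (@cvg_fst _ _ _ _ _)); apply: iter_continuous.
  by apply: (continuous_comp (@cvg_snd _ _ _ _ _)); apply: iter_continuous.
exact: (cont_comp cd cT2).
Qed.

End DynMetric.

Section Widim.
Context {R : realType} {X : topologicalType}.
Implicit Types (d : X -> X -> R) (e : R).

(** A form of [widim e d <= n] that is visibly subadditive under products:
    the image of [F] lies in the part of a cube where at most [n]
    distinct values other than [0] and [1] occur among the coordinates, a
    polyhedron of dimension [n]. *)
Definition cube_embedding d e n :=
  exists (I : finType) (F : I -> X -> R),
  [/\ forall i, continuous (F i),
      forall i x, 0 <= F i x <= 1,
      forall x, (size (undup [seq F i x | i <- enum I & (0 < F i x < 1)%R]) <= n)%N
    & forall x y, (forall i, F i x = F i y) -> d x y < e].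

(** The same in terms of covers: the supports of the [rho i] have order at
    most [n] and uniformly small diameter. *)
Definition fine_cover d e n :=
  exists (I : finType) (rho : I -> X -> R),
  [/\ forall i, continuous (rho i),
      forall i x, 0 <= rho i x <= 1,
      forall x, exists i, 0 < rho i x,
      forall x, (#|[pred i | (0 < rho i x)%R]| <= n.+1)%N
    & exists2 e' : R, e' < e &
        forall i x y, 0 < rho i x -> 0 < rho i y -> d x y <= e'].

Section KuhnWeights.
Variables (I : finType) (F : I -> X -> R) (q : nat).
Hypotheses (F01 : forall i x, 0 <= F i x <= 1) (q0 : (0 < q)%N).

Let lo (z : {ffun I -> 'I_q.+1}) x :=
  \big[Num.max/0]_i (q%:R * F i x - (z i)%:R).
Let hi (z : {ffun I -> 'I_q.+1}) x :=
  \big[Num.min/1]_i (q%:R * F i x - (z i)%:R + 1).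

(** The barycentric coordinate of [q F x] at the vertex [z] in Kuhn's
    triangulation of the integer lattice: [z] is the vertex obtained by
    rounding up [q F x - t] for the parameters [t] in an interval, from
    [lo] to [hi], and the weight is its length. *)
Definition kuhn_weight z x := Num.max 0 (hi z x - lo z x).

Let qR : 0 < q%:R :> R. Proof. by rewrite ltr0n. Qed.

Lemma kuhn_continuous z : (forall i, continuous (F i)) ->
  continuous (kuhn_weight z).
Proof.
move=> cF; apply: cont_max; first exact: cont_cst.
have c i : continuous (fun x => q%:R * F i x - (z i)%:R).
  by apply: cont_sub; [apply: cont_mul => //; exact: cont_cst|exact: cont_cst].
apply: cont_sub; last exact: cont_bigmax.
by apply: cont_bigmin => i; apply: cont_add => //; exact: cont_cst.
Qed.

Let lo0 z x : 0 <= lo z x. Proof. exact: bigmax_ge_id. Qed.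
Let hi1 z x : hi z x <= 1. Proof. exact: bigmin_le_id. Qed.
Let loP (z : {ffun I -> 'I_q.+1}) x i : q%:R * F i x - (z i)%:R <= lo z x.
Proof. by have /bigmax_leP[_ ->] := lexx (lo z x). Qed.
Let hiP (z : {ffun I -> 'I_q.+1}) x i : hi z x <= q%:R * F i x - (z i)%:R + 1.
Proof. by have /bigmin_geP[_ ->] := lexx (hi z x). Qed.

Lemma kuhn_ge0_le1 z x : 0 <= kuhn_weight z x <= 1.
Proof.
rewrite /kuhn_weight le_max lexx /= ge_max ler01 /=.
by have := lo0 z x; have := hi1 z x; lra.
Qed.

Let kuhn_gt0 z x : (0 < kuhn_weight z x) = (lo z x < hi z x).
Proof. by rewrite /kuhn_weight lt_max ltxx /= subr_gt0. Qed.

Lemma kuhn_vertex_near z x y i : 0 < kuhn_weight z x -> 0 < kuhn_weight z y ->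
  `|F i x - F i y| < 2 / q%:R.
Proof.
rewrite !kuhn_gt0 => hx hy.
have := lo0 z x; have := hi1 z x; have := lo0 z y; have := hi1 z y.
have := loP z x i; have := hiP z x i; have := loP z y i; have := hiP z y i.
move=> *; rewrite ltr_pdivlMr //.
rewrite -[q%:R]gtr0_norm // -normrM mulrBl ![_ * q%:R]mulrC ltr_norml.
by apply/andP; split; lra.
Qed.

Lemma round_up (t : R) : 0 <= t <= q%:R ->
  exists k : 'I_q.+1, t <= k%:R /\ k%:R < t + 1.
Proof.
move=> /andP[t0 tq].
have ex : exists k, t <= k%:R by exists q.
case: (ex_minnP ex) => k tk kmin.
have kq : (k < q.+1)%N by rewrite ltnS; apply: kmin.
exists (Ordinal kq); split => //=.
case: k tk kmin {kq} => [|k] tk kmin; first lra.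
rewrite -natr1 ltrD2r ltNge; apply/negP => /kmin; lia.
Qed.

Lemma kuhn_cover x : exists z, 0 < kuhn_weight z x.
Proof.
have h i : exists k : 'I_q.+1, q%:R * F i x <= k%:R /\ k%:R < q%:R * F i x + 1.
  apply: round_up; have /andP[h0 h1] := F01 i x.
  by rewrite mulr_ge0 ?ler0n//= ler_piMr ?ler0n.
have [z zP] := choice h.
exists [ffun i => z i]; rewrite kuhn_gt0; apply: (@le_lt_trans _ _ 0).
  apply/bigmax_leP; split => // i _; rewrite ffunE.
  by have [] := zP i; lra.
apply/bigmin_gtP; split => // i _; rewrite ffunE.
by have [] := zP i; lra.
Qed.

Let kuhn_inj x z z' : 0 < kuhn_weight z x -> 0 < kuhn_weight z' x ->
  lo z x = lo z' x -> z = z'.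
Proof.
rewrite !kuhn_gt0 => hz hz' e; apply/ffunP => i; apply: val_inj => /=.
have a1 := loP z x i; have a2 := hiP z x i.
have b1 := loP z' x i; have b2 := hiP z' x i.
have c1 : (z i)%:R < (z' i).+1%:R :> R by rewrite -natr1; lra.
have c2 : (z' i)%:R < (z i).+1%:R :> R by rewrite -natr1; lra.
by rewrite !ltr_nat !ltnS in c1 c2; apply/eqP; rewrite eqn_leq c1 c2.
Qed.

(** The left end of the interval determines the vertex, and it is [0] or the
    fractional part of a coordinate. *)
Lemma kuhn_order x n :
  (size (undup [seq F i x | i <- enum I & (0 < F i x < 1)%R]) <= n)%N ->
  (#|[pred z | (0 < kuhn_weight z x)%R]| <= n.+1)%N.
Proof.
set s := undup _ => sn.
pose fr (v : R) : R := q%:R * v - (Num.truncn (q%:R * v))%:R.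
pose A := enum [pred z | (0 < kuhn_weight z x)%R].
have -> : #|[pred z | (0 < kuhn_weight z x)%R]| = size [seq lo z x | z <- A].
  by rewrite size_map -cardE.
apply: (@leq_trans (size (0 :: map fr s))); last by rewrite /= size_map.
apply: uniq_leq_size.
  rewrite map_inj_in_uniq ?enum_uniq // => z z'.
  by rewrite !mem_enum !inE => h h'; exact: kuhn_inj.
move=> l /mapP[z]; rewrite mem_enum inE => zx ->.
have := zx; rewrite kuhn_gt0 => lohi.
have lo1 : lo z x < 1 := lt_le_trans lohi (hi1 z x).
rewrite inE; have [//|lo_neq0 /=] := eqVneq (lo z x) 0.
have lopos : 0 < lo z x by rewrite lt_neqAle eq_sym lo_neq0 lo0.
have [j lj] : exists j, lo z x = q%:R * F j x - (z j)%:R.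
  have := lexx (lo z x); rewrite {2}/lo => /bigmax_geP[|[j _ h]].
    by rewrite leNgt lopos.
  by exists j; apply/eqP; rewrite eq_le h loP.
have Y01 : 0 < q%:R * F j x - (z j)%:R < 1 by rewrite -lj lopos lo1.
have Fj : 0 < F j x < 1.
  have /andP[h0 h1] := F01 j x; rewrite !lt_neqAle h0 h1 !andbT.
  apply/andP; split; apply/eqP => Fj; move: Y01.
    by rewrite -Fj mulr0 sub0r oppr_gt0 ltNge ler0n.
  rewrite Fj mulr1 => /andP[+]; rewrite subr_gt0 ltr_nat => zq.
  by rewrite ltrBlDr -[1]/(1%:R) -natrD ltr_nat add1n ltnNge zq.
apply/mapP; exists (F j x).
  by rewrite mem_undup; apply/mapP; exists j => //; rewrite mem_filter Fj mem_enum.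
rewrite /fr lj; congr (_ - _%:R); apply/esym/truncn_def.
by rewrite -natr1; move: Y01 => /andP[]; lra.
Qed.

End KuhnWeights.
End Widim.

(** * Width dimension *)

Section WidimCharacterization.
Context {R : realType} {X : topologicalType}.
Implicit Types (d : X -> X -> R) (e : R).

(** The cover by the preimages of the open stars of the vertices, for a
    subdivision of the cube that is fine enough in the sense of
    [separation_uniform]. *)
Lemma cube_embedding_fine_cover d e n : compact [set: X] -> continuous2 d ->
  cube_embedding d e n -> fine_cover d e n.
Proof.
move=> cX cd [I [F [cF F01 Fn Fe]]].
have [r r0 rP] := separation_uniform cX cF cd Fe.
pose q := (Num.truncn (2 / r)).+1.
have q0 : (0 < q)%N by [].
have qr : 2 / q%:R < r.
  rewrite ltr_pdivrMr ?ltr0n // mulrC -ltr_pdivrMr //.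
  exact: truncnS_gt.
exists {ffun I -> 'I_q.+1}, (@kuhn_weight _ _ _ F q); split.
- by move=> z; apply: kuhn_continuous.
- by move=> z x; apply: kuhn_ge0_le1.
- by move=> x; apply: kuhn_cover.
- by move=> x; apply: kuhn_order.
- exists (e - r); first lra.
  move=> z x y zx zy; apply/ltW/rP => i.
  exact: lt_trans (kuhn_vertex_near q0 i zx zy) qr.
Qed.

Lemma diam_lt d e e' (A : set X) : 0 < e -> e' < e ->
  (forall x y, A x -> A y -> d x y <= e') -> (diam d A < e%:E)%E.
Proof.
move=> e0 ee h; apply: (@le_lt_trans _ _ (Num.max 0 e')%:E).
  apply: ge_ereal_sup => _ [->|[x Ax [y Ay <-]]]; rewrite lee_fin le_max ?lexx//.
  by rewrite h // orbT.
by rewrite lte_fin gt_max e0.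
Qed.

Lemma diam_ge d (A : set X) x y : A x -> A y -> ((d x y)%:E <= diam d A)%E.
Proof. by move=> Ax Ay; apply: ereal_sup_ubound; right; exists x => //; exists y. Qed.

Lemma skeleton_simplices_neq0 m n :
  finset.set0 \notin [set s : {set 'I_m} | (s != finset.set0) && (#|s| <= n.+1)%N]%SET.
Proof. by rewrite inE eqxx. Qed.

Lemma skeleton_face m n (s t : {set 'I_m}) :
  s \in [set s : {set 'I_m} | (s != finset.set0) && (#|s| <= n.+1)%N]%SET ->
  t \subset s -> t != finset.set0 ->
  t \in [set s : {set 'I_m} | (s != finset.set0) && (#|s| <= n.+1)%N]%SET.
Proof.
rewrite !inE => /andP[_ sn] ts ->; exact: leq_trans (subset_leq_card ts) sn.
Qed.

Definition skeleton m n : simplicial_complex m :=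
  SimplicialComplex (@skeleton_simplices_neq0 m n) (@skeleton_face m n).

Lemma skeleton_dimension m n : (n.+1 <= m)%N -> has_dimension (skeleton m n) n.
Proof.
move=> nm; apply/eqP; rewrite eqn_leq; apply/andP; split.
  by apply/bigmax_leqP => s; rewrite inE => /andP[].
pose s := [set widen_ord nm i | i : 'I_n.+1]%SET.
have cs : #|s| = n.+1.
  by rewrite card_imset ?card_ord // => i j /(congr1 val) /= ?; apply: val_inj.
have sK : s \in simplices (skeleton m n).
  by rewrite inE cs leqnn andbT -card_gt0 cs.
by rewrite -{1}cs;
  exact: (@leq_bigmax_cond _ (mem (simplices (skeleton m n))) (fun t => #|t|) s sK).
Qed.

Lemma mx_continuous m n (f : X -> 'M[R]_(m, n)) :
  (forall i j, continuous (fun x => f x i j)) -> continuous f.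
Proof.
move=> cf x A [P MP sPA].
have : nbhs x [set y | forall i j, P i j (f y i j)].
  by apply: filter_forall => i; apply: filter_forall => j; apply: cf; apply: MP.
by apply: filterS => y; apply: sPA.
Qed.

Lemma realization_continuous m (K : simplicial_complex m)
    (f : X -> set_type (realization R K)) :
  continuous f <-> forall i, continuous (fun x => (set_val (f x)) ord0 i).
Proof.
split=> [cf i|cf].
  have c1 : continuous (fun x => set_val (f x)).
    by move=> x; apply: (continuous_comp (cf x)); exact: (@initial_continuous _ _ set_val).
  move=> x; apply: (@continuous_comp _ _ R _ (fun M : 'rV[R]_m => M ord0 i) x (c1 x)); exact: coord_continuous.
suff c : continuous (set_val \o f) by exact: (continuous_comp_initial c).
by apply: mx_continuous => i j; rewrite (ord1 i).
Qed.

(** Dividing the functions by their sum gives barycentric coordinates in the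
    [n]-skeleton of a simplex.  The [n.+1] vertices added to those of the
    cover ensure that the skeleton has dimension exactly [n]. *)
Lemma fine_cover_widim d e n : 0 < e -> fine_cover d e n ->
  (widim e d <= n%:R%:E)%E.
Proof.
move=> e0 [I [rho [crho rho01 rhoex rhon [e' ee' rhoe]]]].
pose V := (I + 'I_n.+1)%type; pose m := #|{: V}|.
pose S x := \sum_i rho i x.
have S0 x : 0 < S x.
  have [i i0] := rhoex x; rewrite /S (bigD1 i) //=.
  apply: ltr_pwDl => //; apply: sumr_ge0 => j _.
  by have /andP[] := rho01 j x.
pose p x : 'rV[R]_m := \row_j match enum_val j with
  | inl i => rho i x / S x | inr _ => 0 end.
have nm : (n.+1 <= m)%N by rewrite /m card_sum card_ord leq_addl.
have pP x : realization R (skeleton m n) (p x).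
  split.
  - move=> j; rewrite mxE; case: enum_val => [i|_] //.
    by apply: divr_ge0; [have /andP[] := rho01 i x|exact: ltW].
  - pose g (v : V) := match v with inl i => rho i x / S x | inr _ => 0 end.
    rewrite (eq_bigr (fun j => g (enum_val j))); last by move=> j _; rewrite mxE.
    transitivity (\sum_v g v).
      rewrite (reindex (enum_rank : V -> 'I_m)) /=; last exact: onW_bij (@enum_rank_bij V).
      by apply: eq_bigr => v _; rewrite enum_rankK.
    rewrite big_sumType /= [X in _ + X]big1 // addr0.
    by rewrite -mulr_suml -/(S x) divff // gt_eqF.
  - rewrite inE; apply/andP; split.
      have [i i0] := rhoex x; apply/finset.set0Pn; exists (enum_rank (inl i : V)).
      rewrite inE mxE enum_rankK; apply: mulf_neq0; first by rewrite gt_eqF.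
      by rewrite invr_eq0 gt_eqF.
    apply: leq_trans (rhon x).
    rewrite -(card_imset _ (@inl_inj I 'I_n.+1)) -(card_imset _ (@enum_rank_inj V)).
    apply: subset_leq_card; apply/fintype.subsetP => j; rewrite inE mxE => pj.
    apply/imsetP; exists (enum_val j); last by rewrite enum_valK.
    move: pj; case: enum_val => [i|k]; last by rewrite eqxx.
    move=> hi; apply: imset_f; rewrite inE lt_neqAle.
    have /andP[-> _] := rho01 i x; rewrite andbT eq_sym.
    by apply: contraNneq hi => ->; rewrite mul0r.
pose f x : set_type (realization R (skeleton m n)) := exist _ (p x) (mem_set (pP x)).
have fE x : set_val (f x) = p x by [].
apply: ereal_inf_lbound; exists n => //=; exists m, (skeleton m n), f; split.
  exact: skeleton_dimension.
split.
  apply/realization_continuous => j.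
  have -> : (fun x => (set_val (f x)) ord0 j) = (fun x => p x ord0 j) by [].
  under eq_fun do rewrite mxE.
  case: enum_val => [i|k]; last exact: cont_cst.
  apply: cont_mul => //; apply: cont_inv; first by move=> y; rewrite gt_eqF.
  exact: cont_sum.
move=> y; apply: diam_lt ee' _ => // x x' /= fx fx'.
have [i i0] := rhoex x; apply: (rhoe i) => //.
have : p x ord0 (enum_rank (inl i : V)) = p x' ord0 (enum_rank (inl i : V)).
  by rewrite -!fE fx fx'.
rewrite !mxE enum_rankK => h.
have : 0 < rho i x' / S x' by rewrite -h divr_gt0.
by rewrite pmulr_lgt0 // invr_gt0.
Qed.

(** Partial sums of barycentric coordinates: they change only at the at most
    [n.+1] vertices of the support, and the last change leads to [1]. *)
Lemma widim_cube_embedding d e n :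
  (widim e d <= n%:R%:E)%E -> cube_embedding d e n.
Proof.
move=> wn; have : (widim e d < n.+1%:R%:E)%E.
  by apply: le_lt_trans wn _; rewrite lte_fin ltr_nat.
move=> /ereal_inf_lt[_ [k /= [m [K [f [Kk [cf fe]]]]] <-]].
rewrite lte_fin ltr_nat ltnS => kn.
pose p x i := (set_val (f x)) ord0 i.
have pP x : realization R K (set_val (f x)) by exact: (set_mem (svalP (f x))).
have p0 x i : 0 <= p x i by have [h _ _] := pP x; exact: h.
have p1 x : \sum_i p x i = 1 by have [_ h _] := pP x; exact: h.
have pn x : (#|[pred i | p x i != 0%R]| <= k.+1)%N.
  have [_ _ sK] := pP x.
  have := @leq_bigmax_cond _ (mem (simplices K)) (fun t => #|t|) _ sK.
  by rewrite Kk cardsE.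
pose S (i : 'I_m) x := \sum_(j < m | (j <= i)%N) p x j.
have S0 i x : 0 <= S i x by apply: sumr_ge0.
have Slast x i : 0 < S i x -> exists2 j, p x j != 0 & S j x = S i x.
  move=> Si; have [j0 /andP[j0i pj0]] : exists j : 'I_m, (j <= i)%N && (p x j != 0).
    apply/existsP; apply: contraPT Si; rewrite negb_exists => /forallP h.
    rewrite /S big1 ?ltxx // => j ji.
    by have := h j; rewrite ji /= negbK => /eqP.
  pose P (j : 'I_m) := (j <= i)%N && (p x j != 0).
  have Pj0 : P j0 by rewrite /P j0i.
  case: (@arg_maxnP _ j0 P (fun j : 'I_m => j : nat) Pj0) => j /andP[ji pj] jmax.
  exists j => //; rewrite /S [RHS](bigID (fun l : 'I_m => (l <= j)%N)) /=.
  rewrite [X in _ = _ + X]big1 ?addr0 => [|l /andP[li lj]].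
    apply: eq_bigl => l; case: (leqP l j) => lj; rewrite ?andbF ?andbT //.
    by rewrite (leq_trans lj ji).
  apply/eqP; apply: contraNT lj => pl; apply: jmax; rewrite /P li; exact: pl.
have S1 i x : S i x <= 1.
  rewrite -(p1 x) /S [leRHS](bigID (fun j : 'I_m => (j <= i)%N)) /=.
  by rewrite lerDl; apply: sumr_ge0.
exists 'I_m, S; split.
- by move=> i; apply: cont_sum => j; exact: (realization_continuous f).1 cf j.
- by move=> i x; rewrite S0 S1.
- move=> x; pose A := [seq j <- enum 'I_m | p x j != 0].
  have sA : (size A <= n.+1)%N.
    apply: (@leq_trans k.+1) => //; apply: leq_trans (pn x); rewrite cardE.
    apply: uniq_leq_size; first by rewrite filter_uniq // enum_uniq.
    by move=> i; rewrite mem_filter !mem_enum inE andbT.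
  have [j pj Sj] : exists2 j, p x j != 0 & S j x = 1.
    have m0 : (0 < m)%N.
      rewrite lt0n; apply/negP => /eqP m0; move: (p1 x).
      rewrite big1 => [/esym/eqP|i _]; first by rewrite oner_eq0.
      by exfalso; have := leq_ltn_trans (leq0n i) (ltn_ord i); rewrite m0.
    have mm : (m.-1 < m)%N by rewrite prednK.
    have Sm : S (Ordinal mm) x = 1.
      rewrite -(p1 x) /S; apply: eq_bigl => l /=.
      by rewrite -ltnS prednK // ltn_ord.
    by have [|j pj Sj] := Slast x (Ordinal mm); [rewrite Sm|exists j; rewrite // Sj].
  have jA : j \in A by rewrite mem_filter pj mem_enum.
  have sAj : (size (rem j A) <= n)%N by rewrite size_rem //; case: (size A) sA.
  apply: leq_trans sAj.
  rewrite -(size_map (S^~ x) (rem j A)); apply: uniq_leq_size; first exact: undup_uniq.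
  move=> v; rewrite mem_undup => /mapP[i]; rewrite mem_filter => /andP[/andP[v0 v1] _] ->.
  have [l pl Sl] := Slast x i v0; rewrite -Sl.
  have uA : uniq A by rewrite filter_uniq // enum_uniq.
  apply: map_f; rewrite mem_rem_uniq // inE /= mem_filter pl mem_enum !andbT; apply: contraTneq v1 => lj.
  by rewrite -Sl lj Sj ltxx.
- move=> x y Sxy; have pxy : forall i, p x i = p y i.
    move=> i; have [l li] := ubnP (i : nat); elim: l i li => // l IH i il.
    have := Sxy i; rewrite /S (bigD1 i) //= [in RHS](bigD1 i) //=.
    rewrite (eq_bigr (p y)) => [/addIr //|j /andP[ji nji]].
    apply: IH; apply: (@leq_trans i); last by rewrite -ltnS.
    by rewrite ltn_neqAle ji andbT.
  have fxy : f x = f y.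
    by apply: val_inj; apply/rowP => i; apply: pxy.
  rewrite -lte_fin; apply: le_lt_trans (fe (f x)).
  by apply: diam_ge => //=.
Qed.

Lemma widim_leP d e n : compact [set: X] -> continuous2 d -> 0 < e ->
  (widim e d <= n%:R%:E)%E <-> cube_embedding d e n.
Proof.
move=> cX cd e0; split; first exact: widim_cube_embedding.
by move=> /(cube_embedding_fine_cover cX cd); apply: fine_cover_widim.
Qed.

End WidimCharacterization.

(** * Mean dimension as a supremum of infima *)

Section Fekete.
Context {R : realType}.
Implicit Types a : nat -> R.

Lemma subadditive_bound a m : (0 < m)%N ->
  (forall n, 0 <= a n) -> (forall n k, a (n + k)%N <= a n + a k) ->
  forall n, a n <= n%:R * (a m / m%:R) + (m%:R * a 1%N + a 0%N *+ 2).
Proof.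
move=> m0 a0 sub n.
have mul k l : a (k * l)%N <= k%:R * a l + a 0%N.
  elim: k => [|k IH]; first by rewrite mul0n mul0r add0r.
  by rewrite mulSn -natr1; have := sub l (k * l)%N; lra.
rewrite {1}(divn_eq n m); set q := (n %/ m)%N; set r := (n %% m)%N.
have h1 := sub (q * m)%N r; have h2 := mul q m.
have h3 : a r <= r%:R * a 1%N + a 0%N by rewrite -{1}[r]muln1.
have h4 : r%:R * a 1%N <= m%:R * a 1%N.
  by rewrite ler_wpM2r // ler_nat ltnW // ltn_pmod.
have h5 : q%:R * a m <= n%:R * (a m / m%:R).
  rewrite mulrA ler_pdivlMr ?ltr0n // mulrAC ler_wpM2r // -natrM ler_nat.
  exact: leq_divM.
by rewrite mulr2n; lra.
Qed.

Lemma fekete a : (forall n, 0 <= a n) ->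
  (forall n k, a (n + k)%N <= a n + a k) ->
  exists l : R, (fun n => a n / n%:R) @ \oo --> l /\
    forall n, (0 < n)%N -> l <= a n / n%:R.
Proof.
move=> a0 sub.
pose A := [set a n / n%:R | n in [set n | (0 < n)%N]].
have lbA : lbound A 0 by move=> _ [n _ <-]; rewrite divr_ge0.
have hA : has_inf A by split; [exists (a 1%N / 1%:R); exists 1%N|exists 0].
have infle n : (0 < n)%N -> inf A <= a n / n%:R.
  by move=> n0; apply: ge_inf; [exists 0|exists n].
exists (inf A); split => //.
apply/cvgrPdist_lt => e e0.
have e2 : 0 < e / 2 by lra.
have [_ [m /= m0 <-] hm] := inf_adherent e2 hA.
set c := m%:R * a 1%N + a 0%N *+ 2.
have c0 : 0 <= c by rewrite addr_ge0 ?mulr_ge0 ?mulrn_wge0.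
near=> n.
have n0 : (0 < n)%N by near: n; exact: nbhs_infty_gt.
have nR : 0 < n%:R :> R by rewrite ltr0n.
have h1 := infle n n0.
have h2 : a n / n%:R <= a m / m%:R + c / n%:R.
  rewrite ler_pdivrMr // mulrDl mulrVK ?unitfE ?gt_eqF // mulrC.
  exact: subadditive_bound.
have h3 : c / n%:R < e / 2.
  rewrite ltr_pdivrMr // mulrC -ltr_pdivrMr //.
  by near: n; exact: nbhs_infty_gtr.
rewrite distrC ltr_norml; apply/andP; split; lra.
Unshelve. all: by end_near. Qed.

Lemma fekete_ereal (b : nat -> \bar R) a : (forall n, b n = (a n)%:E) ->
  (forall n, 0 <= a n) -> (forall n k, a (n + k)%N <= a n + a k) ->
  exists l : R, [/\ limn (fun n => b n * (n%:R^-1)%:E)%E = l%:E,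
    forall n, (0 < n)%N -> l <= a n / n%:R
  & forall c, l < c -> \forall n \near \oo, a n / n%:R < c].
Proof.
move=> bE a0 sub; have [l [cl hl]] := fekete a0 sub.
exists l; split => //.
- have -> : (fun n => b n * (n%:R^-1)%:E)%E = EFin \o (fun n => a n / n%:R).
    by apply/funext => n /=; rewrite bE EFinM.
  by apply/cvg_lim => //; apply: cvg_EFin => //; apply: nearW.
- move=> c lc; have c0 : 0 < c - l by lra.
  have /cvgrPdist_lt /(_ _ c0) := cl.
  by apply: filterS => n /=; rewrite ltr_norml => /andP[]; lra.
Qed.

End Fekete.

Section Bumps.
Context {R : realType} {X : topologicalType}.
Implicit Types (d : X -> X -> R) (e : R).

Lemma finite_subcover (f : X -> set X) : compact [set: X] ->
  (forall x, nbhs x (f x)) -> exists s : seq X, forall y, exists2 x, x \in s & f x y.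
Proof.
move=> /compact_near_coveringP cX fx.
pose G : set_system (seq X) :=
  [set A | exists s0 : seq X, forall s : seq X, {subset s0 <= s} -> A s].
have FG : Filter G.
  split.
  - by exists [::].
  - move=> A B [s hs] [t ht]; exists (s ++ t) => u us; split.
      by apply: hs => x xs; apply: us; rewrite mem_cat xs.
    by apply: ht => x xs; apply: us; rewrite mem_cat xs orbT.
  - by move=> A B AB [s hs]; exists s => u us; apply/AB/hs.
have [x _|s hs] := cX _ G (fun s y => exists2 x, x \in s & f x y) FG.
  exists (f x, [set s : seq X | x \in s]) => /=.
    by split=> //; exists [:: x] => s; apply; rewrite inE.
  by move=> [y s] [/= fxy xs]; exists x.
by exists s => y; apply: (hs s).
Qed.

Lemma max_lip (c s t : R) : `|Num.max c s - Num.max c t| <= `|s - t|.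
Proof.
have := ler_norm (s - t); have := ler_norm (t - s); rewrite (distrC t).
by case: (lerP c s) => ?; case: (lerP c t) => ? *; rewrite ler_norml; apply/andP; split; lra.
Qed.

Lemma min_lip (c s t : R) : `|Num.min c s - Num.min c t| <= `|s - t|.
Proof.
have := ler_norm (s - t); have := ler_norm (t - s); rewrite (distrC t).
by case: (lerP c s) => ?; case: (lerP c t) => ? *; rewrite ler_norml; apply/andP; split; lra.
Qed.

Definition bump d (x : X) (r : R) (z : X) : R :=
  Num.max 0 (Num.min 1 (2 - d x z * (2 / r))).

Lemma bump01 d x r z : 0 <= bump d x r z <= 1.
Proof. by rewrite /bump le_max lexx /= ge_max ler01 ge_min lexx. Qed.

Lemma bump_eq1 d x r z : 0 < r -> d x z < r / 2 -> bump d x r z = 1.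
Proof.
move=> r0 zx; have h : d x z * (2 / r) <= 1.
  by rewrite mulrA ler_pdivrMr // mul1r -ler_pdivlMr ?ltW.
by rewrite /bump (min_l _) ?(max_r _) //; lra.
Qed.

Lemma bump_gt0 d x r z : 0 < r -> 0 < bump d x r z -> d x z < r.
Proof.
move=> r0; rewrite /bump lt_max ltxx /= lt_min ltr01 /= subr_gt0 mulrA ltr_pdivrMr //; lra.
Qed.

Lemma bump_continuous d x r : compatible_metric d -> continuous (bump d x r).
Proof.
move=> dc; apply: cont_max; first exact: cont_cst.
apply: cont_min; first exact: cont_cst.
apply: cont_sub; first exact: cont_cst.
by apply: cont_mul; [exact: metric_continuous|exact: cont_cst].
Qed.

Lemma bump_lip d x r y z : is_metric d -> 0 < r ->
  `|bump d x r y - bump d x r z| <= 2 / r * d y z.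
Proof.
move=> [_ _ ds dt] r0.
apply: le_trans (max_lip _ _ _) _; apply: le_trans (min_lip _ _ _) _.
have -> : 2 - d x y * (2 / r) - (2 - d x z * (2 / r)) = (d x z - d x y) * (2 / r) by ring.
have r20 : 0 < 2 / r by rewrite divr_gt0.
rewrite normrM (gtr0_norm r20) mulrC ler_pM2l //.
have := dt x y z; have := dt x z y; rewrite (ds z y) => *.
by rewrite ler_norml; apply/andP; split; lra.
Qed.

(** Two metrics are involved because the smallness in [d0] makes these
    functions coordinates for the mean dimension, which is defined from [d0],
    while the Lipschitz bound relates them to the covering numbers of [d]. *)
Lemma bumps d0 d e : compact [set: X] ->
  compatible_metric d0 -> compatible_metric d -> 0 < e ->
  exists (I : finType) (f : I -> X -> R) (C : R),
  [/\ 0 < C /\ (forall i, continuous (f i)), forall i x, 0 <= f i x <= 1,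
      forall x, exists i, f i x = 1,
      forall i x y, 0 < f i x -> 0 < f i y -> d0 x y < e
    & forall i x y, `|f i x - f i y| <= C * d x y].
Proof.
move=> cX d0c dc e0; have e2 : 0 < e / 2 by lra.
have [[d0x _ d0s d0t] _] := d0c; have [dm _] := dc.
have rx x : exists r : R, 0 < r /\ forall y, d x y < r -> d0 x y < e / 2.
  have [r r0 h] := compatible_closed_neighbour dc (compatible_near x d0c e2).
  by exists r.
have [r rP] := choice rx.
have r0 x : 0 < r x by have [] := rP x.
have [|s sP] := finite_subcover (f := fun x => [set y | d x y < r x / 2]) cX.
  by move=> x; apply: compatible_near => //; rewrite divr_gt0.
exists (seq_sub s), (fun i => bump d (ssval i) (r (ssval i))).
exists (\big[Num.max/1]_(i : seq_sub s) (2 / r (ssval i))); split.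
- split; first by apply: lt_le_trans ltr01 _; exact: bigmax_ge_id.
  by move=> i; apply: bump_continuous.
- by move=> i x; apply: bump01.
- by move=> x; have [z zD zx] := sP x; exists (SeqSub zD); apply: bump_eq1.
- have h i x : 0 < bump d (ssval i) (r (ssval i)) x -> d0 (ssval i : X) x < e / 2.
    by move=> /(bump_gt0 (r0 _)); have [_] := rP (ssval i); apply.
  move=> i x y /h hx /h hy.
  by have := d0t x (ssval i) y; rewrite (d0s x (ssval i)); lra.
- move=> i x y; apply: le_trans (bump_lip _ _ _ dm (r0 _)) _.
  apply: ler_wpM2r; first exact: metric_ge0.
  exact: (le_bigmax _ (fun i : seq_sub s => 2 / r (ssval i))).
Qed.

End Bumps.

Section MeanWidim.
Context {R : realType} {X : topologicalType}.
Variables (T : X -> X) (d : X -> X -> R).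
Hypotheses (cX : compact [set: X]) (dc : compatible_metric d) (cT : continuous T).
Implicit Types e c : R.

Definition mean_widim e : \bar R :=
  limn (fun N : nat => widim e (dynmetric T d N) * (N%:R^-1)%:E)%E.

(** Coordinates for the first [N] times together with coordinates for the
    next [M] times: the numbers of intermediate values add up. *)
Lemma cube_embedding_add e N M n m : 0 < e ->
  cube_embedding (dynmetric T d N) e n -> cube_embedding (dynmetric T d M) e m ->
  cube_embedding (dynmetric T d (N + M)) e (n + m).
Proof.
move=> e0 [I [F [cF F01 Fn Fe]]] [J [G [cG G01 Gn Ge]]].
pose H (k : I + J) x := match k with inl i => F i x | inr j => G j (iter N T x) end.
exists (I + J)%type, H; split.
- move=> [i|j]; first exact: cF.
  by apply: (cont_comp (cG j)); apply: iter_continuous.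
- by move=> [i|j] x //=.
- move=> x.
  set sF := undup [seq F i x | i <- enum I & (0 < F i x < 1)%R].
  set sG := undup [seq G i (iter N T x) | i <- enum J & (0 < G i (iter N T x) < 1)%R].
  have sn : (size (sF ++ sG) <= n + m)%N by rewrite size_cat leq_add // ?Fn ?Gn.
  apply: leq_trans sn; apply: uniq_leq_size; first exact: undup_uniq.
  move=> v; rewrite mem_undup => /mapP[[i|j]]; rewrite mem_filter => /andP[h _] ->.
    rewrite mem_cat; apply/orP; left; rewrite mem_undup; apply/mapP.
    by exists i => //; rewrite mem_filter h mem_enum.
  rewrite mem_cat; apply/orP; right; rewrite mem_undup; apply/mapP.
  by exists j => //; rewrite mem_filter h mem_enum.
- move=> x y h; apply/dynmetric_ltP => // k kNM.
  have hF : dynmetric T d N x y < e by apply: Fe => i; apply: (h (inl i)).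
  have hG : dynmetric T d M (iter N T x) (iter N T y) < e.
    by apply: Ge => j; apply: (h (inr j)).
  have [kN|Nk] := ltnP k N; first exact: (dynmetric_ltP _ _ _ _ _ e0).1 hF _ kN.
  rewrite -(subnK Nk) !iterD.
  by apply: ((dynmetric_ltP _ _ _ _ _ e0).1 hG); rewrite ltn_subLR.
Qed.

Lemma cube_embedding_ex e N : 0 < e -> exists n, cube_embedding (dynmetric T d N) e n.
Proof.
move=> e0; elim: N => [|N [n IH]].
  exists 0%N, void, (fun (v : void) _ => of_void R v); split => //.
  - move=> x; have -> : enum {: void} = [::] by apply: size0nil; rewrite -cardE card_void.
    by [].
  - by move=> x y _; rewrite /dynmetric big_ord0.
suff [m h] : exists m, cube_embedding (dynmetric T d 1) e m.
  by exists (m + n)%N; rewrite -add1n; apply: cube_embedding_add.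
have [I [f [C [[_ cf] f01 f1 fe _]]]] := bumps cX dc dc e0.
exists #|I|, I, f; split => //.
  move=> x; apply: leq_trans (size_undup _) _.
  by rewrite size_map size_filter cardE; exact: count_size.
move=> x y fxy; apply/dynmetric_ltP => // -[|//] _ /=.
by have [i i1] := f1 x; apply: (fe i); rewrite -?fxy i1.
Qed.

Lemma widim_min e N : 0 < e -> exists n,
  [/\ widim e (dynmetric T d N) = n%:R%:E, cube_embedding (dynmetric T d N) e n
    & forall m, cube_embedding (dynmetric T d N) e m -> (n <= m)%N].
Proof.
move=> e0; have [k hk] := cube_embedding_ex N e0.
have ex : exists n, `[< cube_embedding (dynmetric T d N) e n >].
  by exists k; apply/asboolP.
case: (ex_minnP ex) => n /asboolP hn nmin.
have cd : continuous2 (dynmetric T d N).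
  by apply: dynmetric_continuous2 => //; exact: metric_continuous2.
have nmin' m : cube_embedding (dynmetric T d N) e m -> (n <= m)%N.
  by move=> h; apply: nmin; apply/asboolP.
exists n; split => //; apply/eqP; rewrite eq_le; apply/andP; split.
  by apply/widim_leP.
apply: le_ereal_inf_tmp => _ [m hm <-]; rewrite lee_fin ler_nat.
by apply/nmin'/widim_cube_embedding/ereal_inf_lbound; exists m.
Qed.

(** By Fekete's lemma the limit over [N] is an infimum, so that each cube
    embedding bounds it from above and embeddings close to it exist for all
    large [N]. *)
Lemma mean_widimP e : 0 < e -> exists l : R, [/\ mean_widim e = l%:E,
    forall N n, (0 < N)%N -> cube_embedding (dynmetric T d N) e n -> l <= n%:R / N%:R
  & forall c, l < c -> \forall N \near \oo,
      exists2 n, cube_embedding (dynmetric T d N) e n & n%:R < c * N%:R].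
Proof.
move=> e0; have [w wP] := choice (fun N => widim_min N e0).
have sub n k : (w (n + k)%N)%:R <= (w n)%:R + (w k)%:R :> R.
  rewrite -natrD ler_nat; have [_ _ h] := wP (n + k)%N.
  have [_ h1 _] := wP n; have [_ h2 _] := wP k.
  by apply: h; apply: cube_embedding_add.
have wE n : widim e (dynmetric T d n) = ((w n)%:R)%:E by have [] := wP n.
have [l [lE lle llt]] := fekete_ereal wE (fun n => ler0n _ _) sub.
exists l; split => //.
- move=> N n N0 h; apply: le_trans (lle N N0) _.
  by rewrite ler_pM2r ?invr_gt0 ?ltr0n // ler_nat; have [_ _] := wP N; apply.
- move=> c lc; near=> N; exists (w N); first by have [] := wP N.
  have N0 : (0 < N)%N by near: N; exact: nbhs_infty_gt.
  rewrite -ltr_pdivrMr ?ltr0n //.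
  by near: N; apply: llt.
Unshelve. all: by end_near. Qed.

Lemma mean_widim_mono e e' : 0 < e -> e <= e' -> (mean_widim e' <= mean_widim e)%E.
Proof.
move=> e0 ee'; have e'0 := lt_le_trans e0 ee'.
have [l [-> _ h]] := mean_widimP e0; have [l' [-> h' _]] := mean_widimP e'0.
rewrite lee_fin; apply/ler_addgt0Pr => c c0.
have lc : l < l + c by lra.
have [N [N0 [n [I [F [cF F01 Fn Fe]]] nN]]] : exists N, (0 < N)%N /\
    exists2 n, cube_embedding (dynmetric T d N) e n & n%:R < (l + c) * N%:R.
  have [N _ hN] := filterI (nbhs_infty_gt 0) (h _ lc).
  by exists N; apply: (hN N) => /=.
apply: (@le_trans _ _ (n%:R / N%:R)).
  apply: h' => //; exists I, F; split => // x y /Fe h1; exact: lt_le_trans h1 ee'.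
by rewrite ler_pdivrMr ?ltr0n // ltW.
Qed.

Lemma mdim_sup :
  mdim_of_metric T d = ereal_sup (mean_widim @` [set` Interval (BRight (0 : R)) +oo%O]).
Proof.
apply/cvg_lim => //; apply: nonincreasing_at_right_cvge => //.
by move=> e e'; rewrite !in_itv /= !andbT => e0 e'0; exact: mean_widim_mono.
Qed.

Lemma mdim_ge e : 0 < e -> (mean_widim e <= mdim_of_metric T d)%E.
Proof.
by move=> e0; rewrite mdim_sup; apply: ereal_sup_ubound; exists e; rewrite //= in_itv /= e0.
Qed.

Lemma mdim_le (c : \bar R) : (forall e, 0 < e -> (mean_widim e <= c)%E) ->
  (mdim_of_metric T d <= c)%E.
Proof.
move=> h; rewrite mdim_sup; apply: ge_ereal_sup => _ [e /= he <-]; apply: h.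
by move: he; rewrite in_itv /= andbT.
Qed.

End MeanWidim.

(** * Avoiding a grid, and covering numbers *)

Section GridAvoidance.

(** An exponential moment argument: for a random [xi] the indices [j] at which
    [xi j] hits the value forbidden by [a] are rare, so that some [xi] has at
    most [K] hits for every [a].  The sum to estimate is that of [Q] to the
    power of the number of hits, because it factors over the indices. *)
Lemma grid_avoidance (J A : finType) (Q K : nat) (hit : A -> J -> 'I_Q -> bool) :
  (forall a j t t', hit a j t -> hit a j t' -> t = t') ->
  (#|A| * 2 ^ #|J| < Q ^ K.+1)%N ->
  exists xi : {ffun J -> 'I_Q}, forall a, (#|[pred j | hit a j (xi j)]| <= K)%N.
Proof.
move=> hit1 lt; apply: contrapT => nex.
have Q0 : (0 < Q)%N by case: Q lt {hit hit1 nex} => //; rewrite exp0n.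
have ex (xi : {ffun J -> 'I_Q}) : exists a, (K < #|[pred j | hit a j (xi j)]|)%N.
  apply: contrapT => h; apply: nex; exists xi => a; rewrite leqNgt; apply/negP => ha.
  by apply: h; exists a.
pose w a j t : nat := if hit a j t then Q else 1%N.
have wE a (xi : {ffun J -> 'I_Q}) :
    (\prod_j w a j (xi j) = Q ^ #|[pred j | hit a j (xi j)]|)%N.
  by rewrite -prod_nat_const [RHS]big_mkcond.
have lower : (Q ^ #|J| * Q ^ K.+1 <=
    \sum_(xi : {ffun J -> 'I_Q}) \sum_a \prod_j w a j (xi j))%N.
  have -> : (Q ^ #|J| = #|{: {ffun J -> 'I_Q}}|)%N by rewrite card_ffun card_ord.
  rewrite -sum_nat_const; apply: leq_sum => xi _.
  have [a ha] := ex xi; rewrite (bigD1 a) //= wE.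
  by apply: leq_trans (leq_addr _ _); rewrite leq_pexp2l.
have upper : (\sum_(xi : {ffun J -> 'I_Q}) \sum_a \prod_j w a j (xi j)
    <= #|A| * (2 * Q) ^ #|J|)%N.
  rewrite exchange_big /= -sum_nat_const; apply: leq_sum => a _.
  rewrite -(bigA_distr_bigA (w a)) /= -prod_nat_const; apply: leq_prod => j _.
  have [t0 ht0|h0] := pickP (hit a j).
    rewrite (bigD1 t0) //= /w ht0 mul2n -addnn leq_add2l.
    apply: (@leq_trans (\sum_(i < Q | i != t0) 1)).
      by apply: leq_sum => t tt0; case: ifP => // ht; rewrite (hit1 _ _ _ _ ht ht0) eqxx in tt0.
    by rewrite sum1_card; apply: leq_trans (max_card _) _; rewrite card_ord.
  rewrite (eq_bigr (fun=> 1%N)) => [|t _]; last by rewrite /w h0.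
  by rewrite sum1_card card_ord leq_pmull.
have := leq_trans lower upper.
by rewrite expnMn mulnA [leqLHS]mulnC leq_pmul2r ?expn_gt0 ?Q0 // leqNgt lt.
Qed.

End GridAvoidance.

Section Entropy.
Context {R : realType} {X : topologicalType}.
Implicit Types (d : X -> X -> R) (e : R).

Lemma diam_ltP d e (A : set X) : 0 < e ->
  (diam d A < e%:E)%E <->
  exists2 e' : R, e' < e & forall x y, A x -> A y -> d x y <= e'.
Proof.
move=> e0; split=> [dA|[e' ee' h]]; last exact: diam_lt ee' h.
have d0 : (0%:E <= diam d A)%E by apply: ereal_sup_ubound; left.
have dfin : diam d A \is a fin_num.
  by rewrite ge0_fin_numE //; apply: lt_trans dA _; rewrite ltry.
exists (fine (diam d A)); first by rewrite -lte_fin fineK.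
by move=> x y Ax Ay; rewrite -lee_fin fineK //; exact: diam_ge.
Qed.

Definition small_cover d e n :=
  exists (I : finType) (U : I -> set X),
  [/\ (1 <= n)%N /\ (#|I| <= n)%N, forall i, open (U i), forall x, exists i, U i x
    & forall i, exists2 e' : R, e' < e & forall x y, U i x -> U i y -> d x y <= e'].

Lemma covering_number_leP d e n : 0 < e ->
  (covering_number d e <= n%:R%:E)%E <-> small_cover d e n.
Proof.
move=> e0; split=> [cn|].
  have : (covering_number d e < n.+1%:R%:E)%E.
    by apply: le_lt_trans cn _; rewrite lte_fin ltr_nat.
  move=> /ereal_inf_lt[_ [k /= [k1 [U [oU covU dU]]] <-]].
  rewrite lte_fin ltr_nat ltnS => kn.
  exists 'I_k, U; split => //.
  - by split; [apply: leq_trans kn|rewrite card_ord].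
  - move=> x; have : [set: X] x by [].
    by rewrite -covU => -[i _ h]; exists i.
  - by move=> i; apply/diam_ltP.
move=> [I [U [[n1 In] oU covU dU]]].
apply: ereal_inf_lbound; exists n => //=; split => //.
pose V (k : 'I_n) := match insub (k : nat) : option 'I_#|I| with
  | Some j => U (enum_val j) | None => set0 end.
exists V; split.
- by move=> k; rewrite /V; case: insub => [j|]; [exact: oU|exact: open0].
- apply/seteqP; split => // x _; have [i Ui] := covU x.
  have lt : (enum_rank i < n)%N := leq_trans (ltn_ord _) In.
  by exists (Ordinal lt) => //; rewrite /V /= valK enum_rankK.
- move=> k; apply/diam_ltP => //; rewrite /V; case: insub => [j|]; first exact: dU.
  by exists 0.
Qed.

Variables (T : X -> X) (d : X -> X -> R).
Hypotheses (cX : compact [set: X]) (dc : compatible_metric d) (cT : continuous T).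

Let dm : is_metric d. Proof. by have [] := dc. Qed.

Lemma dyn_triangle N x y z :
  dynmetric T d N x z <= dynmetric T d N x y + dynmetric T d N y z.
Proof.
have [_ _ _ dt] := dm; apply/dynmetric_leP => [|n nN].
  by rewrite addr_ge0 ?dynmetric_ge0.
apply: le_trans (dt _ (iter n T y) _) _; apply: lerD.
  exact: (dynmetric_leP _ _ _ _ _ (dynmetric_ge0 _ _ _ _ _)).1 (lexx _) _ nN.
exact: (dynmetric_leP _ _ _ _ _ (dynmetric_ge0 _ _ _ _ _)).1 (lexx _) _ nN.
Qed.

Lemma dyn_sym N x y : dynmetric T d N x y = dynmetric T d N y x.
Proof. by have [_ _ ds _] := dm; apply: eq_bigr => i _; rewrite ds. Qed.

Lemma dyn_xx N x : dynmetric T d N x x = 0.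
Proof.
have [dxx _ _ _] := dm; rewrite /dynmetric.
by rewrite (eq_bigr (fun=> 0)) ?bigmax_eq_id // => i _; rewrite dxx.
Qed.

Lemma dyn_continuous N x : continuous (dynmetric T d N x).
Proof.
apply: continuous2_section.
by apply: dynmetric_continuous2 => //; exact: metric_continuous2.
Qed.

(** The factor [5] leaves room to replace the classes by open neighbourhoods. *)
Lemma partition_small_cover N e (I : finType) (l : X -> I) : 0 < e ->
  (forall x y, l x = l y -> dynmetric T d N x y <= e) ->
  small_cover (dynmetric T d N) (5 * e) (maxn 1 #|I|).
Proof.
move=> e0 lP.
have pick i : exists U : set X, [/\ open U, forall x, l x = i -> U x &
    forall x y, U x -> U y -> dynmetric T d N x y <= 4 * e].
  have [[x0 lx0]|h] := pselect (exists x, l x = i); last first.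
    by exists set0; split => //; [exact: open0|move=> x lx; apply: h; exists x].
  exists [set y | dynmetric T d N x0 y < 2 * e]; split.
  - apply: cont_open_lt; exact: dyn_continuous.
  - by move=> x lx /=; have := lP x0 x; rewrite lx0 lx => /(_ erefl); lra.
  - move=> x y /= hx hy; have := dyn_triangle N x x0 y.
    by rewrite (dyn_sym N x x0); lra.
have [U UP] := choice pick.
exists I, U; split.
- by rewrite leq_maxl leq_maxr.
- by move=> i; have [] := UP i.
- by move=> x; exists (l x); have [_ h _] := UP (l x); apply: h.
- by move=> i; exists (4 * e); [lra|have [] := UP i].
Qed.

Lemma small_cover_ex N e : 0 < e -> exists n, small_cover (dynmetric T d N) e n.
Proof.
move=> e0; have e3 : 0 < e / 3 by lra.
have near x : nbhs x [set y | dynmetric T d N x y < e / 3].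
  have := @cont_near_lt _ _ _ x (e / 3) (@dyn_continuous N x).
  by apply; rewrite dyn_xx.
have [s sP] := finite_subcover cX near.
exists (maxn 1 #|{: seq_sub s}|), (seq_sub s).
exists (fun i => [set y | dynmetric T d N (ssval i) y < e / 3]); split.
- by rewrite leq_maxl leq_maxr.
- by move=> i; apply: cont_open_lt; apply: dyn_continuous.
- by move=> x; have [z zs zx] := sP x; exists (SeqSub zs).
- move=> i; exists (2 * (e / 3)); first lra.
  move=> x y /= hx hy; have := dyn_triangle N x (ssval i) y.
  by rewrite (dyn_sym N x (ssval i)); lra.
Qed.

Lemma small_cover_mul e N M n m : 0 < e ->
  small_cover (dynmetric T d N) e n -> small_cover (dynmetric T d M) e m ->
  small_cover (dynmetric T d (N + M)) e (n * m).
Proof.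
move=> e0 [I [U [[n1 In] oU covU dU]]] [J [V [[m1 Jm] oV covV dV]]].
exists (I * J)%type, (fun k x => U k.1 x /\ V k.2 (iter N T x)); split.
- by rewrite card_prod leq_mul // muln_gt0 n1 m1.
- move=> [i j] /=; apply: openI => //.
  by apply: open_comp => //= x _; exact: iter_continuous.
- move=> x; have [i Ui] := covU x; have [j Vj] := covV (iter N T x).
  by exists (i, j).
- move=> [i j] /=; have [e1 e1e h1] := dU i; have [e2 e2e h2] := dV j.
  exists (Num.max 0 (Num.max e1 e2)); first by rewrite !gt_max e0 e1e e2e.
  set E := Num.max 0 _ => x y [Ux Vx] [Uy Vy].
  have E0 : 0 <= E by rewrite le_max lexx.
  have E1 : e1 <= E by rewrite !le_max lexx orbT.
  have E2 : e2 <= E by rewrite !le_max lexx !orbT.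
  apply/dynmetric_leP => // k kNM.
  have [kN|Nk] := ltnP k N.
    exact: (dynmetric_leP _ _ _ _ _ E0).1 (le_trans (h1 _ _ Ux Uy) E1) _ kN.
  rewrite -(subnK Nk) !iterD.
  apply: (dynmetric_leP _ _ _ _ _ E0).1 (le_trans (h2 _ _ Vx Vy) E2) _ _.
  by rewrite ltn_subLR.
Qed.

Lemma ln2_gt0 : 0 < ln (2 : R).
Proof. by rewrite ln_gt0 // ltr1n. Qed.

Lemma entropyP e : 0 < e -> exists l : R, [/\ entropy_at_scale T d e = l%:E, 0 <= l,
    forall N n, (0 < N)%N -> small_cover (dynmetric T d N) e n ->
      l * ln 2 * N%:R <= ln n%:R
  & forall c, l < c -> \forall N \near \oo,
      exists2 n, small_cover (dynmetric T d N) e n & ln n%:R < c * ln 2 * N%:R].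
Proof.
move=> e0.
have minc N : exists n, [/\ covering_number (dynmetric T d N) e = n%:R%:E,
    small_cover (dynmetric T d N) e n & forall m, small_cover (dynmetric T d N) e m -> (n <= m)%N].
  have [k hk] := small_cover_ex N e0.
  have ex : exists n, `[< small_cover (dynmetric T d N) e n >] by exists k; apply/asboolP.
  case: (ex_minnP ex) => n /asboolP hn nmin.
  have nmin' m : small_cover (dynmetric T d N) e m -> (n <= m)%N.
    by move=> h; apply: nmin; apply/asboolP.
  exists n; split => //; apply/eqP; rewrite eq_le; apply/andP; split.
    by apply/covering_number_leP.
  apply: le_ereal_inf_tmp => _ [m hm <-]; rewrite lee_fin ler_nat.
  by apply/nmin'/covering_number_leP => //; apply: ereal_inf_lbound; exists m.
have [w wP] := choice minc.
have w1 N : (1 <= w N)%N by have [_ [I [U [[]]]]] := wP N.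
have w1R N : 0 < (w N)%:R :> R by rewrite ltr0n.
pose a N : R := ln (w N)%:R / ln 2.
have a0 N : 0 <= a N by rewrite divr_ge0 ?ln_ge0 ?ler1n ?(ltW ln2_gt0).
have sub n k : a (n + k)%N <= a n + a k.
  rewrite /a -mulrDl ler_pM2r ?invr_gt0 ?ln2_gt0 // -lnM ?posrE // -natrM.
  rewrite ler_ln ?posrE ?ltr0n ?muln_gt0 ?w1 //.
  rewrite ler_nat; have [_ _ h] := wP (n + k)%N; apply: h.
  have [_ h1 _] := wP n; have [_ h2 _] := wP k; exact: small_cover_mul.
have wE n : log2e (covering_number (dynmetric T d n) e) = (a n)%:E.
  by have [-> _ _] := wP n; rewrite /log2e lne_EFin // -EFinM.
have [l [lE lle llt]] := fekete_ereal wE a0 sub.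
exists l; split => //.
- rewrite leNgt; apply/negP => l0; have [N _ hN] := filterI (nbhs_infty_gt 0) (llt _ l0).
  by have [N0] := hN N (leqnn N); rewrite ltNge divr_ge0.
- move=> N n N0 h; have [_ _ wmin] := wP N.
  have n1 : (1 <= n)%N by apply: leq_trans (w1 N) (wmin _ h).
  apply: (@le_trans _ _ (ln (w N)%:R)); last by rewrite ler_ln ?posrE ?ltr0n // ler_nat wmin.
  have := lle N N0; rewrite /a ler_pdivlMr ?ltr0n // ler_pdivlMr ?ln2_gt0 //.
  by rewrite mulrAC.
- move=> c lc; near=> N; exists (w N); first by have [] := wP N.
  have N0 : (0 < N)%N by near: N; exact: nbhs_infty_gt.
  rewrite mulrAC -ltr_pdivrMr ?ln2_gt0 // -ltr_pdivrMr ?ltr0n //.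
  by near: N; apply: llt.
Unshelve. all: by end_near. Qed.

End Entropy.

(** * Mean dimension is at most metric mean dimension *)

Section LindenstraussWeiss.
Context {R : realType} {X : topologicalType}.
Implicit Types (e : R).
Variables (T : X -> X) (d0 d : X -> X -> R).
Hypotheses (cX : compact [set: X]) (cT : continuous T).
Hypotheses (d0c : compatible_metric d0) (dc : compatible_metric d).

Lemma limf_esup_lt (f : R -> \bar R) (c : \bar R) : (limf_esup f 0^'+ < c)%E ->
  exists2 r : R, 0 < r & forall e, 0 < e < r -> (f e < c)%E.
Proof.
rewrite limf_esupE => /ereal_inf_lt[_ [A [r /= r0 rA] <-]] h.
exists r => // e /andP[e0 er]; apply: le_lt_trans h; apply: ereal_sup_ubound.
by exists e => //; apply: rA => //=; rewrite sub0r normrN gtr0_norm.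
Qed.

Lemma limf_esup_le (f : R -> \bar R) (c r : R) : 0 < r ->
  (forall e, 0 < e < r -> (f e <= c%:E)%E) -> (limf_esup f 0^'+ <= c%:E)%E.
Proof.
move=> r0 h; rewrite limf_esupE; apply: ge_ereal_inf.
exists (ereal_sup (f @` [set e | 0 < e < r])).
  exists [set e | 0 < e < r] => //; exists r => //= e /=.
  by rewrite sub0r normrN => er e0; rewrite e0 -(gtr0_norm e0).
by apply: ge_ereal_sup => _ [e /= he <-]; exact: h.
Qed.

Definition clamp (v eta t : R) := Num.max 0 (Num.min 1 ((t - v + eta) / (2 * eta))).

Lemma clamp01 v eta t : 0 <= clamp v eta t <= 1.
Proof. by rewrite /clamp le_max lexx /= ge_max ler01 ge_min lexx. Qed.

Lemma clamp_interior v eta t : 0 < eta -> 0 < clamp v eta t < 1 -> `|t - v| < eta.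
Proof.
move=> eta0; rewrite /clamp lt_max ltxx /= lt_min ltr01 /= gt_max ltr01 /= gt_min ltxx /=.
have e2 : 0 < 2 * eta by rewrite mulr_gt0.
rewrite ltr_pdivrMr // mul1r => /andP[].
rewrite pmulr_lgt0 ?invr_gt0 // => h1 h2.
by rewrite ltr_norml; apply/andP; split; lra.
Qed.

Lemma clamp_eq1 v eta : 0 < eta -> v <= 1 - eta -> clamp v eta 1 = 1.
Proof.
move=> eta0 v1; rewrite /clamp (min_l _) ?(max_r _) //.
by rewrite ler_pdivlMr ?mulr_gt0 //; lra.
Qed.

Lemma clamp_eq1_gt0 v eta t : 0 < eta -> eta <= v -> clamp v eta t = 1 -> 0 < t.
Proof.
move=> eta0 v1 h; rewrite ltNge; apply/negP => t0.
have : 0 < clamp v eta t by rewrite h.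
have e2 : 0 < 2 * eta by rewrite mulr_gt0.
rewrite /clamp lt_max ltxx /= lt_min ltr01 /= pmulr_lgt0 ?invr_gt0 //; lra.
Qed.

(** At scale [e] the orbits of length [N] are covered by about [e ^- (c * N)]
    sets, on each of which the coordinates [F] are nearly constant, and a grid
    that such a coordinate hits at no more than one point has about [1 / e]
    points.  By [grid_avoidance] there is a grid point [xi] that every point
    of the image of [F] avoids in all but about [c * N] coordinates.  Clamping
    around [xi] sends the avoiding coordinates to [0] and [1], and it still
    separates points, since the bumps take the value [1]. *)
Lemma mean_widim_le_mmdim (e0 c delta : R) : 0 < e0 -> 0 < delta ->
  (upper_mmdim T d < c%:E)%E -> (mean_widim T d0 e0 <= (c + delta)%:E)%E.
Proof.
move=> e00 del0 /limf_esup_lt[r r0 rP].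
have [I [f [C [[C0 cf] f01 f1 fe fC]]]] := bumps cX d0c dc e00.
(* [e] is so small that [delta * ln (1 / e)] exceeds the constants of the count *)
pose B := #|I|%:R * ln 2 + (c + delta) * ln (8 * C).
pose e := Num.min (r / 2) (Num.min (1 / 2) (Num.min (1 / (8 * C)) (expR (- B / delta)))).
have e_gt0 : 0 < e by rewrite !lt_min !divr_gt0 ?mulr_gt0 //= expR_gt0.
have er : e < r by rewrite gt_min; apply/orP; left; lra.
have e12 : e <= 1 / 2 by rewrite !ge_min lexx orbT.
have e8C : e <= 1 / (8 * C) by rewrite !ge_min lexx !orbT.
have eB : e <= expR (- B / delta) by rewrite !ge_min lexx !orbT.
have lneB : B <= - (delta * ln e).
  have : ln e <= - B / delta by rewrite -ler_expR lnK ?posrE.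
  by rewrite ler_pdivlMr //; lra.
have lne0 : ln e < 0.
  by rewrite -ln1 ltr_ln ?posrE //; lra.
have [l [lE l0 _ lc]] := entropyP cX dc cT e_gt0.
have lln : l < c * log2 e^-1.
  have := rP e; rewrite e_gt0 er lE -EFinM lte_fin => /(_ isT).
  rewrite ltr_pdivrMr // divr_gt0 ?ln2_gt0 // ln_gt0 // invf_gt1 //; lra.
have c0 : 0 < c.
  have h : 0 < log2 e^-1 by rewrite divr_gt0 ?ln2_gt0 // ln_gt0 // invf_gt1 //; lra.
  by rewrite -(pmulr_lgt0 c h); apply: le_lt_trans lln.
have [N [N0 [k [A [U [[k1 Ak] _ covU dU]]] kc]]] : exists N, (0 < N)%N /\
    exists2 k, small_cover (dynmetric T d N) e k & ln k%:R < c * log2 e^-1 * ln 2 * N%:R.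
  have [N _ hN] := filterI (nbhs_infty_gt 0) (lc _ lln).
  by exists N; apply: (hN N) => /=.
pose eta := C * e.
have eta0 : 0 < eta by rewrite mulr_gt0.
have eta8 : eta <= 1 / 8.
  by move: e8C; rewrite /eta ler_pdivlMr ?mulr_gt0 //; lra.
pose Q := Num.truncn (1 / (4 * eta)).
have Q1 : Q%:R * (4 * eta) <= 1.
  by rewrite -ler_pdivlMr ?mulr_gt0 // truncn_le divr_ge0 // mulr_ge0 // ltW.
have Q2 : 1 <= Q%:R * (8 * eta).
  have : 1 / (4 * eta) < Q.+1%:R by apply: truncnS_gt.
  by rewrite -natr1 ltr_pdivrMr ?mulr_gt0 //; lra.
pose K := Num.truncn ((c + delta) * N%:R).
have K1 : K%:R <= (c + delta) * N%:R.
  by rewrite truncn_le mulr_ge0 //; lra.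
have K2 : (c + delta) * N%:R < K.+1%:R by apply: truncnS_gt.
pose J := (I * 'I_N)%type.
pose F (j : J) x := f j.1 (iter j.2 T x).
have ptP (a : A) : exists o : option X, forall x, U a x ->
    exists2 y, o = Some y & U a y.
  have [[y Uy]|h] := pselect (exists y, U a y); first by exists (Some y) => x _; exists y.
  by exists None => x Ux; case: h; exists x.
have [pt {}ptP] := choice ptP.
pose g (t : 'I_Q) : R := (4 * t%:R + 2) * eta.
pose hit a (j : J) (t : 'I_Q) :=
  match pt a with Some y => `|F j y - g t| < 2 * eta | None => false end.
have [a j t t'||xi xiP] := @grid_avoidance J A Q K hit.
- rewrite /hit; case: (pt a) => // y; rewrite !ltr_norml => /andP[h1 h2] /andP[h3 h4].
  have h5 : (t%:R - t'%:R) * eta < 1 * eta by rewrite /g in h1 h2 h3 h4; lra.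
  have h6 : (t'%:R - t%:R) * eta < 1 * eta by rewrite /g in h1 h2 h3 h4; lra.
  rewrite !ltr_pM2r // in h5 h6.
  have {}h5 : (t < t'.+1)%N by rewrite -(ltr_nat R) -natr1; lra.
  have {}h6 : (t' < t.+1)%N by rewrite -(ltr_nat R) -natr1; lra.
  by apply: val_inj; apply/eqP; rewrite eqn_leq -ltnS h5 -ltnS h6.
- have Q0 : (0 < Q)%N.
    by rewrite lt0n; apply/negP => /eqP Q0; move: Q2; rewrite Q0 mul0r ler10.
  apply: (@leq_ltn_trans (k * 2 ^ #|{: J}|)); first by rewrite leq_mul2r Ak orbT.
  rewrite -(ltr_nat R) natrM !natrX -ltr_ln ?posrE ?mulr_gt0 ?exprn_gt0 ?ltr0n //.
  have QR : 0 < Q%:R :> R by rewrite ltr0n.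
  rewrite lnM ?posrE ?exprn_gt0 ?ltr0n // (lnXn _ (ltr0n R 2)) (lnXn K.+1 QR).
  rewrite -[ln 2 *+ _]mulr_natl -[ln _ *+ K.+1]mulr_natl card_prod card_ord natrM.
  have lnQ : - ln (8 * C) - ln e <= ln Q%:R.
    have : 0 <= ln (Q%:R * (8 * eta)) by rewrite ln_ge0.
    rewrite /eta mulrA !lnM ?posrE ?mulr_gt0 ?ltr0n //; lra.
  have logE : log2 e^-1 * ln 2 = - ln e by rewrite /log2 mulfVK ?gt_eqF ?ln2_gt0 // lnV ?posrE.
  have NR : 0 < N%:R :> R by rewrite ltr0n.
  have lnQ0 : 0 <= ln (Q%:R : R) by rewrite ln_ge0 // ler1n.
  have h1 : (c + delta) * N%:R * ln Q%:R <= K.+1%:R * ln Q%:R.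
    by rewrite ler_wpM2r // ltW.
  have h2 : (c + delta) * N%:R * (- ln (8 * C) - ln e) <= (c + delta) * N%:R * ln Q%:R.
    by rewrite ler_wpM2l // mulr_ge0 // ?(ltW NR) //; lra.
  have h3 : N%:R * B <= N%:R * - (delta * ln e) by rewrite ler_wpM2l // ltW.
  move: kc; rewrite -(mulrA c) logE => kc; rewrite /B in h3; lra.
have [w [wE wle _]] := mean_widimP cX d0c cT e00.
rewrite wE lee_fin; apply: (@le_trans _ _ (K%:R / N%:R)); last by rewrite ler_pdivrMr ?ltr0n.
apply: wle => //.
pose G j x := clamp (g (xi j)) eta (F j x).
have g1 t : eta <= g t.
  rewrite /g -{1}[eta]mul1r ler_pM2r //; have := ler0n R t; lra.
have g2 t : g t <= 1 - eta.
  have : (t.+1)%:R * (4 * eta) <= Q%:R * (4 * eta).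
    by rewrite ler_pM2r ?mulr_gt0 // ler_nat.
  rewrite /g -natr1; have := Q1; lra.
exists J, G; split.
- move=> j; apply: cont_max; first exact: cont_cst.
  apply: cont_min; first exact: cont_cst.
  apply: cont_mul; last exact: cont_cst.
  apply: cont_add; last exact: cont_cst.
  apply: cont_sub; last exact: cont_cst.
  by apply: (cont_comp (cf j.1)); apply: iter_continuous.
- by move=> j x; apply: clamp01.
- move=> x; have [a Ua] := covU x; have [y ya Uy] := ptP a x Ua.
  apply: leq_trans (size_undup _) _; apply: leq_trans (xiP a).
  rewrite size_map cardE; apply: uniq_leq_size; first by rewrite filter_uniq // enum_uniq.
  move=> j; rewrite mem_filter mem_enum => /andP[/(clamp_interior eta0) h _].
  rewrite inE /hit ya; have [e' e'e he'] := dU a.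
  have dyx : dynmetric T d N y x <= e by apply: le_trans (ltW e'e); apply: he'.
  have h2 : `|F j y - F j x| <= eta.
    apply: le_trans (fC _ _ _) _; rewrite ler_pM2l //.
    exact: (dynmetric_leP _ _ _ _ _ (ltW e_gt0)).1 dyx _ (ltn_ord j.2).
  have -> : F j y - g (xi j) = (F j y - F j x) + (F j x - g (xi j)) by lra.
  by apply: le_lt_trans (ler_normD _ _) _; lra.
- move=> x y Gxy; apply/dynmetric_ltP => // n nN.
  have [i fi] := f1 (iter n T x).
  have := Gxy (i, Ordinal nN); rewrite /G /F /= fi clamp_eq1 // => /esym.
  by move=> /(clamp_eq1_gt0 eta0 (g1 _)) fy; apply: (fe i) => //; rewrite fi.
Qed.

(** The inequality of Lindenstrauss and Weiss. *)
Lemma mdim_le_upper_mmdim : (mdim_of_metric T d0 <= upper_mmdim T d)%E.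
Proof.
apply: mdim_le => // e0 e00.
have [w [wE w0 _]] := mean_widimP cX d0c cT e00; rewrite wE.
case U : (upper_mmdim T d) => [u| |]; last 1 first.
- exfalso.
  have h : (mean_widim T d0 e0 <= (w - 2 + 1)%:E)%E.
    by apply: mean_widim_le_mmdim => //; rewrite U ltNyr.
  by move: h; rewrite wE lee_fin; lra.
- rewrite lee_fin; apply/ler_addgt0Pr => c c0.
  have c2 : 0 < c / 2 by lra.
  rewrite -lee_fin -wE [X in (u + X)%R](_ : _ = c / 2 + c / 2) ?addrA; last lra.
  by apply: mean_widim_le_mmdim => //; rewrite U lte_fin; lra.
- by rewrite leey.
Qed.

End LindenstraussWeiss.

(** * Counting by labels *)

Section Splits.
Context {R : realType} {X : Type}.
Implicit Types (A : X -> Prop) (E : X -> X -> Prop).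

(** Labels are used instead of covers because they can be paired, restricted
    to fibres and pulled back without a choice of points. *)
Definition splits A E (k : nat) :=
  exists l : X -> nat, (forall x, A x -> (l x < k)%N) /\
    forall x y, A x -> A y -> l x = l y -> E x y.

Lemma splits_weaken A A' E E' k k' : splits A E k -> (k <= k')%N ->
  (forall x, A' x -> A x) -> (forall x y, A' x -> A' y -> E x y -> E' x y) ->
  splits A' E' k'.
Proof.
move=> [l [lk lE]] kk' AA EE; exists l; split.
  by move=> x /AA /lk h; exact: leq_trans h kk'.
by move=> x y hx hy e; apply: EE => //; apply: lE => //; exact: AA.
Qed.

Lemma splits_empty A E k : (forall x, ~ A x) -> splits A E k.
Proof. by move=> h; exists (fun=> 0%N); split => x; [move/h|move=> ? /h]. Qed.

Lemma splits_true A : splits A (fun _ _ => True) 1.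
Proof. by exists (fun=> 0%N). Qed.

Lemma splits_comp (f : X -> X) A E k : splits A E k ->
  splits (A \o f) (fun x y => E (f x) (f y)) k.
Proof.
by move=> [l [lk lE]]; exists (l \o f); split => [x /lk|x y hx hy /lE] //=; apply.
Qed.

Lemma splits_and A E1 E2 k1 k2 : splits A E1 k1 -> splits A E2 k2 ->
  splits A (fun x y => E1 x y /\ E2 x y) (k1 * k2).
Proof.
move=> [l1 [lk1 lE1]] [l2 [lk2 lE2]].
exists (fun x => l1 x * k2 + l2 x)%N; split.
  move=> x Ax; have := lk1 x Ax; have := lk2 x Ax; nia.
move=> x y Ax Ay e.
have h2 : l2 x = l2 y.
  have := congr1 (modn^~ k2) e.
  by rewrite /= !modnMDl !modn_small //; exact: lk2.
have h1 : l1 x = l1 y.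
  move: e; rewrite h2 => /addIn /eqP.
  rewrite eqn_pmul2r => [/eqP //|].
  by apply: leq_ltn_trans (leq0n _) (lk2 x Ax).
by split; [apply: lE1|apply: lE2].
Qed.

Lemma splits_fiber (I : finType) (l0 : X -> I) A E k :
  (forall i, splits (fun x => A x /\ l0 x = i) E k) ->
  splits A (fun x y => E x y /\ l0 x = l0 y) (#|I| * k).
Proof.
move=> h; have [l lP] := choice h.
have h0 : splits A (fun x y => l0 x = l0 y) #|I|.
  exists (fun x => enum_rank (l0 x) : nat); split=> [x _|x y _ _ e].
    exact: ltn_ord.
  by apply: enum_rank_inj; apply: val_inj.
have h1 : splits A (fun x y => l0 x = l0 y -> E x y) k.
  exists (fun x => l (l0 x) x); split=> [x Ax|x y Ax Ay e exy].
    by have [h1 _] := lP (l0 x); apply: h1.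
  have [_ h2] := lP (l0 x); apply: h2 => //; rewrite e exy //.
apply: splits_weaken (splits_and h0 h1) _ _ _ => //.
by move=> x y _ _ [e /(_ e) hE]; split.
Qed.

Lemma splits_all (I : eqType) (s : seq I) A (E : I -> X -> X -> Prop) k :
  (forall i, i \in s -> splits A (E i) k) ->
  splits A (fun x y => forall i, i \in s -> E i x y) (k ^ size s).
Proof.
elim: s => [|i s IH] h.
  by apply: splits_weaken (splits_true A) _ _ _.
have h1 := h i (mem_head _ _).
have h2 : splits A (fun x y => forall j, j \in s -> E j x y) (k ^ size s).
  by apply: IH => j js; apply: h; rewrite inE js orbT.
rewrite /= expnS; apply: splits_weaken (splits_and h1 h2) _ _ _ => //.
by move=> x y _ _ [e1 e2] j; rewrite inE => /orP[/eqP ->|/e2].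
Qed.

Lemma splits_real A (g : X -> R) (B e : R) : 0 < e ->
  (forall x, A x -> 0 <= g x <= B) ->
  splits A (fun x y => `|g x - g y| <= e) (Num.truncn (B / e)).+1.
Proof.
move=> e0 gB; exists (fun x => Num.truncn (g x / e)); split.
  move=> x Ax; have /andP[g0 gb] := gB x Ax.
  rewrite ltnS truncn_le_nat; apply: le_lt_trans (truncnS_gt _).
  by rewrite ler_pM2r // invr_gt0.
move=> x y Ax Ay exy.
have /andP[gx _] := gB x Ax; have /andP[gy _] := gB y Ay.
have hx : (Num.truncn (g x / e))%:R <= g x / e by rewrite truncn_le divr_ge0 // ltW.
have hy : (Num.truncn (g y / e))%:R <= g y / e by rewrite truncn_le divr_ge0 // ltW.
have hx' : g x / e < (Num.truncn (g x / e)).+1%:R := truncnS_gt _.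
have hy' : g y / e < (Num.truncn (g y / e)).+1%:R := truncnS_gt _.
rewrite exy in hx hx'; rewrite -natr1 in hx' hy'.
have h : `|g x / e - g y / e| <= 1 by rewrite ler_norml; apply/andP; split; lra.
move: h; rewrite -mulrBl normrM [`|e^-1|]gtr0_norm ?invr_gt0 //.
by rewrite ler_pdivrMr // mul1r.
Qed.

(** There are [2 ^ #|I|] possible supports, whatever [e] is, and only the
    coordinates in the support cost a real parameter each. *)
Lemma splits_sparse (I : finType) A (g : I -> X -> R) (B e : R) m : 0 < e ->
  (forall i x, A x -> 0 <= g i x <= B) ->
  (forall x, A x -> (#|[pred i | (0 < g i x)%R]| <= m)%N) ->
  splits A (fun x y => forall i, `|g i x - g i y| <= e)
    (2 ^ #|I| * (Num.truncn (B / e)).+1 ^ m).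
Proof.
move=> e0 gB gm; pose l0 x := [set i | (0 < g i x)%R]%SET.
have -> : (2 ^ #|I| = #|{: {set I}}|)%N by rewrite -cardsT -card_powerset powersetT cardsT.
apply: splits_weaken (splits_fiber (l0 := l0) (A := A)
  (E := fun x y => forall i, `|g i x - g i y| <= e) _) _ _ _ => //; last first.
  by move=> x y _ _ [].
move=> s; have [sm|ms] := leqP #|s| m; last first.
  apply: splits_empty => x [Ax lx]; move: ms.
  by rewrite -lx ltnNge /l0 cardsE gm.
have h i : i \in enum s -> splits (fun x => A x /\ l0 x = s)
    (fun x y => `|g i x - g i y| <= e) (Num.truncn (B / e)).+1.
  by move=> _; apply: splits_real => // x [Ax _]; apply: gB.
apply: splits_weaken (splits_all h) _ _ _ => //.
  by rewrite -cardE leq_pexp2l.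
move=> x y [Ax lx] [Ay ly] hE i; have [is_|ins] := boolP (i \in s).
  by apply: hE; rewrite mem_enum.
have zero z : A z -> l0 z = s -> g i z = 0.
  move=> Az lz; have /andP[h0 _] := gB i z Az; apply/eqP; rewrite eq_le h0 andbT.
  by rewrite leNgt; apply: contra ins; rewrite -lz inE.
by rewrite !zero // subrr normr0 ltW.
Qed.

End Splits.

Section Counting.

Lemma sparse_times_count (N g : nat) (P : pred nat) : (0 < g)%N ->
  (forall n m, P n -> P m -> (n < m)%N -> (n + g <= m)%N) ->
  (#|[pred n : 'I_N | P n]| <= (N %/ g).+1)%N.
Proof.
move=> g0 gap; pose f (n : 'I_N) : 'I_(N %/ g).+1 := inord (n %/ g)%N.
have fE (n : 'I_N) : (f n = n %/ g :> nat)%N.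
  by rewrite inordK // ltnS leq_div2r // ltnW.
rewrite -[leqRHS]card_ord; apply: (@leq_card_in _ _ f).
have lt (n m : nat) : P n -> P m -> (n < m)%N -> (n %/ g < m %/ g)%N.
  move=> Pn Pm nm; have := gap _ _ Pn Pm nm.
  move=> /(leq_div2r g); rewrite divnDr ?dvdnn // divnn g0 addn1.
  by [].
move=> n m; rewrite !inE => Pn Pm e; apply: val_inj.
have {}e : (n %/ g = m %/ g)%N by rewrite -!fE e.
case: (ltngtP n m) => // nm.
  by have := lt _ _ Pn Pm nm; rewrite e ltnn.
by have := lt _ _ Pm Pn nm; rewrite e ltnn.
Qed.

End Counting.

(** * Functionals of the orbit of a point *)

Section LocalFunctionals.
Context {R : realType} {X : topologicalType} {V : finType}.
Variable T : X -> X.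
Hypothesis cT : continuous T.
Implicit Types (u : V -> X -> R) (x y : X).

Definition in01 u := forall i x, 0 <= u i x <= 1.

(** The point and the functions vary together, so that one estimate expresses
    both the dependence on the orbit, which is read along a window of length
    [w], and the stability under perturbations of the functions. *)
Definition local_lipschitz (G : (V -> X -> R) -> X -> R) :=
  exists (C : R) (w : nat),
  [/\ 0 <= C, forall u x, in01 u -> `|G u x| <= C
    & forall u u' x y t, in01 u -> in01 u' -> 0 <= t ->
        (forall n i, (n <= w)%N -> `|u i (iter n T x) - u' i (iter n T y)| <= t) ->
        `|G u x - G u' y| <= C * t].

Lemma local_cst (c : R) : local_lipschitz (fun _ _ => c).
Proof.
exists `|c|, 0%N; split => // u u' x y t _ _ t0 _.
by rewrite subrr normr0 mulr_ge0.
Qed.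

Lemma local_coord i : local_lipschitz (fun u x => u i x).
Proof.
exists 1, 0%N; split => // [u x /(_ i x) /andP[h0 h1]|u u' x y t _ _ _ /(_ 0%N i isT) h].
  by rewrite ger0_norm.
by rewrite mul1r.
Qed.

Lemma local_shift G : local_lipschitz G -> local_lipschitz (fun u x => G u (T x)).
Proof.
move=> [C [w [C0 GC Glip]]]; exists C, w.+1; split => // [u x h|u u' x y t hu hu' t0 h].
  exact: GC.
by apply: Glip => // n i nw; rewrite -!iterSr; apply: h.
Qed.

Lemma local_iter n G : local_lipschitz G ->
  local_lipschitz (fun u x => G u (iter n T x)).
Proof.
elim: n => // n IH h; have := local_shift (IH h); congr local_lipschitz.
by apply/funext => u; apply/funext => x; rewrite -iterSr.
Qed.

Lemma local_add G H : local_lipschitz G -> local_lipschitz H ->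
  local_lipschitz (fun u x => G u x + H u x).
Proof.
move=> [C [w [C0 GC Glip]]] [D [v [D0 HD Hlip]]].
exists (C + D), (maxn w v); split => [|u x hu|u u' x y t hu hu' t0 h].
- exact: addr_ge0.
- by apply: le_trans (ler_normD _ _) _; apply: lerD; [apply: GC|apply: HD].
have hG := Glip u u' x y t hu hu' t0 (fun n i nw => h n i (leq_trans nw (leq_maxl _ _))).
have hH := Hlip u u' x y t hu hu' t0 (fun n i nw => h n i (leq_trans nw (leq_maxr _ _))).
have -> : G u x + H u x - (G u' y + H u' y) = (G u x - G u' y) + (H u x - H u' y) by ring.
by apply: le_trans (ler_normD _ _) _; rewrite mulrDl lerD.
Qed.

Lemma local_mul G H : local_lipschitz G -> local_lipschitz H ->
  local_lipschitz (fun u x => G u x * H u x).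
Proof.
move=> [C [w [C0 GC Glip]]] [D [v [D0 HD Hlip]]].
exists (C * D *+ 2), (maxn w v); split => [|u x hu|u u' x y t hu hu' t0 h].
- by rewrite mulrn_wge0 // mulr_ge0.
- rewrite normrM mulr2n; have h1 : `|G u x| * `|H u x| <= C * D.
    by apply: ler_pM => //; [apply: GC|apply: HD].
  by have := mulr_ge0 C0 D0; lra.
have hG := Glip u u' x y t hu hu' t0 (fun n i nw => h n i (leq_trans nw (leq_maxl _ _))).
have hH := Hlip u u' x y t hu hu' t0 (fun n i nw => h n i (leq_trans nw (leq_maxr _ _))).
have -> : G u x * H u x - G u' y * H u' y
  = (G u x - G u' y) * H u x + G u' y * (H u x - H u' y) by ring.
apply: le_trans (ler_normD _ _) _; rewrite !normrM.
have h1 : `|G u x - G u' y| * `|H u x| <= C * t * D by apply: ler_pM => //; apply: HD.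
have h2 : `|G u' y| * `|H u x - H u' y| <= C * (D * t) by apply: ler_pM => //; apply: GC.
by rewrite mulr2n; lra.
Qed.

Lemma local_sum (I : Type) (s : seq I) (P : pred I) G :
  (forall k : I, local_lipschitz (G k)) ->
  local_lipschitz (fun u x => \sum_(k <- s | P k) G k u x).
Proof.
move=> h; elim: s => [|k s IH].
  have := local_cst 0; congr local_lipschitz.
  by apply/funext => u; apply/funext => x; rewrite big_nil.
have : local_lipschitz (fun u x =>
    (if P k then G k u x else 0) + \sum_(k <- s | P k) G k u x).
  by apply: local_add => //; case: (P k); [exact: h|exact: local_cst].
congr local_lipschitz; apply/funext => u; apply/funext => x.
by rewrite big_cons; case: (P k) => //; rewrite add0r.
Qed.

Lemma local_post (kappa : R -> R) (D : R -> Prop) (B K : R) G :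
  local_lipschitz G -> (forall u x, in01 u -> D (G u x)) -> 0 <= B -> 0 <= K ->
  (forall s, D s -> `|kappa s| <= B) ->
  (forall s t, D s -> D t -> `|kappa s - kappa t| <= K * `|s - t|) ->
  local_lipschitz (fun u x => kappa (G u x)).
Proof.
move=> [C [w [C0 GC Glip]]] GD B0 K0 kB kK.
exists (B + K * C), w; split => [|u x hu|u u' x y t hu hu' t0 h].
- by rewrite addr_ge0 ?mulr_ge0.
- by apply: le_trans (kB _ (GD _ _ hu)) _; rewrite lerDl mulr_ge0.
have hG := Glip u u' x y t hu hu' t0 h.
apply: le_trans (kK _ _ (GD _ _ hu) (GD _ _ hu')) _.
apply: (@le_trans _ _ (K * (C * t))); first by rewrite ler_wpM2l.
by rewrite mulrDl -mulrA lerDr mulr_ge0.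
Qed.

Lemma local_continuous G u : local_lipschitz G -> in01 u ->
  (forall i, continuous (u i)) -> continuous (G u).
Proof.
move=> [C [w [C0 _ Glip]]] hu cu x; apply/cvgrPdist_lt => e e0.
have e1 : 0 < e / (C + 1) by rewrite divr_gt0 // ltr_wpDl.
have : nbhs x [set y | forall (n : 'I_w.+1) i,
    `|u i (iter n T x) - u i (iter n T y)| < e / (C + 1)].
  apply: filter_forall => n; apply: filter_forall => i.
  have ci : continuous (fun z => u i (iter n T z)).
    by apply: cont_comp => //; exact: iter_continuous.
  exact: (@cont_near _ _ _ x _ ci e1).
apply: filterS => y hy.
have h : `|G u x - G u y| <= C * (e / (C + 1)).
  apply: Glip => //; first exact: ltW.
  by move=> n i nw; rewrite -ltnS in nw; apply/ltW/(hy (Ordinal nw)).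
apply: le_lt_trans h _.
rewrite mulrA ltr_pdivrMr ?ltr_wpDl //; lra.
Qed.

End LocalFunctionals.

(** * Markers, the time to the next marker, and its residue *)

Section Markers.
Context {R : realType} {X : topologicalType}.
Variables (T S : X -> X) (d : X -> X -> R).
Hypotheses (cX : compact [set: X]) (dc : compatible_metric d).
Hypotheses (TS : cancel T S) (ST : cancel S T) (cT : continuous T) (cS : continuous S).

Lemma iter_shift n m x : (n <= m)%N -> iter n S (iter m T x) = iter (m - n) T x.
Proof.
move=> nm; rewrite -{1}(subnKC nm); move: (m - n)%N => k.
by rewrite iterD; elim: n {nm} => // n IH; rewrite iterSr /= TS.
Qed.

(** By compactness finitely many translates of the marker set cover [X], which
    bounds the waiting time; bump functions inside the marker set replace it
    by a weight that is continuous. *)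
Lemma marker_function (g : nat) : (0 < g)%N -> marker_property T ->
  exists (h : X -> R) (M : nat),
  [/\ continuous h, forall x, 0 <= h x <= 1,
      forall x, exists2 i, (i < M)%N & h (iter i T x) = 1
    & forall x n, (0 < n)%N -> (n <= g)%N -> 0 < h x -> h (iter n T x) = 0].
Proof.
move=> g0 /(_ g g0)[U [oU covU sepU]].
have hit y : exists ab : nat * nat, U (iter ab.1 T (iter ab.2 S y)).
  have : [set: X] y by []. rewrite -covU => -[[k|k] _ /=].
    by exists (k, 0%N).
  move=> [z Uz <-]; exists (0%N, k.+1) => /=.
  by have := @iter_shift k.+1 k.+1 z (leqnn _); rewrite subnn /= => ->.
have [ab abP] := choice hit.
have rad y : exists r : R, 0 < r /\
    forall z, d (iter (ab y).1 T (iter (ab y).2 S y)) z < r -> U z.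
  have [|r r0 rP] := compatible_closed_neighbour dc (A := U)
      (x := iter (ab y).1 T (iter (ab y).2 S y)); last by exists r.
  by apply: open_nbhs_nbhs; split => //; exact: abP.
have [r rP] := choice rad.
have r0 y : 0 < r y by have [] := rP y.
pose p y := iter (ab y).1 T (iter (ab y).2 S y).
have near y : nbhs y [set z | d (p y) (iter (ab y).1 T (iter (ab y).2 S z)) < r y / 2].
  have c1 : continuous (fun z => d (p y) (iter (ab y).1 T (iter (ab y).2 S z))).
    have c0 : continuous (d (p y)) by exact: metric_continuous.
    have c2 : continuous (fun z => iter (ab y).1 T (iter (ab y).2 S z)).
      move=> z; apply: (continuous_comp (@iter_continuous _ S (ab y).2 cS z)).
      exact: iter_continuous.
    exact: (cont_comp c0 c2).
  apply: (@cont_near_lt _ _ _ y _ c1).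
  by have [[-> _ _ _] _] := dc; rewrite divr_gt0.
have [s sP] := finite_subcover cX near.
pose B := (\max_(i : seq_sub s) (ab (ssval i)).2)%N.
pose A := (\max_(i : seq_sub s) (ab (ssval i)).1)%N.
pose b (i : seq_sub s) := bump d (p (ssval i)) (r (ssval i)).
pose h z := \big[Num.max/0]_(i : seq_sub s) b i z.
have hU z : 0 < h z -> U z.
  move=> /bigmax_gtP[|[i _ /(bump_gt0 (r0 _)) hz]]; first by rewrite ltxx.
  by have [_] := rP (ssval i); apply.
exists h, (A + B).+1; split.
- by apply: cont_bigmax => i; apply: bump_continuous.
- move=> x; rewrite bigmax_ge_id; apply/bigmax_leP; split=> // i _.
  by have /andP[] := bump01 d (p (ssval i)) (r (ssval i)) x.
- move=> x; have [y ys hy] := sP (iter B T x); pose i := SeqSub ys.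
  have iB : ((ab y).2 <= B)%N.
    exact: (@leq_bigmax_cond _ predT (fun i : seq_sub s => (ab (ssval i)).2) i isT).
  have iA : ((ab y).1 <= A)%N.
    exact: (@leq_bigmax_cond _ predT (fun i : seq_sub s => (ab (ssval i)).1) i isT).
  exists ((ab y).1 + (B - (ab y).2))%N.
    by rewrite ltnS leq_add // leq_subr.
  move: hy; rewrite /= iter_shift // -iterD => hy.
  apply/eqP; rewrite eq_le; apply/andP; split.
    by apply/bigmax_leP; split=> // j _; have /andP[] := bump01 d (p (ssval j)) (r (ssval j)) (iter ((ab y).1 + (B - (ab y).2)) T x).
  rewrite -(bump_eq1 (r0 y) hy).
  exact: (le_bigmax _ (fun j => b j (iter ((ab y).1 + (B - (ab y).2)) T x)) i).
- move=> x n n0 ng /hU Ux.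
  apply/eqP; rewrite eq_le bigmax_ge_id andbT leNgt; apply/negP => /hU Unx.
  suff : set0 x by [].
  by rewrite -(sepU n) ?n0.
Qed.

End Markers.

Section ReturnTime.
Context {R : realType} {X : Type}.
Variables (T : X -> X) (h : X -> R).

(** The expected time to the next stop, or to time [M] if that comes first,
    when at each point [x] the walk along the orbit stops with probability
    [min 1 (2 * h x)].  If a stop before time [M] is certain, it decreases by
    exactly one at each step away from the support of [h]; unlike the set of
    markers it depends continuously on [x]. *)
Fixpoint return_time (M : nat) (x : X) : R :=
  if M is M'.+1 then (1 - Num.min 1 (2 * h x)) * (1 + return_time M' (T x)) else 0.

Hypothesis h01 : forall x, 0 <= h x <= 1.

Lemma return_time_ge0_le M x : 0 <= return_time M x <= M%:R.
Proof.
elim: M x => [|M IH] x /=; first by rewrite lexx.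
have /andP[h0 _] := h01 x; have /andP[r0 r1] := IH (T x).
have m0 : 0 <= Num.min 1 (2 * h x) by rewrite le_min ler01 mulr_ge0.
have m1 : Num.min 1 (2 * h x) <= 1 by rewrite ge_min lexx.
rewrite -natr1; apply/andP; split; first by apply: mulr_ge0; lra.
apply: (@le_trans _ _ (1 * (1 + return_time M (T x)))); last by lra.
by apply: ler_wpM2r; lra.
Qed.

Lemma return_time_stable M x : (exists2 i, (i < M)%N & 1 / 2 <= h (iter i T x)) ->
  return_time M.+1 x = return_time M x.
Proof.
elim: M x => [|M IH] x; first by case.
move=> [[|i] iM hi].
  have e : Num.min 1 (2 * h x) = 1 by rewrite min_l //; move: hi => /=; lra.
  by rewrite /= e subrr !mul0r.
have e : return_time M.+1 (T x) = return_time M (T x).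
  by apply: IH; exists i => //; rewrite -iterSr.
by rewrite -[LHS]/((1 - Num.min 1 (2 * h x)) * (1 + return_time M.+1 (T x))) e.
Qed.

End ReturnTime.

Section Sawtooth.
Context {R : realType}.
Variables (L : nat).
Hypothesis L1 : (1 < L)%N.
Implicit Types p s t : R.

Let L0 : 0 < L%:R :> R. Proof. by rewrite ltr0n ltnW. Qed.

Definition modL p := p - L%:R * (Num.truncn (p / L%:R))%:R.

Lemma modL_ge0_lt p : 0 <= p -> 0 <= modL p < L%:R.
Proof.
move=> p0; have h1 : (Num.truncn (p / L%:R))%:R <= p / L%:R.
  by rewrite truncn_le divr_ge0 // ltW.
have h2 : p / L%:R < (Num.truncn (p / L%:R)).+1%:R := truncnS_gt _.
move: h1 h2; rewrite ler_pdivlMr // ltr_pdivrMr // -natr1 /modL => h1 h2.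
by apply/andP; split; lra.
Qed.

Lemma modL_unique p (k : nat) : L%:R * k%:R <= p < L%:R * k%:R + L%:R ->
  modL p = p - L%:R * k%:R.
Proof.
move=> /andP[h1 h2]; rewrite /modL (_ : Num.truncn (p / L%:R) = k) //.
apply: truncn_def; rewrite ler_pdivlMr // ltr_pdivrMr // -natr1.
by apply/andP; split; lra.
Qed.

Lemma modL_pred p : 1 <= modL p -> 1 <= p -> modL (p - 1) = modL p - 1.
Proof.
move=> m1 p1; have p0 : 0 <= p by lra.
rewrite (@modL_unique (p - 1) (Num.truncn (p / L%:R))); first by rewrite /modL; lra.
by have := modL_ge0_lt p0; rewrite /modL in m1 *; lra.
Qed.

Lemma modL_wrap p : modL p < 1 -> 1 <= p -> modL (p - 1) = modL p - 1 + L%:R.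
Proof.
move=> m1 p1; have p0 : 0 <= p by lra.
have LR : 2 <= L%:R :> R by rewrite ler_nat.
have := modL_ge0_lt p0; rewrite /modL in m1 *.
case E: (Num.truncn (p / L%:R)) m1 => [|k]; first by rewrite mulr0; lra.
rewrite -natr1 => m1 h.
by rewrite -/(modL (p - 1)) (@modL_unique (p - 1) k); lra.
Qed.

(** Across a jump of [modL] both values are compared with the common value
    [0] of [g] at the ends of the period. *)
Lemma modL_lipschitz (g : R -> R) (K : R) p p' : 0 <= K -> 0 <= p -> 0 <= p' ->
  g 0 = 0 -> g L%:R = 0 ->
  (forall s t, 0 <= s <= L%:R -> 0 <= t <= L%:R -> `|g s - g t| <= K * `|s - t|) ->
  `|g (modL p) - g (modL p')| <= K * `|p - p'|.
Proof.
move=> K0 p0 p'0 g0 gL glip.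
wlog pp' : p p' p0 p'0 / p <= p'.
  move=> W; have [/W|/ltW /W] := leP p p'; first by apply.
  by rewrite distrC (distrC p); apply.
have /andP[a1 a2] := modL_ge0_lt p0; have /andP[b1 b2] := modL_ge0_lt p'0.
have mono : (Num.truncn (p / L%:R) <= Num.truncn (p' / L%:R))%N.
  rewrite truncn_ge_nat ?divr_ge0 ?(ltW L0) //; apply: (@le_trans _ _ (p / L%:R)).
    by rewrite truncn_le divr_ge0 // ltW.
  by rewrite ler_pM2r ?invr_gt0.
rewrite (distrC p) (ger0_norm (_ : 0 <= p' - p)) ?subr_ge0 //.
have [same|diff] := eqVneq (Num.truncn (p / L%:R)) (Num.truncn (p' / L%:R)).
  apply: (@le_trans _ _ (K * `|modL p - modL p'|)).
    by apply: glip; apply/andP; split => //; exact: ltW.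
  by rewrite /modL same ler_wpM2l // ler_norml; apply/andP; split; lra.
have lt : (Num.truncn (p / L%:R)).+1%:R <= (Num.truncn (p' / L%:R))%:R :> R.
  by rewrite ler_nat ltn_neqAle diff mono.
have h1 : `|g (modL p)| <= K * (L%:R - modL p).
  have := glip (modL p) L%:R; rewrite gL subr0 a1 (ltW a2) lexx (ltW L0) => /(_ isT isT).
  by rewrite distrC (ger0_norm (_ : 0 <= L%:R - modL p)) // subr_ge0 ltW.
have h2 : `|g (modL p')| <= K * modL p'.
  have := glip (modL p') 0; rewrite g0 !subr0 b1 lexx (ltW b2) (ltW L0) => /(_ isT isT).
  by rewrite (ger0_norm b1).
apply: le_trans (ler_normB _ _) _; apply: le_trans (lerD h1 h2) _.
rewrite -mulrDr ler_wpM2l // /modL.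
by have := ler_wpM2l (ltW L0) lt; rewrite -natr1; lra.
Qed.

End Sawtooth.

(** * The code of a block *)

Section Kernels.
Context {R : realType}.
Implicit Types s t r : R.

Definition spike t : R := Num.max 0 (1 - 3 * `|t|).
Definition hump t : R := Num.max 0 (Num.min (3 * t) (2 - 3 * t)).

Lemma spike01 t : 0 <= spike t <= 1.
Proof. by rewrite /spike le_max lexx /= ge_max ler01 /=; have := normr_ge0 t; lra. Qed.

Lemma hump01 t : 0 <= hump t <= 1.
Proof.
rewrite /hump le_max lexx /= ge_max ler01 /= ge_min.
by apply/orP; case: (lerP t (1 / 3)) => ?; [left|right]; lra.
Qed.

Lemma spike_lip s t : `|spike s - spike t| <= 3 * `|s - t|.
Proof.
apply: le_trans (max_lip _ _ _) _.
have := ler_dist_dist s t; rewrite !ler_norml => /andP[h1 h2].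
by apply/andP; split; lra.
Qed.

Lemma hump_lip s t : `|hump s - hump t| <= 3 * `|s - t|.
Proof.
apply: le_trans (max_lip _ _ _) _.
have := ler_norm (s - t); have := ler_norm (t - s); rewrite (distrC t) => h1 h2.
by case: (lerP (3 * s) (2 - 3 * s)) => ?; case: (lerP (3 * t) (2 - 3 * t)) => ?;
  rewrite ler_norml; apply/andP; split; lra.
Qed.

Lemma spike_opp t : spike (- t) = spike t.
Proof. by rewrite /spike normrN. Qed.

Lemma spike_eq0 t : 1 / 3 <= `|t| -> spike t = 0.
Proof. by move=> h; rewrite /spike max_l //; lra. Qed.

Lemma spike_gt0 t : `|t| < 1 / 3 -> 0 < spike t.
Proof. by move=> h; rewrite /spike lt_max; apply/orP; right; lra. Qed.

Lemma hump_eq0 t : t <= 0 \/ 2 / 3 <= t -> hump t = 0.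
Proof.
by move=> h; rewrite /hump max_l // ge_min; apply/orP; case: h => ?; [left|right]; lra.
Qed.

Lemma hump_gt0 t : 0 < t < 2 / 3 -> 0 < hump t.
Proof. by move=> /andP[? ?]; rewrite /hump lt_max lt_min; apply/orP; right; apply/andP; split; lra. Qed.

End Kernels.

Section BlockCode.
Context {R : realType} {X : Type} {V W : finType}.
Variables (T : X -> X) (L q : nat) (before after : 'I_q -> V -> W).
Implicit Types (rho : V -> X -> R) (U : X -> R).

(** An interpolation between integer times that moves with the orbit, so that
    by [window_shift] the code of a block stays the same along the block. *)
Definition window (alpha : R -> R) U (r : R) (x : X) : R :=
  \sum_(n < L.+1) alpha (r - n%:R) * U (iter n T x).

(** The simplicial map of nerves that extends [p], in unnormalized barycentric
    coordinates. *)
Definition push (p : V -> W) w rho x : R := \sum_(v | p v == w) rho v x.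

(** The code of a block that ends at real time [r].  Just after an integer
    time [n] it shows a multiple of the point [rho (T^n x)] of the fine nerve
    and a multiple of its image by [after], and just before [n + 1] a multiple
    of [rho (T^(n+1) x)] and one of its image by [before].  In between there
    only remains a mixture of the image of [rho (T^n x)] by [after] and of
    that of [rho (T^(n+1) x)] by [before], for each [i] two points of the
    coarse nerve that have their supports in one simplex.  The code moves from
    one point of the fine nerve to the next without ever needing the
    parameters of both. *)
Definition code rho (r : R) (x : X) (j : V + 'I_q * W) : R :=
  match j with
  | inl v => window spike (rho v) r x
  | inr iw => window hump (push (after iw.1) iw.2 rho) r x
            + window (fun t => hump (- t)) (push (before iw.1) iw.2 rho) r x
  end.

Lemma window_two alpha U r x : (forall t, 1 <= `|t| -> alpha t = 0) ->
  0 <= r < L%:R ->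
  let n := Num.truncn r in
  window alpha U r x = alpha (r - n%:R) * U (iter n T x)
                     + alpha (r - n%:R - 1) * U (iter n.+1 T x).
Proof.
move=> a0 /andP[r0 rL] n.
have n1 : n%:R <= r by rewrite truncn_le.
have n2 : r < n.+1%:R by apply: truncnS_gt.
have nL : (n < L)%N by rewrite -(ltr_nat R); apply: le_lt_trans rL.
have nL1 : (n < L.+1)%N by apply: ltnW.
rewrite /window (bigD1 (Ordinal nL1)) //=; congr (_ + _).
rewrite (bigD1 (Ordinal (nL : (n.+1 < L.+1)%N))) /=; last first.
  by rewrite -val_eqE /= gtn_eqF.
rewrite big1 ?addr0 => [|k /andP[k1 k2]].
  by rewrite -natr1 opprD addrA.
rewrite a0 ?mul0r //.
move: k1 k2; rewrite -!val_eqE /= => k1 k2.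
have [kn|kn] := ltnP k n.
  have : (k.+1)%:R <= n%:R :> R by rewrite ler_nat.
  by rewrite -natr1 => h; rewrite ger0_norm; lra.
have kn2 : (n.+2 <= k)%N.
  by rewrite ltn_neqAle eq_sym k2 ltn_neqAle eq_sym k1.
have : (n.+2)%:R <= k%:R :> R by rewrite ler_nat.
by rewrite -natr1 => h; rewrite ler0_norm; lra.
Qed.

Lemma window_shift alpha U r x : (forall t, 1 <= `|t| -> alpha t = 0) ->
  1 <= r < L%:R -> window alpha U (r - 1) (T x) = window alpha U r x.
Proof.
move=> a0 /andP[r1 rL].
rewrite !window_two //; try (apply/andP; split; lra).
case E: (Num.truncn r) => [|n].
  have : r < (Num.truncn r).+1%:R by apply: truncnS_gt.
  by rewrite E; lra.
have h1 : (Num.truncn r)%:R <= r by rewrite truncn_le; lra.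
have h2 : r < (Num.truncn r).+1%:R by apply: truncnS_gt.
rewrite E -!natr1 in h1 h2.
have -> : Num.truncn (r - 1) = n.
  by apply: truncn_def; rewrite -natr1; apply/andP; split; lra.
by rewrite -!iterSr -natr1 opprD !addrA (addrAC r (-1)).
Qed.

Let spike_supp (t : R) : 1 <= `|t| -> spike t = 0.
Proof. by move=> h; apply: spike_eq0; lra. Qed.

Let hump_supp (t : R) : 1 <= `|t| -> hump t = 0.
Proof.
by move=> h; apply: hump_eq0; have [t0|t0] := leP 0 t;
  [right; rewrite ger0_norm in h|left]; lra.
Qed.

Let hump_supp' (t : R) : 1 <= `|t| -> hump (- t) = 0.
Proof. by rewrite -normrN; exact: hump_supp. Qed.

Lemma code_shift rho r x j : 1 <= r < L%:R -> code rho (r - 1) (T x) j = code rho r x j.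
Proof. by case: j => [v|[i w]] hr /=; rewrite !window_shift. Qed.

Lemma code_two rho r x j : 0 <= r < L%:R ->
  let n := Num.truncn r in let s := r - n%:R in
  code rho r x j = match j with
  | inl v => spike s * rho v (iter n T x) + spike (1 - s) * rho v (iter n.+1 T x)
  | inr iw => hump s * push (after iw.1) iw.2 rho (iter n T x)
            + hump (1 - s) * push (before iw.1) iw.2 rho (iter n.+1 T x)
  end.
Proof.
move=> /andP[r0 rL] n s.
have n1 : n%:R <= r by rewrite truncn_le.
have n2 : r < n.+1%:R by apply: truncnS_gt.
rewrite -natr1 in n2.
have h : 0 <= r < L%:R by rewrite r0.
case: j => [v|[i w]] /=; rewrite !window_two // -/n -/s.
  by rewrite -(spike_opp (s - 1)) opprB.
have z1 : hump (s - 1) = 0 by apply: hump_eq0; left; rewrite /s; lra.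
have z2 : hump (- s) = 0 by apply: hump_eq0; left; rewrite /s; lra.
by rewrite /= z1 z2 !mul0r addr0 add0r opprB.
Qed.

End BlockCode.

Section Push.
Context {R : realType} {X : Type} {V W : finType}.
Variables (rho : V -> X -> R).
Hypothesis rho01 : forall v x, 0 <= rho v x <= 1.

Lemma push_ge0 (p : V -> W) w x : 0 <= push p w rho x.
Proof. by apply: sumr_ge0 => v _; have /andP[] := rho01 v x. Qed.

Lemma push_le (p : V -> W) w x : push p w rho x <= #|V|%:R.
Proof.
apply: (@le_trans _ _ (\sum_(v : V) 1)); last by rewrite sumr_const.
rewrite /push big_mkcond /=; apply: ler_sum => v _.
by have /andP[h0 h1] := rho01 v x; case: ifP.
Qed.

Lemma push_lip (p : V -> W) w x y e : 0 <= e -> (forall v, `|rho v x - rho v y| <= e) ->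
  `|push p w rho x - push p w rho y| <= #|V|%:R * e.
Proof.
move=> e0 h; rewrite /push -sumrB; apply: le_trans (ler_norm_sum _ _ _) _.
apply: (@le_trans _ _ (\sum_(v : V) e)); last by rewrite sumr_const mulr_natl.
by rewrite big_mkcond /=; apply: ler_sum => v _; case: ifP.
Qed.

Lemma push_gt0 (p : V -> W) w x : 0 < push p w rho x -> exists2 v, p v = w & 0 < rho v x.
Proof.
move=> h; apply: contrapT => nex; move: h; rewrite /push big1 ?ltxx // => v /eqP pv.
apply/eqP; rewrite eq_le; have /andP[-> _] := rho01 v x; rewrite andbT leNgt.
by apply/negP => h; apply: nex; exists v.
Qed.

End Push.

Section CodeSplits.
Context {R : realType} {X : Type} {V W : finType}.
Variables (T : X -> X) (L q : nat) (before after : 'I_q -> V -> W).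
Variables (rho : V -> X -> R) (r : X -> R) (active : X -> pred ('I_q * W)) (k1 k2 : nat).
Hypotheses (rho01 : forall v x, 0 <= rho v x <= 1)
  (rL : forall x, 0 <= r x < L%:R)
  (rho_order : forall x, (#|[pred v | (0 < rho v x)%R]| <= k2)%N)
  (active_order : forall x, (#|active x| <= k1)%N)
  (after_active : forall i v x, 0 < rho v x -> active x (i, after i v))
  (before_active : forall i v x, 0 < rho v (T x) -> active x (i, before i v)).

Let B : R := 2 * #|V|%:R + 1.
Let kappa := maxn k2.+1 k1.

Lemma prod_lip (a b c d e A : R) : 0 <= e -> 0 <= A -> `|a| <= 1 -> `|d| <= A ->
  `|a - b| <= 3 * e -> `|c - d| <= A * e -> `|a * c - b * d| <= 4 * A * e.
Proof.
move=> e0 A0 a1 dA ab cd.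
have -> : a * c - b * d = a * (c - d) + (a - b) * d by ring.
apply: le_trans (ler_normD _ _) _; rewrite !normrM.
have h1 : `|a| * `|c - d| <= 1 * (A * e) by apply: ler_pM.
have h2 : `|a - b| * `|d| <= 3 * e * A by apply: ler_pM.
lra.
Qed.

Let n x := Num.truncn (r x).
Let s x := r x - (n x)%:R.

Let s01 x : 0 <= s x <= 1.
Proof.
have /andP[r0 _] := rL x.
have h1 : (n x)%:R <= r x by rewrite truncn_le.
have h2 : r x < (n x).+1%:R by apply: truncnS_gt.
by rewrite -natr1 in h2; rewrite /s; apply/andP; split; lra.
Qed.

(** A block costs [kappa] real parameters: on each of the three parts of the
    unit interval that [tau] distinguishes, the code is determined by [s] and
    one point of the fine nerve or by the mixture of points of the coarse
    nerve. *)
Lemma code_splits e : 0 < e <= 1 ->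
  splits (fun _ : X => True)
    (fun x y => forall j, `|code T L before after rho (r x) x j
                         - code T L before after rho (r y) y j| <= 4 * B * e)
    (4 * (2 ^ (#|V| + #|{: 'I_q * W}|) * (Num.truncn (B / e)).+1 ^ kappa)).
Proof.
move=> /andP[e0 e1].
pose tau x := (s x <= 1 / 3, 2 / 3 <= s x).
set m := (Num.truncn (B / e)).+1.
have V0 : 0 <= #|V|%:R :> R by [].
have B1 : 1 <= B by rewrite /B; lra.
have B0 : 0 <= B by lra.
have Be : B * e <= 4 * B * e.
  by rewrite -mulrA ler_peMl ?ler1n // mulr_ge0 // ltW.
have tm : ((Num.truncn (1 / e)).+1 <= m)%N.
  rewrite ltnS truncn_ge_nat ?divr_ge0 ?(ltW e0) //.
  apply: (@le_trans _ _ (1 / e)); first by rewrite truncn_le divr_ge0 // ltW.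
  by rewrite ler_pM2r ?invr_gt0.
(* near an integer time: the time and the point of the fine nerve *)
have near (f : X -> X) (t : X -> R) (p : 'I_q -> V -> W) (A : X -> Prop) :
    (forall x, A x -> 0 <= t x <= 1) ->
    (forall x, A x -> forall j, code T L before after rho (r x) x j = match j with
      | inl v => spike (t x) * rho v (f x)
      | inr iw => hump (t x) * push (p iw.1) iw.2 rho (f x) end) ->
    splits A (fun x y => forall j, `|code T L before after rho (r x) x j
      - code T L before after rho (r y) y j| <= 4 * B * e)
     (2 ^ (#|V| + #|{: 'I_q * W}|) * m ^ kappa).
  move=> t01 codeE.
  have h1 := splits_real e0 t01.
  have h2 := @splits_sparse R X V A (fun v x => rho v (f x)) 1 e k2 e0
    (fun v x _ => rho01 v (f x)) (fun x _ => rho_order (f x)).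
  apply: splits_weaken (splits_and h1 h2) _ _ _ => //.
    rewrite mulnCA; apply: leq_mul; first by rewrite leq_pexp2l // leq_addr.
    rewrite -expnS; apply: (@leq_trans (m ^ k2.+1)); first by rewrite leq_exp2r.
    by rewrite leq_pexp2l // leq_maxl.
  move=> x y Ax Ay [tt hh] j; rewrite !codeE //.
  have nrm (a : R) : 0 <= a <= 1 -> `|a| <= 1 by move=> /andP[? ?]; rewrite ger0_norm.
  case: j => [v|[i w]] /=.
    apply: le_trans (prod_lip (e := e) (A := 1) _ _ _ _ _ _) _ => //; try exact: ltW.
    - by apply: nrm; apply: spike01.
    - by apply: nrm; apply: rho01.
    - by apply: le_trans (spike_lip _ _) _; rewrite ler_pM2l.
    - by rewrite mul1r.
    - by rewrite -!mulrA ler_pM2l // ler_wpM2r // ltW.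
  apply: le_trans (prod_lip (e := e) (A := #|V|%:R) _ _ _ _ _ _) _ => //; try exact: ltW.
  - by apply: nrm; apply: hump01.
  - by rewrite ger0_norm ?push_le ?push_ge0.
  - by apply: le_trans (hump_lip _ _) _; rewrite ler_pM2l.
  - by apply: push_lip => //; apply: ltW.
  - by rewrite -!mulrA ler_pM2l // ler_wpM2r ?ltW // /B; lra.
apply: splits_weaken (splits_fiber (l0 := tau) (A := fun=> True)
  (E := fun x y => forall j, `|code T L before after rho (r x) x j
      - code T L before after rho (r y) y j| <= 4 * B * e)
  (k := 2 ^ (#|V| + #|{: 'I_q * W}|) * m ^ kappa) _) _ _ _ => //; last 2 first.
- by rewrite card_prod card_bool.
- by move=> x y _ _ [].
move=> [[] b].
- apply: (near (fun x => iter (n x) T x) s after) => [x [_ [sx _]]|x [_ [sx _]] j].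
    exact: s01.
  have sx' := s01 x; rewrite code_two // -/(n x) -/(s x).
  case: j => [v|[i w]] /=.
    rewrite [spike (1 - _)]spike_eq0 ?mul0r ?addr0 // ger0_norm; lra.
  by rewrite [hump (1 - _)]hump_eq0 ?mul0r ?addr0 //; right; lra.
case: b.
- apply: (near (fun x => iter (n x).+1 T x) (fun x => 1 - s x) before).
    by move=> x _; have := s01 x; lra.
  move=> x [_ [_ sx]] j.
  have sx' := s01 x; rewrite code_two // -/(n x) -/(s x).
  case: j => [v|[i w]] /=.
    rewrite [spike (s x)]spike_eq0 ?mul0r ?add0r // ger0_norm; lra.
  by rewrite [hump (s x)]hump_eq0 ?mul0r ?add0r //; right; lra.
(* the middle: only the mixture of two points of the coarse nerve remains *)
set A : X -> Prop := fun x => _.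
have sA x : A x -> 1 / 3 <= s x <= 2 / 3.
  by move=> [_ []] /negbT; rewrite -ltNge => h /negbT; rewrite -ltNge => h'; apply/andP; split; lra.
pose g j x := hump (s x) * push (after j.1) j.2 rho (iter (n x) T x)
            + hump (1 - s x) * push (before j.1) j.2 rho (iter (n x).+1 T x).
have codeE x j : A x -> code T L before after rho (r x) x j =
    match j with inl _ => 0 | inr iw => g iw x end.
  move=> Ax; have /andP[sx1 sx2] := sA x Ax.
  rewrite code_two // -/(n x) -/(s x); case: j => [v|[i w]] //.
  by rewrite !spike_eq0 ?mul0r ?addr0 // ger0_norm; lra.
have gB j x : A x -> 0 <= g j x <= B.
  move=> _; have /andP[h1 h2] := hump01 (s x); have /andP[h3 h4] := hump01 (1 - s x).
  have p1 := push_ge0 rho01 (after j.1) j.2 (iter (n x) T x).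
  have p2 := push_ge0 rho01 (before j.1) j.2 (iter (n x).+1 T x).
  have p3 := push_le rho01 (after j.1) j.2 (iter (n x) T x).
  have p4 := push_le rho01 (before j.1) j.2 (iter (n x).+1 T x).
  have m1 := ler_piMl p1 h2; have m2 := ler_piMl p2 h4.
  by rewrite /g addr_ge0 ?mulr_ge0 //= /B; lra.
have gm x : A x -> (#|[pred j | (0 < g j x)%R]| <= k1)%N.
  move=> _; apply: leq_trans (active_order (iter (n x) T x)).
  apply: subset_leq_card; apply/fintype.subsetP => -[i w]; rewrite inE /g /= => gp.
  have p1 := push_ge0 rho01 (after i) w (iter (n x) T x).
  have p2 := push_ge0 rho01 (before i) w (iter (n x).+1 T x).
  have [ha|ha] := ltP 0 (push (after i) w rho (iter (n x) T x)).
    by have [v <- hv] := push_gt0 rho01 ha; apply: after_active.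
  have [hb|hb] := ltP 0 (push (before i) w rho (iter (n x).+1 T x)).
    by have [v <- hv] := push_gt0 rho01 hb; apply: before_active.
  have e3 : push (after i) w rho (iter (n x) T x) = 0 by apply/eqP; rewrite eq_le ha.
  have e4 : push (before i) w rho (iter (n x).+1 T x) = 0 by apply/eqP; rewrite eq_le hb.
  by move: gp; rewrite /= in e4 *; rewrite e3 e4 !mulr0 addr0 ltxx.
have h := splits_sparse e0 gB gm.
apply: splits_weaken h _ _ _ => //.
  apply: leq_mul; first by rewrite leq_pexp2l // leq_addl.
  by rewrite leq_pexp2l // leq_maxr.
move=> x y Ax Ay gxy [v|j]; rewrite !codeE //.
  by rewrite subrr normr0 mulr_ge0 ?mulr_ge0 // ltW.
apply: le_trans (gxy j) _; apply: le_trans Be.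
by rewrite ler_peMl // ltW.
Qed.

End CodeSplits.

(** * Counting the codes along an orbit *)

Section OrbitSplits.
Context {R : realType} {X : Type} {J : finType}.
Variables (T : X -> X) (L g : nat) (M C : R) (h phi : X -> R) (c : J -> X -> R).
Hypotheses (L1 : (1 < L)%N) (g0 : (0 < g)%N).
Hypotheses (phiM : forall x, 0 <= phi x <= M)
  (phi_step : forall x, h x = 0 -> phi (T x) = phi x - 1)
  (c_step : forall x j, h x = 0 -> 1 <= modL L (phi x) -> c j (T x) = c j x)
  (h_sparse : forall x n, (0 < n)%N -> (n <= g)%N -> h x != 0 -> h (iter n T x) = 0).

Let r x := modL L (phi x).

Lemma phi_ge1 x : h x = 0 -> 1 <= phi x.
Proof. by move=> hx; have /andP[] := phiM (T x); rewrite (phi_step hx); lra. Qed.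

(* How often the phase and the code, respectively, may change freely. *)
Let resets x N := (\sum_(n < N) (h (iter n T x) != 0%R))%N.
Let starts x N := (\sum_(n < N) ((h (iter n T x) != 0%R) || (r (iter n T x) < 1)%R))%N.

Lemma resets_le x N : (resets x N <= (N %/ g).+1)%N.
Proof.
have h1 n m : h (iter n T x) != 0 -> h (iter m T x) != 0 -> (n < m)%N -> (n + g <= m)%N.
  move=> hn hm nm; rewrite leqNgt; apply/negP => mng; move: hm.
  rewrite -(subnK (ltnW nm)) iterD h_sparse ?eqxx ?subn_gt0 //.
  by rewrite leq_subLR ltnW.
apply: leq_trans (sparse_times_count N g0 h1).
by rewrite /resets -sum1_card [leqRHS]big_mkcond /=; apply: leq_sum => n _; rewrite inE; case: ifP.
Qed.

(** Between two block ends without a reset there are [L] steps, since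
    [phi] decreases by one at each step: the potential on the left grows by
    at most one per step, apart from a jump at each reset. *)
Lemma starts_potential x N :
  L%:R * (starts x N)%:R + (L%:R - r (iter N T x))
    <= N%:R + L%:R + 2 * L%:R * (resets x N)%:R.
Proof.
have L0 : 0 < L%:R :> R by rewrite ltr0n ltnW.
elim: N => [|N IH].
  rewrite /starts /resets !big_ord0 !mulr0 !addr0 add0r /=.
  by have := modL_ge0_lt L1 (proj1 (andP (phiM x))); rewrite /r; lra.
rewrite /starts /resets !big_ord_recr /= -/(starts x N) -/(resets x N) !natrD.
set y := iter N T x in IH *.
have /andP[y0 yL] := modL_ge0_lt L1 (proj1 (andP (phiM y))).
have /andP[z0 zL] := modL_ge0_lt L1 (proj1 (andP (phiM (T y)))).
rewrite -/(r y) in y0 yL *; rewrite -/(r (T y)) in z0 zL.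
have t1 : (true : nat)%:R = 1 :> R by [].
have [hy|hy] := eqVneq (h y) 0 => /=.
  have p1 := phi_ge1 hy.
  rewrite addr0; have [ry|ry] := ltP (r y) 1.
    have e : r (T y) = r y - 1 + L%:R by rewrite /r (phi_step hy) modL_wrap.
    by rewrite e -natr1 t1; lra.
  have e : r (T y) = r y - 1 by rewrite /r (phi_step hy) modL_pred.
  by rewrite e -natr1 addr0; lra.
by lra.
Qed.

Lemma starts_le x N : (starts x N <= N %/ L + 2 * (N %/ g) + 3)%N.
Proof.
have L0 : (0 < L)%N by rewrite ltnW.
have h1 := starts_potential x N; have h2 := resets_le x N.
have /andP[_ h3] := modL_ge0_lt L1 (proj1 (andP (phiM (iter N T x)))).
have h4 : (L * starts x N <= N + L + 2 * L * (resets x N))%N.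
  rewrite -(ler_nat R) !natrD !natrM.
  by move: h1; rewrite -/(r (iter N T x)) in h3; lra.
have h5 : (L * starts x N <= N + L * (1 + 2 * (N %/ g).+1))%N.
  apply: leq_trans h4 _; nia.
have : (starts x N <= (N + (1 + 2 * (N %/ g).+1) * L) %/ L)%N.
  by rewrite leq_divRL // mulnC [X in (_ <= _ + X)%N]mulnC.
by rewrite divnDMl //; lia.
Qed.

(** Once the times of resets and block ends are known, at the cost of a factor
    [4 ^ N] that does not depend on [e], the orbit only has freedom in the
    phase after each reset and in the code of each block. *)
Lemma orbit_splits (N : nat) (e : R) (kc : nat) : 0 < e -> (0 < kc)%N ->
  splits (fun _ : X => True) (fun x y => forall j, `|c j x - c j y| <= C * e) kc ->
  splits (fun _ : X => True)
    (fun x y => forall n, (n <= N)%N ->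
       `|phi (iter n T x) - phi (iter n T y)| <= e /\
       forall j, `|c j (iter n T x) - c j (iter n T y)| <= C * e)
    (4 ^ N * ((Num.truncn (M / e)).+1 ^ (N %/ g).+2
              * kc ^ (N %/ L + 2 * (N %/ g) + 4))).
Proof.
move=> e0 kc0 csp.
pose l0 x : {ffun 'I_N -> bool * bool} :=
  [ffun n : 'I_N => (h (iter n T x) != 0, r (iter n T x) < 1)].
have -> : (4 ^ N = #|{: {ffun 'I_N -> bool * bool}}|)%N.
  by rewrite card_ffun card_ord card_prod card_bool.
set E := fun x y => forall n, (n <= N)%N -> _.
apply: splits_weaken (splits_fiber (l0 := l0) (A := fun=> True) (E := E) _) _ _ _ => //;
  last by move=> x y _ _ [].
move=> p.
have [[x0 lx0]|nex] := pselect (exists x, l0 x = p); last first.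
  by apply: splits_empty => x [_ lx]; apply: nex; exists x.
pose s1 := 0%N :: [seq (n : 'I_N).+1 | n <- [seq n <- enum 'I_N | (p n).1]].
pose s2 := 0%N :: [seq (n : 'I_N).+1 | n <- [seq n <- enum 'I_N | (p n).1 || (p n).2]].
have s1E : size s1 = (resets x0 N).+1.
  rewrite /s1 /= size_map size_filter /resets -sum1_count big_enum_cond /= big_mkcond /=.
  congr _.+1; apply: eq_bigr => n _.
  by rewrite -lx0 ffunE /=; case: (h _ != 0).
have s2E : size s2 = (starts x0 N).+1.
  rewrite /s2 /= size_map size_filter /starts -sum1_count big_enum_cond /= big_mkcond /=.
  congr _.+1; apply: eq_bigr => n _.
  by rewrite -lx0 ffunE /=; case: (h _ != 0); case: (r _ < 1).
have h1 : splits (fun x => True /\ l0 x = p)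
    (fun x y => forall n, n \in s1 -> `|phi (iter n T x) - phi (iter n T y)| <= e)
    ((Num.truncn (M / e)).+1 ^ size s1).
  apply: splits_all => n _.
  by apply: (splits_real (g := fun x => phi (iter n T x))) => // x _; apply: phiM.
have h2 : splits (fun x => True /\ l0 x = p)
    (fun x y => forall n, n \in s2 ->
      forall j, `|c j (iter n T x) - c j (iter n T y)| <= C * e)
    (kc ^ size s2).
  apply: splits_all => n _.
  by apply: splits_weaken (splits_comp (iter n T) csp) _ _ _.
apply: splits_weaken (splits_and h1 h2) _ _ _ => //.
  apply: leq_mul.
    by rewrite leq_pexp2l // s1E ltnS resets_le.
  by rewrite leq_pexp2l // s2E; have := starts_le x0 N; lia.
move=> x y [_ lx] [_ ly] [e1 e2]; elim=> [|n IH] nN.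
  by split; [apply: e1|apply: e2]; rewrite mem_head.
have [IHphi IHc] := IH (ltnW nN).
pose o := Ordinal nN.
have px : p o = (h (iter n T x) != 0, r (iter n T x) < 1) by rewrite -lx ffunE.
have py : p o = (h (iter n T y) != 0, r (iter n T y) < 1) by rewrite -ly ffunE.
have in1 : (p o).1 -> n.+1 \in s1.
  move=> po; rewrite inE; apply/orP; right; apply/mapP; exists o => //.
  by rewrite mem_filter po mem_enum.
have in2 : (p o).1 || (p o).2 -> n.+1 \in s2.
  move=> po; rewrite inE; apply/orP; right; apply/mapP; exists o => //.
  by rewrite mem_filter po mem_enum.
have hh : ~~ (p o).1 -> h (iter n T x) = 0 /\ h (iter n T y) = 0.
  by move=> po; split; apply/eqP; [move: po; rewrite px|move: po; rewrite py] => /negPn.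
split.
  have [po|po] := boolP (p o).1; first by apply: e1; exact: in1.
  have [hx hy] := hh po; rewrite /= !phi_step //.
  by rewrite opprB addrA subrK.
move=> j; have [po|po] := boolP ((p o).1 || (p o).2); first by apply: e2; exact: in2.
move: po; rewrite negb_or => /andP[po1 po2].
have [hx hy] := hh po1.
have rx : 1 <= r (iter n T x) by move: po2; rewrite px /= -leNgt.
have ry : 1 <= r (iter n T y) by move: po2; rewrite py /= -leNgt.
by rewrite /= !c_step.
Qed.

End OrbitSplits.

(** * The two covers of the block code *)

Section NestedCovers.
Context {R : realType} {X : topologicalType}.
Variables (T : X -> X) (d : X -> X -> R).
Hypotheses (cX : compact [set: X]) (dc : compatible_metric d) (cT : continuous T).

Lemma uniformly_positive (V : finType) (rho : V -> X -> R) :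
  (forall v, continuous (rho v)) -> (forall x, exists v, 0 < rho v x) ->
  exists2 c : R, 0 < c & forall x, exists v, c <= rho v x.
Proof.
move=> crho ex.
have [|x y|c c0 h] := compact_pair_uniform (Q := fun r x _ => exists v, r <= rho v x) cX.
- by move=> r r' x _ rr' [v h]; exists v; apply: le_trans h.
- have [v vx] := ex x; exists (rho v x / 2); first lra.
  exists ([set x' | rho v x / 2 < rho v x'], setT) => /=.
    by split; [apply: cont_near_gt => //; lra|exact: filterT].
  by move=> [x' y'] /= [h _]; exists v; apply: ltW.
- by exists c; [exact: c0|move=> z; exact: (h z z)].
Qed.

Lemma lebesgue_number (W : finType) (sigma : W -> X -> R) :
  (forall w, continuous (sigma w)) -> (forall x, exists w, 0 < sigma w x) ->
  exists2 r : R, 0 < r & forall x, exists w, forall y, d x y < r -> 0 < sigma w y.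
Proof.
move=> cs ex; have [[dxx _ ds dt] _] := dc.
have [|x y|r r0 h] := compact_pair_uniform
    (Q := fun r x _ => exists w, forall y, d x y < r -> 0 < sigma w y) cX.
- by move=> r r' x _ rr' [w h]; exists w => z hz; apply: h; apply: lt_le_trans hz rr'.
- have [w wx] := ex x.
  have [r r0 hr] := compatible_closed_neighbour dc (cont_near_gt (cs w) wx).
  exists (r / 2); first lra.
  exists ([set x' | d x x' < r / 2], setT) => /=.
    by split; [apply: compatible_near => //; lra|exact: filterT].
  move=> [x' y'] /= [h _]; exists w => z hz; apply: hr.
  by have := dt x x' z; lra.
- by exists r; [exact: r0|move=> z; exact: (h z z)].
Qed.

Lemma unit_arith (D del L n : R) : n < (D + del) * L -> 1 <= del * L ->
  n + 1 <= (D + 2 * del) * L.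
Proof. move=> *; lra. Qed.

Lemma fine_arith (D del Z n : R) : 0 <= D -> 0 < del -> n < (D + del) * Z ->
  2 + 4 * (D + 2 * del) + 4 * del <= del * Z ->
  n + 1 + 1 <= (D + 3 * del) * Z - (D + 3 * del) * 4.
Proof. move=> *; lra. Qed.

Lemma coarse_arith (D del Z k : R) : 0 <= D -> 0 < del -> k <= (D + 2 * del) * Z ->
  2 + 4 * (D + 2 * del) + 4 * del <= del * Z ->
  k <= (D + 3 * del) * Z - (D + 3 * del) * 4.
Proof. move=> *; lra. Qed.

Variable D : R.
Hypothesis D0 : 0 <= D.
Hypothesis dimD : forall e c : R, 0 < e -> D < c -> \forall N \near \oo,
  exists2 n, cube_embedding (dynmetric T d N) e n & n%:R < c * N%:R.

Lemma small_order_cover e c : 0 < e -> D < c -> \forall N \near \oo,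
  exists n, fine_cover (dynmetric T d N) e n /\ n%:R < c * N%:R.
Proof.
move=> e0 Dc; apply: filterS (dimD e0 Dc) => N [n h nc]; exists n; split => //.
apply: cube_embedding_fine_cover => //.
by apply: dynmetric_continuous2 => //; exact: metric_continuous2.
Qed.

(** The fine cover is chosen after the coarse one and refines all its shifts
    along the window [q * L'], whence the maps of nerves in the code.  A
    point of the fine nerve costs about [D * (q * L')] parameters, and so do
    [q] points of the coarse nerve.  Blocks are shorter than windows by [4],
    because a point is observed at three consecutive times and the code looks
    at the two integer times next to a real one. *)
Lemma nested_covers (x0 : X) (eps delta : R) : 0 < eps -> 0 < delta ->
  exists (W V : finType) (sigma : W -> X -> R) (rho : V -> X -> R) (L' q L k1 k2 : nat),
  [/\ [/\ (1 < L')%N, (1 < L)%N & (L + 4 = q * L')%N],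
      (forall v, continuous (rho v)) /\ (forall v x, 0 <= rho v x <= 1),
      [/\ forall x, exists v, 0 < rho v x,
          forall x, (#|[pred v | (0 < rho v x)%R]| <= k2)%N,
          forall x, (#|[pred w | (0 < sigma w x)%R]| <= k1)%N
        & (maxn k2.+1 (q * k1))%:R <= (D + delta) * L%:R],
      (forall w x y, 0 < sigma w x -> 0 < sigma w y -> dynmetric T d L' x y < eps) /\
      (forall v x y, 0 < rho v x -> 0 < rho v y -> dynmetric T d (q * L') x y < eps)
    & forall v j, (j < q * L')%N -> exists w, forall x,
        0 < rho v x -> 0 < sigma w (iter j T x)].
Proof.
move=> eps0 delta0; pose del := delta / 3.
have del0 : 0 < del by rewrite /del; lra.
have dE : delta = 3 * del by rewrite /del; lra.
clearbody del.
have Ddel : D < D + del by lra.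
have [L' [L'1 L'del [n1 [[W [sigma [cs s01 sex sn [es es_lt sd]]]] n1c]]]] :
    exists L', [/\ (1 < L')%N, 1 <= del * L'%:R &
      exists n, fine_cover (dynmetric T d L') eps n /\ n%:R < (D + del) * L'%:R].
  have [N _ hN] := filterI (filterI (nbhs_infty_gt 1) (nbhs_infty_gtr (1 / del)))
    (small_order_cover eps0 Ddel).
  have [[h1 h2] h3] := hN N (leqnn N); exists N; split => //.
  by move: h2; rewrite ltr_pdivrMr // => /ltW; rewrite mulrC.
have [r r0 rP] := lebesgue_number cs sex.
pose e1 := Num.min eps r.
have e10 : 0 < e1 by rewrite lt_min eps0 r0.
have L'R : 1 <= L'%:R :> R by rewrite ler1n ltnW.
have [q [q6 qdel [n2 [[V [rho [crho rho01 rex rn [er er_lt rd]]]] n2c]]]] :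
    exists q, [/\ (6 < q)%N, 2 + 4 * (D + 2 * del) + 4 * del <= del * q%:R &
      exists n, fine_cover (dynmetric T d (q * L')) e1 n /\ n%:R < (D + del) * (q * L')%:R].
  have [N0 _ hN0] := small_order_cover e10 Ddel.
  have [N1 _ hN1] := nbhs_infty_gtr ((2 + 4 * (D + 2 * del) + 4 * del) / del).
  pose q := (maxn 7 (maxn N0 N1)); exists q; split.
  - by rewrite /q leq_max.
  - have : (N1 <= q)%N by rewrite /q !leq_max leqnn !orbT.
    by move=> /hN1 /=; rewrite ltr_pdivrMr // => /ltW h; rewrite [leRHS]mulrC.
  - apply: hN0 => /=; rewrite /q.
    by apply: (@leq_trans (maxn 7 (maxn N0 N1))); [rewrite !leq_max leqnn !orbT|rewrite leq_pmulr // ltnW].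
have Z6 : (6 < q * L')%N by apply: (leq_trans q6); rewrite leq_pmulr // ltnW.
exists W, V, sigma, rho, L', q, (q * L' - 4)%N, n1.+1, n2.+1.
have ZE : (q * L' - 4 + 4 = q * L')%N by rewrite subnK //; apply: leq_trans Z6.
split.
- by split => //; rewrite ltn_subRL; apply: leq_trans Z6.
- by [].
- split => //.
  have ZR : (q * L' - 4)%:R + 4 = (q * L')%:R :> R by rewrite -{2}ZE natrD.
  rewrite -(lerD2r (4 * (D + delta))) -(mulrC (D + delta)) -mulrDr ZR.
  have qZ : q%:R <= (q * L')%:R :> R by rewrite ler_nat leq_pmulr // ltnW.
  have Z0 : 0 <= (q * L')%:R :> R by [].
  have dZ : 2 + 4 * (D + 2 * del) + 4 * del <= del * (q * L')%:R.
    by apply: le_trans qdel _; rewrite ler_pM2l.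
  have DZ : 0 <= D * (q * L')%:R by rewrite mulr_ge0.
  rewrite dE natr_max -lerBrDr ge_max; apply/andP; split.
    by rewrite -[n2.+2%:R]natr1 -[n2.+1%:R]natr1; apply: (fine_arith D0 del0 n2c dZ).
  rewrite natrM -natr1.
  have : q%:R * (n1%:R + 1) <= (D + 2 * del) * (q * L')%:R.
    rewrite natrM [leRHS]mulrCA; apply: ler_wpM2l => //.
    exact: (unit_arith n1c L'del).
  by move=> h; apply: (coarse_arith D0 del0 h dZ).
- split => [w x y hx hy|v x y hx hy].
    exact: le_lt_trans (sd w x y hx hy) es_lt.
  apply: le_lt_trans (rd v x y hx hy) _; apply: lt_le_trans er_lt _.
  by rewrite ge_min lexx.
- move=> v j jZ.
  have [[z hz]|nex] := pselect (exists z, 0 < rho v z); last first.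
    have [w _] := sex x0; exists w => x hx; case: nex; by exists x.
  have [w wP] := rP (iter j T z); exists w => x hx; apply: wP.
  have h : dynmetric T d (q * L') z x < r.
    apply: le_lt_trans (rd v z x hz hx) _; apply: lt_le_trans er_lt _.
    by rewrite ge_min lexx orbT.
  exact: (dynmetric_ltP _ _ _ _ _ r0).1 h _ jZ.
Qed.

End NestedCovers.

(** * Block coding *)

Section BlockCoding.
Context {R : realType} {X : topologicalType} {V W : finType}.
Variables (T : X -> X) (M L q : nat) (before after : 'I_q -> V -> W).
Hypothesis L1 : (1 < L)%N.
Implicit Types u : option V -> X -> R.

Let L0 : 0 < L%:R :> R. Proof. by rewrite ltr0n ltnW. Qed.

Definition phase u x : R := return_time T (u None) M x.
Definition fine_part u : V -> X -> R := fun v => u (Some v).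

(** An amplitude that vanishes at both ends of a block, where the code jumps. *)
Definition amplitude (r : R) : R := Num.max 0 (Num.min 1 (Num.min r (L%:R - r))).

(** What an orbit shows at time [0]: its phase, and the code of the current
    block with an amplitude that depends on the phase. *)
Definition broadcast (j : option (V + 'I_q * W)) u x : R :=
  match j with
  | None => phase u x
  | Some j => amplitude (modL L (phase u x)) *
      code T L before after (fine_part u) (modL L (phase u x)) x j
  end.

Lemma amplitude01 r : 0 <= amplitude r <= 1.
Proof. by rewrite /amplitude le_max lexx /= ge_max ler01 ge_min lexx. Qed.

Lemma amplitude_lip s t : `|amplitude s - amplitude t| <= `|s - t|.
Proof.
apply: le_trans (max_lip _ _ _) _; apply: le_trans (min_lip _ _ _) _.
have := ler_norm (s - t); have := ler_norm (t - s); rewrite (distrC t) => h1 h2.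
by case: (lerP s (L%:R - s)) => ?; case: (lerP t (L%:R - t)) => ?;
  rewrite ler_norml; apply/andP; split; lra.
Qed.

Lemma amplitude_gt0 r : 0 < r < L%:R -> 0 < amplitude r.
Proof. by move=> /andP[? ?]; rewrite /amplitude lt_max !lt_min ltr01 /=; apply/orP; right; apply/andP; split; lra. Qed.

Lemma phase_ge0_le u x : in01 u -> 0 <= phase u x <= M%:R.
Proof. by move=> hu; apply: return_time_ge0_le. Qed.

Lemma phase_local : local_lipschitz T phase.
Proof.
rewrite /phase; elim: M => [|m IH]; first exact: local_cst.
have h1 : local_lipschitz T (fun u x => 1 - Num.min 1 (2 * u (None : option V) x)).
  apply: (@local_post _ _ _ T (fun t => 1 - Num.min 1 (2 * t)) (fun t => 0 <= t <= 1) 1 2 _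
    (local_coord T None)) => //.
  - move=> s /andP[s0 s1]; have h0 : 0 <= Num.min 1 (2 * s) by rewrite le_min ler01 mulr_ge0.
    have h2 : Num.min 1 (2 * s) <= 1 by rewrite ge_min lexx.
    by rewrite ger0_norm; lra.
  - move=> s t _ _; have -> : 1 - Num.min 1 (2 * s) - (1 - Num.min 1 (2 * t))
      = Num.min 1 (2 * t) - Num.min 1 (2 * s) by ring.
    apply: le_trans (min_lip _ _ _) _.
    by rewrite -mulrBr normrM ger0_norm // distrC.
exact: (local_mul h1 (local_add (local_cst T 1) (local_shift IH))).
Qed.

(** The amplitude is what makes this continuous: the residue of the phase
    jumps at the end of a block. *)
Lemma kernel_local (alpha : R -> R) n : (forall t, 0 <= alpha t <= 1) ->
  (forall s t, `|alpha s - alpha t| <= 3 * `|s - t|) ->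
  local_lipschitz T (fun u x =>
    amplitude (modL L (phase u x)) * alpha (modL L (phase u x) - n%:R)).
Proof.
move=> a01 alip; pose g r := amplitude r * alpha (r - n%:R).
have nrm (a : R) : 0 <= a <= 1 -> `|a| <= 1 by move=> /andP[? ?]; rewrite ger0_norm.
have zero r : r = 0 \/ r = L%:R -> g r = 0.
  move=> hr; rewrite /g /amplitude max_l ?mul0r // ge_min; apply/orP; right.
  by rewrite ge_min; apply/orP; case: hr => ->; [left|right; rewrite subrr].
have glip s t : `|g s - g t| <= 4 * `|s - t|.
  have -> : g s - g t = (amplitude s - amplitude t) * alpha (s - n%:R)
      + amplitude t * (alpha (s - n%:R) - alpha (t - n%:R)) by rewrite /g; ring.
  apply: le_trans (ler_normD _ _) _; rewrite !normrM.
  have h1 : `|amplitude s - amplitude t| * `|alpha (s - n%:R)| <= `|s - t| * 1.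
    by apply: ler_pM => //; [apply: amplitude_lip|apply: nrm].
  have h2 : `|amplitude t| * `|alpha (s - n%:R) - alpha (t - n%:R)| <= 1 * (3 * `|s - t|).
    apply: ler_pM => //; first by apply: nrm; apply: amplitude01.
    by apply: le_trans (alip _ _) _; rewrite opprB addrA subrK.
  by lra.
apply: (@local_post _ _ _ T (fun p => g (modL L p)) (fun p => 0 <= p) 1 4 _ phase_local) => //.
- by move=> u x hu; have /andP[] := phase_ge0_le x hu.
- move=> s s0; rewrite /g normrM -[1](mulr1 1); apply: ler_pM => //; apply: nrm => //.
  exact: amplitude01.
- move=> s t s0 t0; apply: modL_lipschitz => //; [apply: zero; by left|apply: zero; by right].
Qed.

Lemma window_local (alpha : R -> R) (G : (option V -> X -> R) -> X -> R) :
  (forall t, 0 <= alpha t <= 1) ->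
  (forall s t, `|alpha s - alpha t| <= 3 * `|s - t|) -> local_lipschitz T G ->
  local_lipschitz T (fun u x => amplitude (modL L (phase u x)) *
    window T L alpha (G u) (modL L (phase u x)) x).
Proof.
move=> a01 alip hG.
have h : local_lipschitz T (fun u x => \sum_(n < L.+1)
    amplitude (modL L (phase u x)) * alpha (modL L (phase u x) - n%:R) * G u (iter n T x)).
  apply: local_sum => n; apply: (local_mul (kernel_local n a01 alip)); exact: local_iter.
move: h; congr local_lipschitz; apply/funext => u; apply/funext => x.
by rewrite /window mulr_sumr; apply: eq_bigr => n _; rewrite mulrA.
Qed.

Lemma push_local (p : V -> W) w :
  local_lipschitz T (fun u => push p w (fine_part u)).
Proof. by rewrite /push; apply: local_sum => v; apply: local_coord. Qed.

Lemma broadcast_local j : local_lipschitz T (broadcast j).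
Proof.
case: j => [[v|[i w]]|]; last exact: phase_local.
  by apply: window_local; [exact: spike01|exact: spike_lip|exact: local_coord].
have h1 := window_local (@hump01 R) (@hump_lip R) (push_local (after i) w).
have hl (s t : R) : `|hump (- s) - hump (- t)| <= 3 * `|s - t|.
  by apply: le_trans (hump_lip _ _) _; rewrite opprK addrC distrC.
have h2 := window_local (fun t => hump01 (- t)) hl (push_local (before i) w).
have := local_add h1 h2; congr local_lipschitz; apply/funext => u; apply/funext => x.
by rewrite /broadcast /code /= mulrDr.
Qed.

Section Fixed.
Variables (u : option V -> X -> R) (g : nat).
Hypotheses (u01 : in01 u)
  (u_stop : forall x, exists2 i, (i < M)%N & 1 / 2 <= u None (iter i T x))
  (u_sparse : forall x n, (0 < n)%N -> (n <= g)%N -> u None x != 0 -> u None (iter n T x) = 0)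
  (g0 : (0 < g)%N).

Let rho := fine_part u.
Let phi := phase u.
Let r x := modL L (phi x).

Lemma phase_step x : u None x = 0 -> phi (T x) = phi x - 1.
Proof.
move=> ux; have := return_time_stable (u_stop x).
rewrite [LHS]/= ux mulr0 (min_r ler01) subr0 mul1r => e.
by rewrite /phi /phase -e addrAC subrr add0r.
Qed.

Let rL x : 0 <= r x < L%:R.
Proof. by apply: modL_ge0_lt => //; have /andP[] := phase_ge0_le x u01. Qed.

Lemma code_bound x j : `|code T L before after rho (r x) x j| <= 2 * (2 * #|V|%:R + 1).
Proof.
have V0 : 0 <= #|V|%:R :> R by [].
have two (a b p p' B : R) : 0 <= a <= 1 -> 0 <= b <= 1 -> 0 <= p <= B -> 0 <= p' <= B ->
    `|a * p + b * p'| <= B + B.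
  move=> /andP[a0 a1] /andP[b0 b1] /andP[p0 pB] /andP[p'0 p'B].
  rewrite ger0_norm ?addr_ge0 ?mulr_ge0 //.
  by apply: lerD; [apply: le_trans (ler_piMl p0 a1) _|apply: le_trans (ler_piMl p'0 b1) _].
have pB (p : V -> W) w y : 0 <= push p w rho y <= #|V|%:R.
  by rewrite push_ge0 ?push_le // => v z; apply: u01.
rewrite code_two //; case: j => [v|[i w]].
  apply: le_trans (two _ _ _ _ 1 (spike01 _) (spike01 _) (u01 _ _) (u01 _ _)) _.
  by lra.
apply: le_trans (two _ _ _ _ _ (hump01 _) (hump01 _) (pB _ _ _) (pB _ _ _)) _.
by lra.
Qed.

Lemma broadcast_splits (active : X -> pred ('I_q * W)) (k1 k2 N : nat) (e : R) :
  (forall x, (#|[pred v | (0 < rho v x)%R]| <= k2)%N) ->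
  (forall x, (#|active x| <= k1)%N) ->
  (forall i v x, 0 < rho v x -> active x (i, after i v)) ->
  (forall i v x, 0 < rho v (T x) -> active x (i, before i v)) ->
  0 < e <= 1 ->
  splits (fun _ : X => True)
    (fun x y => forall n, (n <= N)%N -> forall j,
       `|broadcast j u (iter n T x) - broadcast j u (iter n T y)|
         <= 6 * (2 * #|V|%:R + 1) * e)
    (4 ^ N * ((Num.truncn (M%:R / e)).+1 ^ (N %/ g).+2 *
      (4 * (2 ^ (#|V| + #|{: 'I_q * W}|)
            * (Num.truncn ((2 * #|V|%:R + 1) / e)).+1 ^ maxn k2.+1 k1))
        ^ (N %/ L + 2 * (N %/ g) + 4))).
Proof.
move=> rho_order active_order aft bef /andP[e0 e1].
have rho01 v x : 0 <= rho v x <= 1 by apply: u01.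
have e01 : 0 < e <= 1 by rewrite e0 e1.
have csp := code_splits rho01 rL rho_order active_order aft bef e01.
have c_step x j : u None x = 0 -> 1 <= r x ->
    code T L before after rho (r (T x)) (T x) j = code T L before after rho (r x) x j.
  move=> ux rx; have p1 : 1 <= phi x.
    have := phase_step ux; have /andP[h _] := phase_ge0_le (T x) u01.
    by move: h; rewrite -/phi => h1 h2; move: h1; rewrite h2; lra.
  have -> : r (T x) = r x - 1 by rewrite /r phase_step // modL_pred.
  by apply: code_shift => //; rewrite rx; have /andP[] := rL x.
have kc0 : (0 < 4 * (2 ^ (#|V| + #|{: 'I_q * W}|)
   * (Num.truncn ((2 * #|V|%:R + 1) / e)).+1 ^ maxn k2.+1 k1))%N.
  by rewrite !muln_gt0 !expn_gt0.
have h := orbit_splits L1 g0 (fun x => phase_ge0_le x u01) phase_step c_step u_sparse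
  N e0 kc0 csp.
apply: splits_weaken h _ _ _ => // x y _ _ h n nN; have {h}[hp hc] := h n nN.
set B := 2 * _ + 1 in hc *.
have V0 : 0 <= #|V|%:R :> R by [].
have B1 : 1 <= B by rewrite /B; lra.
have e00 := ltW e0.
case=> [j|] /=; last first.
  apply: le_trans hp _; have := ler_peMl e00 B1.
  by move=> ?; lra.
set x' := iter n T x in hp hc *; set y' := iter n T y in hp hc *.
rewrite -/phi -/(r x') -/(r y') -/rho.
set cx := code _ _ _ _ _ (r x') _ _; set cy := code _ _ _ _ _ (r y') _ _.
have -> : amplitude (r x') * cx - amplitude (r y') * cy
  = (amplitude (r x') - amplitude (r y')) * cx + amplitude (r y') * (cx - cy) by ring.
apply: le_trans (ler_normD _ _) _; rewrite !normrM.
have h1 : `|amplitude (r x') - amplitude (r y')| * `|cx| <= e * (2 * B).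
  apply: ler_pM => //; last exact: code_bound.
  apply: le_trans hp; rewrite -[leRHS]mul1r.
  have /andP[px _] := phase_ge0_le x' u01; have /andP[py _] := phase_ge0_le y' u01.
  apply: modL_lipschitz => //.
  - by rewrite /amplitude max_l // !ge_min lexx orbT.
  - by rewrite /amplitude max_l // !ge_min subrr lexx !orbT.
  - by move=> s t _ _; rewrite mul1r; exact: amplitude_lip.
have h2 : `|amplitude (r y')| * `|cx - cy| <= 1 * (4 * B * e).
  apply: ler_pM => //; last exact: hc.
  by have /andP[? ?] := amplitude01 (r y'); rewrite ger0_norm.
by lra.
Qed.

Variables (d : X -> X -> R) (eps : R).
Hypotheses (rho_cover : forall x, exists v, 0 < rho v x)
  (rho_small : forall v n x y, (n <= L + 2)%N ->
     0 < rho v (iter n T x) -> 0 < rho v (iter n T y) -> d x y < eps)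
  (coarse_small : forall n, (n <= L.+1)%N -> exists (i : 'I_q) (P : W -> X -> Prop),
     [/\ forall v x, 0 < rho v (iter n T x) -> P (after i v) x,
         forall v x, 0 < rho v (iter n.+1 T x) -> P (before i v) x
       & forall w x y, P w x -> P w y -> d x y < eps]).

(** The phase is inside a period at one of three consecutive times: a block
    end is followed by a time inside the next block unless there is a reset,
    and two resets are never consecutive. *)
Lemma phase_inside x : exists a : 'I_3, 0 < r (iter a T x).
Proof.
have /andP[r0 _] := rL x; have /andP[r1 _] := rL (T x); have /andP[r2 _] := rL (T (T x)).
have L2 : 2 <= L%:R :> R by rewrite ler_nat.
have wrap y : u None y = 0 -> r y = 0 -> 0 < r (T y).
  move=> uy ry; have p1 : 1 <= phi y.
    have := phase_step uy; have /andP[h _] := phase_ge0_le (T y) u01.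
    by move: h; rewrite -/phi => h1 h2; move: h1; rewrite h2; lra.
  have m1 : modL L (phi y) < 1 by rewrite -/(r y) ry ltr01.
  by rewrite /r phase_step // modL_wrap // -/(r y) ry; lra.
have [h0|h0] := ltP 0 (r x); first by exists (@Ordinal 3 0 isT).
have e0 : r x = 0 by apply/eqP; rewrite eq_le h0 r0.
have [h1|h1] := ltP 0 (r (T x)); first by exists (@Ordinal 3 1 isT).
have e1 : r (T x) = 0 by apply/eqP; rewrite eq_le h1 r1.
exists (@Ordinal 3 2 isT) => /=.
have [ux|ux] := eqVneq (u None x) 0; first by have := wrap x ux e0; rewrite e1 ltxx.
by apply: wrap => //; apply: (u_sparse (n := 1)).
Qed.

(** At a time inside a block the code can be read off.  If the end of the block
    is close to an integer time, it shows a common element of the fine cover,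
    otherwise a common element of the coarse cover, for the [i] whose window
    contains time [0]. *)
Lemma broadcast_separates x y :
  (forall (a : 'I_3) j, broadcast j u (iter a T x) = broadcast j u (iter a T y)) ->
  d x y < eps.
Proof.
move=> bxy; have [a ra] := phase_inside x.
set x' := iter a T x in ra *; set y' := iter a T y.
have a2 : (a <= 2)%N by rewrite -ltnS.
have pe : phi x' = phi y' by have := bxy a None.
have re : r x' = r y' by rewrite /r pe.
have /andP[_ rxL] := rL x'.
have amp : 0 < amplitude (r x') by apply: amplitude_gt0; rewrite ra rxL.
have ce j : code T L before after rho (r x') x' j = code T L before after rho (r x') y' j.
  have := bxy a (Some j); rewrite /= -/phi -/(r x') -/(r y') -re => h.
  by apply: (mulfI _ h); rewrite gt_eqF.
have rxx : 0 <= r x' < L%:R by rewrite ltW ?rxL.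
set n := Num.truncn (r x').
have nL : (n < L)%N by rewrite -(ltr_nat R); apply: le_lt_trans rxL; rewrite truncn_le ltW.
set s := r x' - n%:R.
have s0 : 0 <= s by rewrite subr_ge0 truncn_le ltW.
have s1 : s < 1.
  have h : r x' < n.+1%:R := truncnS_gt _.
  by rewrite -natr1 in h; rewrite /s; lra.
have rho0 v z : 0 <= rho v z by have /andP[] := u01 (Some v) z.
have rho01 v z : 0 <= rho v z <= 1 by apply: u01.
have p0 p w z : 0 <= push p w rho z by apply: push_ge0.
have it k z : iter k T (iter a T z) = iter (k + a) T z by rewrite iterD.
have ka : (n + a <= L.+1)%N by rewrite -ltnS -addSn -[L.+2]addn2 leq_add.
have [sl|sl] := ltP s (1 / 3).
  have [v hv] := rho_cover (iter n T x').
  have := ce (inl v); rewrite !code_two // -/n -/s /=.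
  rewrite [spike (1 - s)]spike_eq0 ?mul0r ?addr0; last by rewrite ger0_norm; lra.
  have sp : 0 < spike s by apply: spike_gt0; rewrite ger0_norm.
  move=> h; have hy : 0 < rho v (iter n T y') by rewrite -(pmulr_rgt0 _ sp) -h mulr_gt0.
  rewrite !it in hv hy; apply: (rho_small _ hv hy).
  by apply: leq_trans ka _; rewrite addn2.
have [sr|sr] := ltP (2 / 3) s.
  have [v hv] := rho_cover (iter n.+1 T x').
  have := ce (inl v); rewrite !code_two // -/n -/s.
  rewrite [spike s]spike_eq0 ?mul0r ?add0r; last by rewrite ger0_norm; lra.
  have sp : 0 < spike (1 - s) by apply: spike_gt0; rewrite ger0_norm; lra.
  move=> h; have hy : 0 < rho v (iter n.+1 T y') by rewrite -(pmulr_rgt0 _ sp) -h mulr_gt0.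
  rewrite !it in hv hy; apply: (rho_small _ hv hy).
  by rewrite addSn addn2 ltnS.
have hump0 t : 0 <= hump t :> R by have /andP[] := hump01 t.
have [i [P [Paft Pbef Psmall]]] := coarse_small ka.
pose mix w z := hump s * push (after i) w rho (iter n T z)
  + hump (1 - s) * push (before i) w rho (iter n.+1 T z).
have mixP w z : 0 < mix w (iter a T z) -> P w z.
  move=> hm; have [ha|ha] := ltP 0 (push (after i) w rho (iter n T (iter a T z))).
    have [v <- hv] := push_gt0 rho01 ha; apply: Paft; by rewrite -it.
  have [hb|hb] := ltP 0 (push (before i) w rho (iter n.+1 T (iter a T z))).
    have [v <- hv] := push_gt0 rho01 hb; apply: Pbef; by rewrite -addSn -it.
  exfalso; move: hm; rewrite /mix ltNge -[X in _ <= X]addr0 => /negP; apply.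
  by apply: lerD; rewrite mulr_ge0_le0.
have mixe w : mix w x' = mix w y'.
  by have := ce (inr (i, w)); rewrite !code_two.
suff [w hw] : exists w, 0 < mix w x'.
  by apply: (Psmall w); apply: mixP => //; rewrite -mixe.
have pv (p : V -> W) v z : 0 < rho v z -> 0 < push p (p v) rho z.
  move=> hv; rewrite /push (bigD1 v) //=; apply: ltr_pwDl => //.
  by apply: sumr_ge0 => v' _.
have [sm|sm] := ltP s (2 / 3).
  have [v hv] := rho_cover (iter n T x').
  exists (after i v); rewrite /mix; apply: ltr_pwDl; last by rewrite mulr_ge0.
  by rewrite mulr_gt0 ?pv // hump_gt0 //; apply/andP; split; lra.
have [v hv] := rho_cover (iter n.+1 T x').
exists (before i v); rewrite /mix; apply: ltr_wpDl; first by rewrite mulr_ge0.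
by rewrite mulr_gt0 ?pv // hump_gt0 //; apply/andP; split; lra.
Qed.

End Fixed.
End BlockCoding.

(** * Stages *)

Section CountBound.
Context {R : realType}.

Lemma ln_truncn_le (B e : R) : 0 <= B -> 0 < e <= 1 ->
  ln (Num.truncn (B / e)).+1%:R <= ln (B + 1) + ln e^-1.
Proof.
move=> B0 /andP[e0 e1]; rewrite -lnM ?posrE ?invr_gt0 //; last by lra.
rewrite ler_ln ?posrE ?ltr0n ?mulr_gt0 ?invr_gt0 //; last by lra.
have h : (Num.truncn (B / e))%:R <= B / e by rewrite truncn_le divr_ge0 // ltW.
have h2 : 1 <= e^-1 by rewrite invf_ge1.
by rewrite -natr1; lra.
Qed.

Lemma ln_natX (a n : nat) : (0 < a)%N -> ln (a ^ n)%:R = n%:R * ln a%:R :> R.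
Proof. by move=> a0; rewrite natrX lnXn ?ltr0n // mulr_natl. Qed.

Lemma ln_natM (a b : nat) : (0 < a)%N -> (0 < b)%N ->
  ln (a * b)%:R = ln a%:R + ln b%:R :> R.
Proof. by move=> a0 b0; rewrite natrM lnM ?posrE ?ltr0n. Qed.

Lemma divn_mul_le (N g : nat) : (N %/ g)%:R * g%:R <= N%:R :> R.
Proof. by rewrite -natrM ler_nat leq_divM. Qed.

(** Blocks, of length [L] and with [kappa] parameters each, contribute
    [D + delta] to the exponent per unit of time; resets, which are at least
    [g] apart and cost one phase and two codes each, contribute [delta]. *)
Lemma ln_count_le (D delta M B e a0 : R) (L g kappa c0 N : nat) :
  0 <= D -> 0 < delta -> 0 <= M -> 0 <= B -> 0 < e <= 1 ->
  kappa%:R <= (D + delta) * L%:R -> 1 + 2 * kappa%:R <= delta * g%:R ->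
  a0 = ln 4 + c0%:R * ln 2 + kappa%:R * ln (B + 1) ->
  ln (4 ^ N * ((Num.truncn (M / e)).+1 ^ (N %/ g).+2 *
      (4 * (2 ^ c0 * (Num.truncn (B / e)).+1 ^ kappa)) ^ (N %/ L + 2 * (N %/ g) + 4)))%:R
  <= (N%:R + 1) * (ln 4 + 2 * ln (M + 1) + 4 * a0)
     + ((D + 2 * delta) * N%:R + (2 + 4 * kappa%:R)) * ln e^-1.
Proof.
move=> D0 del0 M0 B0 e01 kL kg a0E; have /andP[e0 e1] := e01.
have lam0 : 0 <= ln e^-1 by rewrite ln_ge0 // invf_ge1.
have h1 := ln_truncn_le M0 e01; have h2 := ln_truncn_le B0 e01.
set m1 := (Num.truncn (M / e)).+1 in h1 *; set m2 := (Num.truncn (B / e)).+1 in h2 *.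
set lam := ln e^-1 in lam0 h1 h2 *.
set kc := (4 * (2 ^ c0 * m2 ^ kappa))%N.
have kc_gt0 : (0 < kc)%N by rewrite !muln_gt0 !expn_gt0.
have lnkc : ln kc%:R <= a0 + kappa%:R * lam.
  rewrite (ln_natM (b := 2 ^ c0 * m2 ^ kappa)) ?muln_gt0 ?expn_gt0 //.
  rewrite (ln_natM (a := 2 ^ c0)) ?expn_gt0 // !(ln_natX _ (isT : (0 < m2)%N)) ln_natX // a0E.
  have := ler_wpM2l (ler0n R kappa) h2; lra.
set p := (N %/ g)%N; set b := (N %/ L)%N.
have pos1 : (0 < 4 ^ N)%N by rewrite expn_gt0.
have pos2 : (0 < m1 ^ p.+2)%N by rewrite expn_gt0.
have pos3 : (0 < kc ^ (b + 2 * p + 4))%N by rewrite expn_gt0 kc_gt0.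
have pos4 : (0 < m1 ^ p.+2 * kc ^ (b + 2 * p + 4))%N by rewrite muln_gt0 pos2.
rewrite (ln_natM pos1 pos4) (ln_natM pos2 pos3).
rewrite (ln_natX _ (isT : (0 < 4)%N)) (ln_natX _ (isT : (0 < m1)%N)) (ln_natX _ kc_gt0).
have pN : p%:R <= N%:R :> R by rewrite ler_nat leq_div.
have bN : b%:R <= N%:R :> R by rewrite ler_nat leq_div.
have lnM0 : 0 <= ln (M + 1) by rewrite ln_ge0 //; lra.
have lnB0 : 0 <= ln (B + 1) by rewrite ln_ge0 //; lra.
have ln40 : 0 <= ln (4 : R) by rewrite ln_ge0 // ler1n.
have ln20 : 0 <= ln (2 : R) by rewrite ln_ge0 // ler1n.
have a00 : 0 <= a0 by rewrite a0E !addr_ge0 ?mulr_ge0.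
have N0 : 0 <= N%:R :> R by [].
have p0 : 0 <= p%:R :> R by []; have b0 : 0 <= b%:R :> R by [].
have k0 : 0 <= kappa%:R :> R by [].
have p2E : (p.+2)%:R = p%:R + 2 :> R by rewrite -addn2 natrD.
have q4E : (b + 2 * p + 4)%:R = b%:R + 2 * p%:R + 4 :> R.
  by rewrite natrD natrD natrM.
rewrite p2E q4E.
have t1 : (p%:R + 2) * ln m1%:R <= (p%:R + 2) * (ln (M + 1) + lam).
  by apply: ler_wpM2l => //; lra.
have t2 : (b%:R + 2 * p%:R + 4) * ln kc%:R <= (b%:R + 2 * p%:R + 4) * (a0 + kappa%:R * lam).
  by apply: ler_wpM2l => //; lra.
(* [N %/ g] counts resets and [N %/ L] blocks *)
have x1 : p%:R * (1 + 2 * kappa%:R) <= delta * N%:R.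
  apply: (@le_trans _ _ (p%:R * (delta * g%:R))); first by rewrite ler_wpM2l.
  by rewrite mulrCA ler_pM2l // divn_mul_le.
have x2 : b%:R * kappa%:R <= (D + delta) * N%:R.
  apply: (@le_trans _ _ (b%:R * ((D + delta) * L%:R))); first by rewrite ler_wpM2l.
  by rewrite mulrCA ler_wpM2l ?divn_mul_le //; lra.
have x3 : (p%:R + 2 + (b%:R + 2 * p%:R + 4) * kappa%:R) * lam
    <= ((D + 2 * delta) * N%:R + (2 + 4 * kappa%:R)) * lam.
  by apply: ler_wpM2r => //; lra.
have y1 : (p%:R + 2) * ln (M + 1) <= (N%:R + 1) * (2 * ln (M + 1)).
  by rewrite mulrA; apply: ler_wpM2r => //; lra.
have y2 : (b%:R + 2 * p%:R + 4) * a0 <= (N%:R + 1) * (4 * a0).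
  by rewrite mulrA; apply: ler_wpM2r => //; lra.
lra.
Qed.

End CountBound.

Section Stages.
Context {R : realType} {X : topologicalType}.

(** A finite family of functionals together with functions to apply them to.
    The functions remain an argument of [stage_map], because they will be
    replaced by nearby ones that factor through a later stage. *)
Record stage := Stage {
  stage_var : finType;
  stage_out : finType;
  stage_data : stage_var -> X -> R;
  stage_radius : R;
  stage_map : stage_out -> (stage_var -> X -> R) -> X -> R }.

Arguments stage_data : clear implicits.
Arguments stage_map : clear implicits.

(** Supports must not grow, since the order of the covers and the distance
    between markers are properties of the supports. *)
Definition subordinate (s : stage) (u : stage_var s -> X -> R) :=
  forall i x, [/\ 0 <= u i x <= 1, `|u i x - stage_data s i x| <= stage_radius s
    & 0 < u i x -> 0 < stage_data s i x].

Variables (T S : X -> X) (d : X -> X -> R).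

(** The constants serve all perturbations of the data and all scales [e]: the
    perturbation is only known in the limit, and the weight of the stage in
    the metric is chosen after the constants. *)
Definition stage_dimension (s : stage) (dim : R) :=
  exists A C : R, [/\ 0 <= A, 0 < C &
    forall u, subordinate (s := s) u -> forall e N, 0 < e <= 1 ->
    exists k : nat, [/\ (0 < k)%N,
      splits (fun _ : X => True) (fun x y => forall n, (n <= N)%N -> forall j,
        `|stage_map s j u (iter n T x) - stage_map s j u (iter n T y)| <= C * e) k
      & ln k%:R <= (N%:R + 1) * A + (dim * N%:R + A) * ln e^-1]].

Definition good_stage (dim eps : R) (s : stage) :=
  [/\ [/\ 0 < stage_radius s, forall i, continuous (stage_data s i)
        & in01 (stage_data s)],
      forall j, local_lipschitz T (stage_map s j),
      forall u, subordinate u -> forall x y,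
        (forall j, stage_map s j u x = stage_map s j u y) -> d x y < eps
    & stage_dimension s dim].

Hypotheses (cX : compact [set: X]) (dc : compatible_metric d).
Hypotheses (TS : cancel T S) (ST : cancel S T) (cT : continuous T) (cS : continuous S).
Hypothesis hm : marker_property T.
Variable D : R.
Hypothesis D0 : 0 <= D.
Hypothesis dimD : forall e c : R, 0 < e -> D < c -> \forall N \near \oo,
  exists2 n, cube_embedding (dynmetric T d N) e n & n%:R < c * N%:R.

Lemma iter_comm k x : T (iter k S x) = iter k S (T x).
Proof. by elim: k => //= k <-; rewrite ST TS. Qed.

Lemma card_pairs (I J : finType) (P : I -> pred J) k :
  (forall i, (#|P i| <= k)%N) -> (#|[pred p : I * J | P p.1 p.2]| <= #|I| * k)%N.
Proof.
move=> Pk; rewrite -sum1_card -(pair_big_dep predT P (fun _ _ => 1%N)) /=.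
by rewrite -sum_nat_const; apply: leq_sum => i _; rewrite sum1_card.
Qed.

(** The data consists of the marker function and of the fine cover, the latter
    read [Z.-1] steps in the past: its window then contains time [0] whenever
    the code looks at it. *)
Lemma stage_exists (x0 : X) (eps delta : R) : 0 < eps -> 0 < delta ->
  exists s, good_stage (D + delta) eps s.
Proof.
move=> eps0 delta0; pose del := delta / 2.
have del0 : 0 < del by rewrite /del; lra.
have dE : delta = 2 * del by rewrite /del; lra.
have [W [V [sigma [rho [L' [q [L [k1 [k2]]]]]]]]] := nested_covers cX dc cT D0 dimD x0 eps0 del0.
move=> [[L'1 L1 LZ] [crho rho01] [rex rn sn kL] [ssmall rsmall] refine].
set Z := (q * L')%N in LZ rsmall refine.
have shiftL (i : 'I_q) : (i * L' + 1 < Z)%N.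
  apply: (@leq_trans (i.+1 * L')); first by rewrite mulSn [leqRHS]addnC -addnS leq_add2l.
  by rewrite leq_mul2r ltn_ord orbT.
have aft_ex (iv : 'I_q * V) : exists w, forall x, 0 < rho iv.2 x ->
    0 < sigma w (iter (iv.1 * L' + 1) T x).
  by apply: refine; exact: shiftL.
have bef_ex (iv : 'I_q * V) : exists w, forall x, 0 < rho iv.2 x ->
    0 < sigma w (iter (iv.1 * L') T x).
  by apply: refine; apply: leq_ltn_trans (shiftL iv.1); rewrite leq_addr.
have [aft aftP] := choice aft_ex; have [bef befP] := choice bef_ex.
pose after i v := aft (i, v); pose before i v := bef (i, v).
set kappa := maxn k2.+1 (q * k1) in kL.
pose g := (Num.truncn ((1 + 2 * kappa%:R) / del)).+1.
have gP : 1 + 2 * kappa%:R <= del * g%:R.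
  by rewrite [leRHS]mulrC -ler_pdivrMr //; apply/ltW/truncnS_gt.
have [h [M [ch h01 hM hsep]]] := marker_function (g := g) cX dc TS cT cS isT hm.
have [c0 c00 c0P] := uniformly_positive cX crho rex.
pose u0 (v : option V) : X -> R := match v with
  | None => h | Some v => fun x => rho v (iter Z.-1 S x) end.
pose eta := Num.min (1 / 2) (c0 / 2).
have eta0 : 0 < eta by rewrite lt_min; apply/andP; split; lra.
pose s := @Stage (option V) ('I_3 * option (V + 'I_q * W))%type u0 eta
  (fun aj u x => broadcast T M L before after aj.2 u (iter aj.1 T x)).
have sub (u : option V -> X -> R) : subordinate (s := s) u ->
  [/\ in01 u, forall x, exists2 i, (i < M)%N & 1 / 2 <= u None (iter i T x),
      forall x n, (0 < n)%N -> (n <= g)%N -> u None x != 0 -> u None (iter n T x) = 0,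
      forall x, exists v, 0 < u (Some v) x
    & forall v x, 0 < u (Some v) x -> 0 < rho v (iter Z.-1 S x)].
  move=> hu; have u01 : in01 u by move=> i x; have [] := hu i x.
  split => //.
  - move=> x; have [i iM hi] := hM x; exists i => //.
    have [_ h1 _] := hu None (iter i T x); move: h1; rewrite /= hi ler_norml => /andP[h1 _].
    have : eta <= 1 / 2 by rewrite ge_min lexx.
    by lra.
  - move=> x n n0 ng ux; have /andP[ux0 _] := u01 None x.
    have uxp : 0 < u None x by rewrite lt_neqAle eq_sym ux.
    have [_ _ /(_ uxp) hx] := hu None x.
    have /andP[uy0 _] := u01 None (iter n T x).
    apply/eqP; rewrite eq_le uy0 andbT leNgt; apply/negP => uy.
    have [_ _ /(_ uy)] := hu None (iter n T x).
    by rewrite /= (hsep x n) ?ltxx.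
  - move=> x; have [v hv] := c0P (iter Z.-1 S x); exists v.
    have [_ h1 _] := hu (Some v) x; move: h1; rewrite /= ler_norml => /andP[h1 _].
    have : eta <= c0 / 2 by rewrite ge_min lexx orbT.
    by lra.
  - by move=> v x ux; have [_ _ /(_ ux)] := hu (Some v) x.
(* [iter Z.-1 S (iter n T x)] reaches [x] at time [Z.-1 - n] *)
have back n x : (n <= Z.-1)%N -> iter (Z.-1 - n) T (iter Z.-1 S (iter n T x)) = x.
  move=> nZ; rewrite (iter_shift ST) ?leq_subr // subKn //.
  by rewrite (iter_shift TS) // subnn.
have Z1 : Z.-1.+1 = Z by rewrite prednK // -LZ addn_gt0 orbT.
have LZ1 : (L + 3 = Z.-1)%N by apply: succn_inj; rewrite Z1 -LZ !addnS.
exists s; split.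
- split => //; last by move=> [v|] x /=.
  move=> [v|] //=; apply: cont_comp => //; exact: iter_continuous.
- move=> [a j]; apply: (local_iter a (broadcast_local T M before after L1 j)).
- move=> u hu x y e; have [u01 ust usp uc ur] := sub u hu.
  apply: (broadcast_separates L1 u01 ust usp isT uc (before := before) (after := after));
    last by move=> a j; exact: e (a, j).
  + move=> v n z z' nL /ur hz /ur hz'.
    have nZ : (n <= Z.-1)%N by rewrite -LZ1; apply: leq_trans nL _; rewrite leq_add2l.
    have h1 := (dynmetric_ltP _ _ _ _ _ eps0).1 (rsmall v _ _ hz hz') (Z.-1 - n)%N.
    by move: h1; rewrite !back //; apply; rewrite -[leqRHS]Z1 ltnS leq_subr.
  + move=> n nL; pose t := (Z.-1 - n.+1)%N.
    have nZ : (n < Z.-1)%N by rewrite -LZ1; apply: leq_ltn_trans nL _; rewrite -addn1 ltn_add2l.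
    have tq : (t %/ L' < q)%N.
      rewrite ltn_divLR ?(ltnW L'1) // -/Z -[leqRHS]Z1 ltnS /t.
      exact: leq_subr.
    pose i := Ordinal tq; exists i.
    exists (fun w z => 0 < sigma w (iter (i * L' + 1) T (iter Z.-1 S (iter n T z)))).
    split.
    * by move=> v z /ur /(aftP (i, v)).
    * by move=> v z /ur /(befP (i, v)); rewrite /= -iter_comm addn1 -iterSr.
    * move=> w z z' hz hz'.
      have L'0 : (0 < L')%N by apply: ltnW.
      have h1 := (dynmetric_ltP _ _ _ _ _ eps0).1 (ssmall w _ _ hz hz') (t %% L')%N.
      move: h1; rewrite ltn_mod -!iterD.
      have -> : (t %% L' + (i * L' + 1) = Z.-1 - n)%N.
        by rewrite /= addnA addn1 addnC -divn_eq /t subnSK.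
      by rewrite !back ?(ltnW nZ) //; apply.
- pose a0 : R := ln 4 + (#|V| + #|{: 'I_q * W}|)%:R * ln 2
    + kappa%:R * ln (2 * #|V|%:R + 1 + 1).
  pose a1 : R := ln 4 + 2 * ln (M%:R + 1) + 4 * a0.
  pose a2 : R := 2 * (D + delta) + (2 + 4 * kappa%:R).
  have V0 : 0 <= #|V|%:R :> R by [].
  have B0 : 0 <= 2 * #|V|%:R + 1 :> R by lra.
  have M0 : 0 <= M%:R :> R by [].
  have ln_ge (x : R) : 0 <= x -> 0 <= ln (x + 1) by move=> x1; rewrite ln_ge0 //; lra.
  have ln4 : 0 <= ln (4 : R) by rewrite ln_ge0 // ler1n.
  have ln2 : 0 <= ln (2 : R) by rewrite ln_ge0 // ler1n.
  have a00 : 0 <= a0 by rewrite /a0 !addr_ge0 ?mulr_ge0 // ln_ge.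
  have a10 : 0 <= a1 by rewrite /a1 !addr_ge0 ?mulr_ge0 // ln_ge.
  have a20 : 0 <= a2 by rewrite /a2 !addr_ge0 ?mulr_ge0 ?addr_ge0 // ltW.
  exists (3 * a1 + a2), (6 * (2 * #|V|%:R + 1)); split.
  + by rewrite addr_ge0 ?mulr_ge0.
  + by rewrite mulr_gt0 //; lra.
  move=> u hu e N e01; have [u01 ust usp uc ur] := sub u hu.
  pose active x := [pred iw : 'I_q * W | 0 < sigma iw.2 (iter (iw.1 * L' + 1) T (iter Z.-1 S x))].
  have uorder x : (#|[pred v | (0 < fine_part u v x)%R]| <= k2)%N.
    apply: leq_trans (rn (iter Z.-1 S x)); apply: subset_leq_card.
    by apply/fintype.subsetP => v; rewrite !inE => /ur.
  have active_order x : (#|active x| <= q * k1)%N.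
    rewrite -[q in leqRHS]card_ord; apply: (@card_pairs _ _
      (fun (i : 'I_q) w => 0 < sigma w (iter (i * L' + 1) T (iter Z.-1 S x)))) => i.
    exact: sn.
  have aftA i v x : 0 < fine_part u v x -> active x (i, after i v).
    by move=> /ur /(aftP (i, v)).
  have befA i v x : 0 < fine_part u v (T x) -> active x (i, before i v).
    by move=> /ur /(befP (i, v)); rewrite /= -iter_comm addn1 -iterSr.
  have hs := broadcast_splits L1 u01 ust usp isT (N + 2) uorder active_order aftA befA e01.
  move: hs; rewrite -/kappa; set k := (4 ^ _ * _)%N => hs.
  exists k; split.
  + rewrite /k muln_gt0; apply/andP; split; first by rewrite expn_gt0.
    rewrite muln_gt0; apply/andP; split; first by rewrite expn_gt0.
    rewrite expn_gt0; apply/orP; left; rewrite muln_gt0 /= muln_gt0.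
    by apply/andP; split; rewrite expn_gt0.
  + apply: splits_weaken hs _ _ _ => // x y _ _ hxy n nN [a j] /=.
    rewrite -!iterD; apply: hxy; rewrite addnC leq_add // -ltnS; exact: ltn_ord.
  + have kdel : kappa%:R <= (D + del) * L%:R := kL.
    have := ln_count_le (N + 2) D0 del0 M0 B0 e01 kdel gP
      (erefl : a0 = _ + _ * _ + _).
    rewrite -/k -/a1 -dE natrD => hk; apply: le_trans hk _.
    have lam0 : 0 <= ln e^-1.
      by have /andP[e0 e1] := e01; rewrite ln_ge0 // invf_ge1.
    set lam := ln e^-1 in lam0 *.
    have N0 : 0 <= N%:R :> R by [].
    have y1 := mulr_ge0 N0 a10; have y2 := mulr_ge0 N0 a20.
    have y3 := mulr_ge0 a10 lam0; have y4 := mulr_ge0 a20 lam0.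
    rewrite [leRHS](_ : _ = (N%:R + 1) * (3 * a1 + a2)
      + ((D + delta) * N%:R + a2) * lam + 3 * (a1 * lam)); last by ring.
    have -> : (D + delta) * (N%:R + 2) + (2 + 4 * kappa%:R) = (D + delta) * N%:R + a2.
      by rewrite /a2; ring.
    by lra.
Qed.

End Stages.

Arguments stage_data {R X} s i x : rename.
Arguments stage_map {R X} s j u x : rename.

(** * Refining a stage *)

Section InverseLimit.
Context {R : realType} {X : topologicalType}.
Variables (T S : X -> X) (d : X -> X -> R).
Hypotheses (cX : compact [set: X]) (dc : compatible_metric d).
Hypotheses (TS : cancel T S) (ST : cancel S T) (cT : continuous T) (cS : continuous S).
Hypothesis hm : marker_property T.
Variable D : R.
Hypothesis D0 : 0 <= D.
Hypothesis dimD : forall e c : R, 0 < e -> D < c -> \forall N \near \oo,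
  exists2 n, cube_embedding (dynmetric T d N) e n & n%:R < c * N%:R.
Variable x0 : X.

Lemma uniform_modulus (V : finType) (u : V -> X -> R) (tau : R) : 0 < tau ->
  (forall i, continuous (u i)) ->
  exists2 r : R, 0 < r & forall x y, d x y < r -> forall i, `|u i x - u i y| < tau.
Proof.
move=> tau0 cu; have [_ sepd _ _] := dc.1.
apply: (compact_pair_uniform (Q := fun r x y => d x y < r -> forall i, `|u i x - u i y| < tau)) => //.
  by move=> r r' x y rr' h hd; apply: h; apply: lt_le_trans hd rr'.
move=> x y; have [small|/existsNP[i /negP big]] := pselect (forall i, `|u i x - u i y| < tau).
  exists 1; first exact: ltr01.
  have : nbhs ((x, y) : X * X) [set p : X * X | forall i, `|u i p.1 - u i p.2| < tau].
    apply: (@filter_forall _ V (fun i (p : X * X) => `|u i p.1 - u i p.2| < tau)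
      _ (nbhs_filter ((x, y) : X * X))) => i.
    have c2 : continuous (fun p : X * X => `|u i p.1 - u i p.2|).
      by apply: cont_norm; apply: cont_sub; [apply: cont_fst|apply: cont_snd].
    exact: (@cont_near_lt _ _ _ (x, y) _ c2 (small i)).
  by apply: filterS => p /= h _.
have dxy : 0 < d x y.
  rewrite lt_neqAle (metric_ge0 dc.1) andbT eq_sym; apply/eqP => dxy.
  by move: big; rewrite (sepd _ _ dxy) subrr normr0 tau0.
exists (d x y / 2); first lra.
have h2 : d x y / 2 < d x y by lra.
have := @cont_near_gt _ _ _ (x, y) _ (metric_continuous2 dc) h2.
by apply: filterS => p /= h3 h4; have := lt_trans h3 h4; rewrite ltxx.
Qed.

Lemma local_lipschitz_uniform (V J : finType) (G : J -> (V -> X -> R) -> X -> R) :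
  (forall j, local_lipschitz T (G j)) ->
  exists (C : R) (w : nat), 0 <= C /\
    forall j u u' x y t, in01 u -> in01 u' -> 0 <= t ->
      (forall n i, (n <= w)%N -> `|u i (iter n T x) - u' i (iter n T y)| <= t) ->
      `|G j u x - G j u' y| <= C * t.
Proof.
move=> h; have h' j : exists Cw : R * nat, 0 <= Cw.1 /\
    forall u u' x y t, in01 u -> in01 u' -> 0 <= t ->
      (forall n i, (n <= Cw.2)%N -> `|u i (iter n T x) - u' i (iter n T y)| <= t) ->
      `|G j u x - G j u' y| <= Cw.1 * t.
  by have [C [w [C0 _ hC]]] := h j; exists (C, w).
have [Cw CwP] := choice h'.
exists (\big[Num.max/0]_j (Cw j).1), (\max_j (Cw j).2)%N; split; first exact: bigmax_ge_id.
move=> j u u' x y t hu hu' t0 ht; have [C0 hj] := CwP j.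
apply: (@le_trans _ _ ((Cw j).1 * t)).
  apply: hj => // n i nw; apply: ht; apply: leq_trans nw _.
  exact: (@leq_bigmax_cond _ predT (fun j => (Cw j).2) j isT).
by apply: ler_wpM2r => //; exact: (le_bigmax _ (fun j => (Cw j).1)).
Qed.

(** [Gamma] reconstructs the data of [s], up to its radius, from the image of
    [s'].  The last clause is the contraction that makes the iterated
    reconstructions from later and later stages converge. *)
Definition linked (s s' : stage) (Gamma : (stage_var s' -> X -> R) -> stage_var s -> X -> R)
    (Lambda : R) :=
  [/\ 0 <= Lambda,
      forall u, subordinate (s := s') u -> subordinate (s := s) (Gamma u),
      forall u v x y t, subordinate (s := s') u -> subordinate (s := s') v -> 0 <= t ->
        (forall j, `|stage_map s' j u x - stage_map s' j v y| <= t) ->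
        forall i, `|Gamma u i x - Gamma v i y| <= Lambda * t
    & forall u v t, subordinate (s := s') u -> subordinate (s := s') v -> 0 <= t ->
        (forall i x, `|u i x - v i x| <= t * stage_radius s') ->
        forall i x, `|Gamma u i x - Gamma v i x| <= t / 2 * stage_radius s].

Definition infX (a : X -> R) := inf (range a).

Lemma infX_le (a : X -> R) z : (forall z, 0 <= a z) -> infX a <= a z.
Proof. by move=> a0; apply: ge_inf; [exists 0 => _ [z' _ <-]|exists z]. Qed.

Lemma infX_ge (a : X -> R) c : (forall z, c <= a z) -> c <= infX a.
Proof. by move=> h; apply: lb_le_inf; [exists (a x0); exists x0|move=> _ [z _ <-]]. Qed.

Lemma subordinate_self (s : stage) dim eps : good_stage T d dim eps s ->
  subordinate (stage_data s).
Proof.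
move=> [[r0 _ h01] _ _ _] i x; split => //.
by rewrite subrr normr0 ltW.
Qed.

(** The new stage separates points so well that the data of the old one is
    nearly a function of its image, and McShane's formula extends it to a
    Lipschitz function [Gamma], with an error of at most [2 * tau].
    Subtracting [tau] makes [Gamma] smaller than the data, so that supports do
    not grow; a small radius of the new stage makes it contract. *)
Lemma refine_stage (s : stage) (dim eps eps' delta' : R) : good_stage T d dim eps s ->
  0 < eps' -> 0 < delta' ->
  exists (s' : stage) Gamma Lambda,
    good_stage T d (D + delta') eps' s' /\ linked (s := s) (s' := s') Gamma Lambda.
Proof.
move=> gs eps'0 delta'0; have [[rad0 cdata d01] _ _ _] := gs.
pose tau := stage_radius s / 3.
have tau0 : 0 < tau by rewrite /tau; lra.
have radE : stage_radius s = 3 * tau by rewrite /tau; lra.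
have [r r0 rP] := uniform_modulus tau0 cdata.
pose eps1 := Num.min eps' r.
have eps10 : 0 < eps1 by rewrite lt_min eps'0 r0.
have [s1 gs1] := stage_exists cX dc TS ST cT cS hm D0 dimD x0 eps10 delta'0.
have sub1 := subordinate_self gs1.
have [[rad10 cdata1 d101] loc1 sep1 dim1] := gs1.
pose F j := stage_map s1 j (stage_data s1).
have cF j : continuous (F j) by apply: local_continuous.
have [r1 r10 r1P] := separation_uniform cX cF (metric_continuous2 dc) (sep1 _ sub1).
have [C [w [C0 CP]]] := local_lipschitz_uniform loc1.
pose A := r1^-1.
have A0 : 0 < A by rewrite invr_gt0.
pose rad := Num.min (stage_radius s1) (tau / (A * C + 1)).
have AC0 : 0 <= A * C by rewrite mulr_ge0 // ltW.
have rad_gt0 : 0 < rad by rewrite lt_min rad10 divr_gt0 // ltr_wpDl.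
have radAC : A * C * rad <= tau.
  apply: (@le_trans _ _ (A * C * (tau / (A * C + 1)))).
    by apply: ler_wpM2l => //; rewrite ge_min lexx orbT.
  rewrite mulrA ler_pdivrMr ?ltr_wpDl // mulrC ler_pM2l //; lra.
pose s' := @Stage _ X (stage_var s1) (stage_out s1) (stage_data s1) rad (stage_map s1).
have sub' u : subordinate (s := s') u -> subordinate (s := s1) u.
  move=> h i x; have [h1 h2 h3] := h i x; split => //.
  by apply: le_trans h2 _; rewrite ge_min lexx.
have in' u : subordinate (s := s') u -> in01 u by move=> h i x; have [] := h i x.
(* McShane's formula, with the images of the data of the new stage *)
pose dist (u : stage_var s1 -> X -> R) x z :=
  \big[Num.max/0]_j `|stage_map s1 j u x - F j z|.
have dist0 u x z : 0 <= dist u x z by exact: bigmax_ge_id.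
pose a (u : stage_var s1 -> X -> R) i x z := stage_data s i z + A * dist u x z.
have a0 u i x z : 0 <= a u i x z.
  by have /andP[h _] := d01 i z; rewrite addr_ge0 // mulr_ge0 // ltW.
pose Gamma u i x := Num.max 0 (infX (a u i x) - tau).
have dist_lip u v x y z t : 0 <= t ->
    (forall j, `|stage_map s1 j u x - stage_map s1 j v y| <= t) ->
    dist u x z <= dist v y z + t.
  move=> t0 h; apply/bigmax_leP; split => [|j _]; first by rewrite addr_ge0.
  have := ler_distD (stage_map s1 j v y) (stage_map s1 j u x) (F j z).
  have := h j; have : `|stage_map s1 j v y - F j z| <= dist v y z.
    exact: (le_bigmax _ (fun j => `|stage_map s1 j v y - F j z|)).
  by move=> *; lra.
have Gamma_lip u v x y t : 0 <= t ->
    (forall j, `|stage_map s1 j u x - stage_map s1 j v y| <= t) ->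
    forall i, `|Gamma u i x - Gamma v i y| <= A * t.
  move=> t0 h i; apply: le_trans (max_lip _ _ _) _.
  have half u' v' x' y' : (forall z, dist u' x' z <= dist v' y' z + t) ->
      infX (a u' i x') <= infX (a v' i y') + A * t.
    move=> h'; rewrite -lerBlDr; apply: infX_ge => z; rewrite lerBlDr.
    apply: le_trans (infX_le z (a0 u' i x')) _; rewrite /a.
    by have := ler_wpM2l (ltW A0) (h' z); lra.
  have h1 := half u v x y (fun z => dist_lip u v x y z t t0 h).
  have h2 : infX (a v i y) <= infX (a u i x) + A * t.
    by apply: half => z; apply: dist_lip => // j; rewrite distrC.
  by rewrite opprB addrA subrK ler_norml; apply/andP; split; lra.
have near_data u x j : subordinate (s := s') u -> `|stage_map s1 j u x - F j x| <= C * rad.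
  move=> hu; apply: (CP j) => //; [exact: in'|exact: ltW|].
  by move=> n i _; have [] := hu i (iter n T x).
have distxx u x : subordinate (s := s') u -> A * dist u x x <= tau.
  move=> hu; apply: le_trans radAC; rewrite -mulrA ler_wpM2l ?(ltW A0) //.
  by apply/bigmax_leP; split => [|j _]; [rewrite mulr_ge0 // ltW|exact: near_data].
have up u i x : subordinate (s := s') u -> infX (a u i x) - tau <= stage_data s i x.
  by move=> hu; have := infX_le x (a0 u i x); have := distxx u x hu; rewrite /a; lra.
have down u i x : subordinate (s := s') u -> stage_data s i x - 2 * tau <= infX (a u i x).
  move=> hu; apply: infX_ge => z; rewrite /a.
  have dF : dist (stage_data s1) x z <= dist u x z + C * rad.
    apply: dist_lip => [|j]; first by rewrite mulr_ge0 // ltW.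
    by rewrite distrC; exact: near_data.
  have := ler_wpM2l (ltW A0) dF; have := radAC; rewrite mulrDr mulrA => h1 h2.
  have [close|/existsNP[j /negP far]] := pselect (forall j, `|F j x - F j z| < r1).
    have dxz : d x z < r.
      apply: (@lt_le_trans _ _ eps1); last by rewrite ge_min lexx orbT.
      by have := r1P x z close; lra.
    have := rP x z dxz i; rewrite ltr_norml => /andP[_ h3].
    have h4 : 0 <= A * dist (stage_data s1) x z by rewrite mulr_ge0 // ltW.
    by lra.
  have h3 : 1 <= A * dist (stage_data s1) x z.
    rewrite /A mulrC ler_pdivlMr // mul1r; apply: (@le_trans _ _ `|F j x - F j z|).
      by rewrite leNgt.
    exact: (le_bigmax _ (fun j => `|F j x - F j z|)).
  have /andP[_ h4] := d01 i x; have /andP[h5 _] := d01 i z.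
  by lra.
exists s', Gamma, A; split.
  split => //.
  - by move=> u hu x y h; apply: lt_le_trans (sep1 u (sub' u hu) x y h) _; rewrite ge_min lexx.
  - have [B [E [B0 E0 hB]]] := dim1; exists B, E; split => // u hu.
    by apply: hB; exact: sub'.
split.
- exact: ltW.
- move=> u hu i x; have hup := up u i x hu; have hdown := down u i x hu.
  have /andP[h0 h1] := d01 i x; rewrite /Gamma; split.
  + by rewrite le_max lexx /= ge_max ler01 /=; lra.
  + rewrite radE ler_norml; apply/andP; split.
      have : infX (a u i x) - tau <= Num.max 0 (infX (a u i x) - tau) by rewrite le_max lexx orbT.
      by lra.
    by rewrite lerBlDr ge_max; apply/andP; split; lra.
  + by rewrite lt_max ltxx /= => h; apply: lt_le_trans h hup.
- by move=> u v x y t _ _; exact: Gamma_lip.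
- move=> u v t hu hv t0 h i x.
  have rt0 : 0 <= t * rad by rewrite mulr_ge0 // ltW.
  apply: (@le_trans _ _ (A * (C * (t * rad)))).
    apply: Gamma_lip => [|j]; first exact: mulr_ge0.
    by apply: (CP j) => //; [exact: in'|exact: in'].
  rewrite radE; have := ler_wpM2l t0 radAC.
  have := mulr_ge0 t0 (ltW tau0); rewrite !mulrA; lra.
Qed.

(** * Pseudometrics from an inverse limit of stages *)

Let scale (k : nat) : R := k.+1%:R^-1.
Let good k s := good_stage T d (D + scale k) (scale k) s.

Let scale0 k : 0 < scale k. Proof. by rewrite invr_gt0 ltr0n. Qed.

Lemma stage_sequence : exists (s : nat -> @stage R X)
    (Gamma : forall k, (stage_var (s k.+1) -> X -> R) -> stage_var (s k) -> X -> R)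
    (Lambda : nat -> R),
  (forall k, good k (s k)) /\ forall k, linked (s := s k) (s' := s k.+1) (Gamma k) (Lambda k).
Proof.
have ex0 : exists s, good 0%N s.
  exact: (stage_exists cX dc TS ST cT cS hm D0 dimD x0 (scale0 0%N) (scale0 0%N)).
have step k (s : {s | good k s}) : exists s' : {s | good k.+1 s},
    exists (Gamma : (stage_var (sval s') -> X -> R) -> stage_var (sval s) -> X -> R) Lambda,
      linked (s := sval s) (s' := sval s') Gamma Lambda.
  have [s' [G [La [gs' ls']]]] := refine_stage (svalP s) (scale0 k.+1) (scale0 k.+1).
  by exists (exist _ s' gs'), G, La.
pose f := fix f k : {s | good k s} := match k with
  | 0 => let (s, gs) := cid ex0 in exist _ s gs
  | k.+1 => sval (cid (step k (f k))) end.
have link k : exists (Gamma : (stage_var (sval (f k.+1)) -> X -> R) ->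
    stage_var (sval (f k)) -> X -> R) Lambda,
    linked (s := sval (f k)) (s' := sval (f k.+1)) Gamma Lambda.
  exact: svalP (cid (step k (f k))).
pose Gamma k := sval (cid (link k)).
have link2 k : exists Lambda, linked (s := sval (f k)) (s' := sval (f k.+1)) (Gamma k) Lambda.
  exact: svalP (cid (link k)).
have [Lambda hL] := choice link2.
by exists (fun k => sval (f k)), Gamma, Lambda; split => // k; exact: svalP (f k).
Qed.

Definition orbit_dimension (rho : X -> X -> R) (dim A E : R) :=
  forall (e : R) N, 0 < e <= 1 -> exists K, [/\ (0 < K)%N,
    splits (fun _ : X => True) (fun x y => forall n, (n <= N)%N ->
      rho (iter n T x) (iter n T y) <= E * e) K
  & ln K%:R <= (N%:R + 1) * A + (dim * N%:R + A) * ln e^-1].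

(** The data of stage [k] is replaced by the limit [u k] of its reconstructions
    from the data of later stages.  As [u k = Gamma k (u k.+1)], the
    pseudometric [rho k] defined by the image of stage [k] is then exactly
    controlled by [rho k.+1], with constants that do not involve later
    stages; an approximate control would not do, because it would be used
    at arbitrarily small scales. *)
Lemma dimension_pseudometrics : exists rho : nat -> X -> X -> R,
  [/\ forall k, continuous2 (rho k),
      forall k, [/\ forall x y, 0 <= rho k x y, forall x, rho k x x = 0,
        forall x y, rho k x y = rho k y x & forall x y z, rho k x z <= rho k x y + rho k y z],
      forall k, exists (C : R) (w : nat), 0 <= C /\ forall (x y : X) (t : R), 0 <= t ->
        (forall n, (n <= w)%N -> rho k.+1 (iter n T x) (iter n T y) <= t) ->
        rho k x y <= C * t,
      forall k x y, rho k x y = 0 -> d x y < scale k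
    & forall k, exists A E : R,
        [/\ 0 <= A, 0 < E & orbit_dimension (rho k) (D + scale k) A E]].
Proof.
have [s [Gamma [Lambda [gs ls]]]] := stage_sequence.
have Gsub k u : subordinate (s := s k.+1) u -> subordinate (s := s k) (Gamma k u).
  by have [_ h _ _] := ls k; exact: h.
have Glip k := let: And4 _ _ h _ := ls k in h.
have Gcon k := let: And4 _ _ _ h := ls k in h.
have rad0 k : 0 < stage_radius (s k) by have [[]] := gs k.
have subin k u : subordinate (s := s k) u -> in01 u by move=> h i x; have [] := h i x.
pose it := fix it (n k : nat) : stage_var (s k) -> X -> R := match n with
  | 0 => stage_data (s k)
  | n.+1 => Gamma k (it n k.+1) end.
have itsub n k : subordinate (it n k).
  elim: n k => [|n IH] k /=; first exact: subordinate_self (gs k).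
  by apply: Gsub; exact: IH.
have itcont n k i : continuous (it n k i).
  elim: n k i => [|n IH] k i /=; first by have [[_ h _] _ _ _] := gs k; exact: h.
  have [_ loc _ _] := gs k.+1.
  have cF j : continuous (stage_map (s k.+1) j (it n k.+1)).
    by apply: local_continuous => //; exact: subin.
  move=> x; apply/cvgrPdist_lt => e e0.
  have [L0 _ _ _] := ls k.
  have e1 : 0 < e / (Lambda k + 1) by rewrite divr_gt0 // ltr_wpDl.
  have : nbhs x [set y | forall j, `|stage_map (s k.+1) j (it n k.+1) x
      - stage_map (s k.+1) j (it n k.+1) y| < e / (Lambda k + 1)].
    by apply: filter_forall => j; exact: (cont_near x (cF j) e1).
  apply: filterS => y hy.
  apply: le_lt_trans (Glip k _ _ x y _ (itsub n k.+1) (itsub n k.+1) (ltW e1) _ i) _.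
    by move=> j; apply/ltW/hy.
  by rewrite mulrA ltr_pdivrMr ?ltr_wpDl //; lra.
pose h2 (n : nat) : R := (1 / 2) ^+ n.
have h20 n : 0 < h2 n by rewrite exprn_gt0.
have h2S n : h2 n.+1 = h2 n / 2 by rewrite /h2 exprSr mul1r.
have h2small (c : R) : 0 < c -> exists n, h2 n < c.
  move=> c0; have [n _ hn] := nbhs_infty_gtr c^-1; exists n.
  have nc : c^-1 < n%:R := hn n (leqnn n).
  have n0 : 0 < n%:R :> R by apply: lt_trans nc; rewrite invr_gt0.
  apply: (@lt_trans _ _ n%:R^-1); last by rewrite invf_plt ?posrE.
  rewrite /h2 expr_div_n expr1n mul1r ltf_pV2 ?posrE ?exprn_gt0 //.
  by rewrite -natrX ltr_nat ltn_expl.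
have itcauchy n k m i x : `|it n k i x - it (n + m)%N k i x| <= h2 n * stage_radius (s k).
  elim: n k i x => [|n IH] k i x.
    by rewrite /h2 expr0 mul1r distrC; have [] := itsub m k i x.
  rewrite h2S; apply: (Gcon k _ _ _ (itsub n k.+1) (itsub (n + m)%N k.+1) (ltW (h20 n))).
  by move=> i' x'; exact: IH.
(* the intervals around the iterates are nested: take their common point *)
pose u k i x := sup (range (fun n => it n k i x - h2 n * stage_radius (s k))).
have cross k i x n m : it n k i x - h2 n * stage_radius (s k)
    <= it m k i x + h2 m * stage_radius (s k).
  have [nm|/ltnW mn] := leqP n m.
    have := itcauchy n k (m - n)%N i x; rewrite subnKC // ler_norml => /andP[_].
    have : 0 <= h2 m * stage_radius (s k) by rewrite mulr_ge0 // ltW.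
    by lra.
  have := itcauchy m k (n - m)%N i x; rewrite subnKC // ler_norml => /andP[h _].
  have : 0 <= h2 n * stage_radius (s k) by rewrite mulr_ge0 // ltW.
  by lra.
have unear n k i x : `|u k i x - it n k i x| <= h2 n * stage_radius (s k).
  have lo : it n k i x - h2 n * stage_radius (s k) <= u k i x.
    apply: ub_le_sup; last by exists n.
    by exists (it 0%N k i x + h2 0%N * stage_radius (s k)) => _ [m _ <-].
  have hi : u k i x <= it n k i x + h2 n * stage_radius (s k).
    apply: ge_sup; first by exists (it 0%N k i x - h2 0%N * stage_radius (s k)); exists 0%N.
    by move=> _ [m _ <-].
  by rewrite ler_norml; apply/andP; split; lra.
have usub k : subordinate (u k).
  have small (c : R) : 0 < c -> exists n, h2 n * stage_radius (s k) < c.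
    move=> c0; have [n hn] := h2small _ (divr_gt0 c0 (rad0 k)).
    by exists n; rewrite -ltr_pdivlMr.
  move=> i x; split.
  - apply/andP; split.
      rewrite leNgt; apply/negP => neg; have [n hn] := small (- u k i x) ltac:(lra).
      have := unear n k i x; rewrite ler_norml => /andP[+ _].
      by have /andP[h _] := subin _ _ (itsub n k) i x; lra.
    rewrite leNgt; apply/negP => big; have [n hn] := small (u k i x - 1) ltac:(lra).
    have := unear n k i x; rewrite ler_norml => /andP[_].
    by have /andP[_ h] := subin _ _ (itsub n k) i x; lra.
  - by have := unear 0%N k i x; rewrite /h2 expr0 mul1r.
  - move=> pos; have [n hn] := small _ pos.
    have [_ _ h] := itsub n k i x; apply: h.
    have := unear n k i x; rewrite ler_norml => /andP[_].
    by lra.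
have ucons k : u k = Gamma k (u k.+1).
  apply/funext => i; apply/funext => x; apply/eqP; rewrite -subr_eq0 -normr_le0.
  apply/ler_addgt0Pr => e e0; rewrite add0r.
  have [n hn] := h2small _ (divr_gt0 e0 (rad0 k)).
  rewrite ltr_pdivlMr // in hn.
  have h1 := unear n.+1 k i x.
  have h3 : `|Gamma k (u k.+1) i x - it n.+1 k i x| <= h2 n / 2 * stage_radius (s k).
    apply: (Gcon k _ _ _ (usub k.+1) (itsub n k.+1) (ltW (h20 n))).
    by move=> i' x'; exact: unear.
  have := ler_distD (it n.+1 k i x) (u k i x) (Gamma k (u k.+1) i x).
  rewrite h2S in h1; rewrite (distrC (it _ _ _ _)) => h4; lra.
have ucont k i : continuous (u k i).
  move=> x; apply/cvgrPdist_lt => e e0; have e3 : 0 < e / 3 by lra.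
  have [n hn] := h2small _ (divr_gt0 e3 (rad0 k)).
  rewrite ltr_pdivlMr // in hn.
  apply: filterS (cont_near x (itcont n k i) e3) => y /= hy.
  have h1 := unear n k i x; have h3 := unear n k i y; rewrite distrC in h3.
  have a1 := ler_distD (it n k i x) (u k i x) (u k i y).
  have a2 := ler_distD (it n k i y) (it n k i x) (u k i y).
  by lra.
pose F k j := stage_map (s k) j (u k).
pose rho k x y := \big[Num.max/0]_j `|F k j x - F k j y|.
have rhoP k x y t : 0 <= t -> rho k x y <= t <-> forall j, `|F k j x - F k j y| <= t.
  move=> t0; split=> [/bigmax_leP[_ h] j|h]; first exact: h.
  by apply/bigmax_leP; split => // j _; exact: h.
have rho0 k x y : 0 <= rho k x y by exact: bigmax_ge_id.
exists rho; split.
- move=> k; have [_ loc _ _] := gs k; apply: cont_bigmax => j; apply: cont_norm.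
  have cF : continuous (F k j).
    by apply: local_continuous => //; exact: subin.
  by apply: cont_sub; [apply: cont_fst|apply: cont_snd].
- move=> k; split => //.
  + move=> x; apply/eqP; rewrite eq_le rho0 andbT; apply/rhoP => // j.
    by rewrite subrr normr0.
  + by move=> x y; apply: eq_bigr => j _; rewrite distrC.
  + move=> x y z; apply/rhoP => [|j]; first by rewrite addr_ge0.
    apply: le_trans (ler_distD (F k j y) _ _) _; apply: lerD.
      by have /(rhoP _ _ _ _ (rho0 k x y)) := lexx (rho k x y); apply.
    by have /(rhoP _ _ _ _ (rho0 k y z)) := lexx (rho k y z); apply.
- move=> k; have [_ loc _ _] := gs k.
  have [C [w [C0 hC]]] := local_lipschitz_uniform loc.
  have [L0 _ _ _] := ls k.
  exists (C * Lambda k), w; split; first exact: mulr_ge0.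
  move=> x y t t0 ht; apply/rhoP => [|j]; first by rewrite !mulr_ge0.
  rewrite -mulrA; apply: hC; [exact: subin|exact: subin|exact: mulr_ge0|].
  move=> n i nw; rewrite ucons; apply: (Glip k) => // j'.
  by have /(rhoP _ _ _ _ t0) := ht n nw; apply.
- move=> k x y rxy; have [_ _ sep _] := gs k; apply: (sep _ (usub k)) => j.
  have /(rhoP _ _ _ _ (lexx 0))/(_ j) : rho k x y <= 0 by rewrite rxy.
  by rewrite normr_le0 subr_eq0 => /eqP.
- move=> k; have [_ _ _ [A [E [A0 E0 h]]]] := gs k.
  exists A, E; split => // e N e01; have [K [K0 sK lK]] := h _ (usub k) e N e01.
  exists K; split => //; apply: splits_weaken sK _ _ _ => // x y _ _ hxy n nN.
  apply/rhoP; last exact: hxy.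
  by have /andP[e0 _] := e01; rewrite mulr_ge0 // ltW.
Qed.

End InverseLimit.

(** * The metric *)

Section FinalMetric.
Context {R : realType} {X : topologicalType}.
Variables (T : X -> X) (d : X -> X -> R) (D : R) (rho : nat -> X -> X -> R).
Hypotheses (cX : compact [set: X]) (dc : compatible_metric d) (cT : continuous T).
Hypothesis D0 : 0 <= D.

Let scale (k : nat) : R := k.+1%:R^-1.

Hypotheses (rho_cont : forall k, continuous2 (rho k))
  (rho_metric : forall k, [/\ forall x y, 0 <= rho k x y, forall x, rho k x x = 0,
     forall x y, rho k x y = rho k y x & forall x y z, rho k x z <= rho k x y + rho k y z])
  (rho_factor : forall k, exists (C : R) (w : nat), 0 <= C /\ forall (x y : X) (t : R), 0 <= t ->
     (forall n, (n <= w)%N -> rho k.+1 (iter n T x) (iter n T y) <= t) -> rho k x y <= C * t)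
  (rho_sep : forall k x y, rho k x y = 0 -> d x y < scale k)
  (rho_dim : forall k, exists A E : R,
     [/\ 0 <= A, 0 < E & orbit_dimension T (rho k) (D + scale k) A E]).

Let scale0 k : 0 < scale k. Proof. by rewrite invr_gt0 ltr0n. Qed.
Let scale1 k : scale k <= 1. Proof. by rewrite invf_le1 ?ler1n ?ltr0n. Qed.

Lemma rho_bounded k : exists2 B : R, 0 < B & forall x y, rho k x y <= B.
Proof.
have [rho0 _ _ _] := rho_metric k.
have [|x y|r r0 h] := compact_pair_uniform (Q := fun r x y => r * rho k x y <= 1) cX.
- by move=> r r' x y rr'; apply: le_trans; rewrite ler_wpM2r.
- have r1 : 0 < rho k x y + 1 by have := rho0 x y; lra.
  exists (rho k x y + 1)^-1; first by rewrite invr_gt0.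
  have lt1 : rho k x y < rho k x y + 1 by lra.
  have := @cont_near_lt _ _ _ (x, y) _ (@rho_cont k) lt1.
  by apply: filterS => p /= /ltW; rewrite mulrC ler_pdivrMr // mul1r.
- exists r^-1; first by rewrite invr_gt0.
  by move=> x y; rewrite -[r^-1]mul1r ler_pdivlMr // mulrC.
Qed.

Lemma rho_factor_all k : exists (G : R) (W : nat), 1 <= G /\
  forall j (x y : X) (t : R), (j <= k)%N -> 0 <= t ->
    (forall n, (n <= W)%N -> rho k (iter n T x) (iter n T y) <= t) -> rho j x y <= G * t.
Proof.
elim: k => [|k [G [W [G1 h]]]].
  exists 1, 0%N; split => // j x y t; rewrite leqn0 => /eqP -> t0 /(_ 0%N isT).
  by rewrite mul1r.
have [C [w [C0 hC]]] := rho_factor k.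
exists (Num.max 1 (G * C)), (W + w)%N; split; first by rewrite le_max lexx.
move=> j x y t jk t0 ht; have [jk'|jk'] := leqP j k; last first.
  have -> : j = k.+1 by apply/eqP; rewrite eqn_leq jk.
  apply: le_trans (ht 0%N (leq0n _)) _; rewrite ler_peMl // le_max lexx //.
apply: (@le_trans _ _ (G * (C * t))).
  apply: h => //; first exact: mulr_ge0.
  move=> n nW; apply: hC => // m mw; rewrite -!iterD addnC; apply: ht.
  by rewrite leq_add.
by rewrite mulrA ler_wpM2r // le_max lexx orbT.
Qed.

Section Weights.
Variables (beta B : nat -> R).
Hypotheses (beta0 : forall k, 0 < beta k) (beta1 : forall k, beta k <= 1)
  (beta_mono : forall j k, (j <= k)%N -> beta k <= beta j)
  (beta_small : forall e : R, 0 < e -> exists k, beta k < e)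
  (B0 : forall k, 0 < B k) (rhoB : forall k x y, rho k x y <= B k).

Let alpha k := beta k / (B k + 1).
Let alpha0 k : 0 < alpha k. Proof. by rewrite divr_gt0 // addr_gt0. Qed.

Let alpha1 k : alpha k <= 1.
Proof. by rewrite ler_pdivrMr ?addr_gt0 // mul1r; have := beta1 k; have := B0 k; lra. Qed.

Let rho0 k x y : 0 <= rho k x y. Proof. by have [h _ _ _] := rho_metric k; exact: h. Qed.

Let alpha_rho k x y : alpha k * rho k x y <= beta k.
Proof.
rewrite mulrAC ler_pdivrMr ?addr_gt0 // ler_wpM2l ?(ltW (beta0 k)) //.
by have := rhoB k x y; lra.
Qed.

(** A supremum instead of a sum, so that at scales from [beta k.+1] on only the
    pseudometrics up to [rho k] matter. *)
Definition weighted_sup x y := sup (range (fun k => alpha k * rho k x y)).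

Let le_sup k x y : alpha k * rho k x y <= weighted_sup x y.
Proof.
apply: ub_le_sup; last by exists k.
by exists 1 => _ [j _ <-]; apply: le_trans (alpha_rho j x y) _.
Qed.

Let sup_le x y (c : R) : (forall k, alpha k * rho k x y <= c) -> weighted_sup x y <= c.
Proof.
move=> h; apply: ge_sup; first by exists (alpha 0%N * rho 0%N x y); exists 0%N.
by move=> _ [k _ <-].
Qed.

Lemma weighted_sup_le k x y (e : R) : beta k.+1 <= e ->
  (forall j, (j <= k)%N -> rho j x y <= e) -> weighted_sup x y <= e.
Proof.
move=> be h; apply: sup_le => j; have [jk|kj] := leqP j k.
  apply: le_trans (h j jk); rewrite ler_piMl //.
by apply: le_trans (alpha_rho j x y) _; apply: le_trans be; exact: beta_mono.
Qed.

Lemma weighted_sup_metric : is_metric weighted_sup.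
Proof.
split.
- move=> x; apply/eqP; rewrite eq_le; apply/andP; split.
    by apply: sup_le => k; have [_ -> _ _] := rho_metric k; rewrite mulr0.
  by apply: le_trans (le_sup 0 x x); rewrite mulr_ge0 // ltW.
- move=> x y e; have [_ dsep _ _] := dc.1; apply: dsep.
  have rz k : rho k x y = 0.
    apply/eqP; rewrite eq_le rho0 andbT -(pmulr_rle0 _ (alpha0 k)) -e; exact: le_sup.
  apply/eqP; rewrite eq_le (metric_ge0 dc.1) andbT.
  apply/ler_addgt0Pr => c c0; rewrite add0r.
  have [n _ hn] := nbhs_infty_gtr c^-1; have nc : c^-1 < n%:R := hn n (leqnn n).
  apply/ltW; apply: lt_trans (rho_sep (rz n)) _.
  rewrite /scale invf_plt ?posrE ?ltr0n //; apply: lt_trans nc _.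
  by rewrite ltr_nat.
- move=> x y; congr sup; apply: eq_imagel => k _.
  by have [_ _ -> _] := rho_metric k.
- move=> x y z; apply: sup_le => k; have [_ _ _ tri] := rho_metric k.
  apply: (@le_trans _ _ (alpha k * rho k x y + alpha k * rho k y z)).
    by rewrite -mulrDr ler_wpM2l // ltW.
  by apply: lerD; exact: le_sup.
Qed.

Lemma weighted_sup_near x (e : R) : 0 < e -> nbhs x [set y | weighted_sup x y < e].
Proof.
move=> e0; have e2 : 0 < e / 2 by lra.
have [k bk] := beta_small e2.
have : nbhs x [set y | forall j : 'I_k.+1, rho j x y < e / 2].
  apply: filter_forall => j.
  have c1 : continuous (rho j x) by apply: continuous2_section; exact: rho_cont.
  have lt : rho j x x < e / 2 by have [_ -> _ _] := rho_metric j.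
  exact: (cont_near_lt c1 lt).
apply: filterS => y hy; apply: (@le_lt_trans _ _ (e / 2)); last lra.
apply: (weighted_sup_le (k := k)).
  by apply: le_trans (ltW bk); apply: beta_mono.
by move=> j jk; rewrite -ltnS in jk; apply/ltW/(hy (Ordinal jk)).
Qed.

Lemma weighted_sup_compatible : compatible_metric weighted_sup.
Proof.
have wm := weighted_sup_metric; split => // x.
have [_ wsep ws wt] := wm.
apply/seteqP; split => A; last first.
  move=> [r /= r0 h]; apply: filterS h _; exact: weighted_sup_near.
move=> xA.
have [|y z|r r0 h] := compact_pair_uniform
    (Q := fun r y _ => weighted_sup x y < r -> A y) cX.
- by move=> r r' y _ rr' h hy; apply: h; apply: lt_le_trans hy rr'.
- have [->|xy] := pselect (y = x).
    exists 1; first exact: ltr01.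
    exists (A, setT) => /=; first by split => //; exact: filterT.
    by move=> [y' z'] /= [].
  have wxy : 0 < weighted_sup x y.
    rewrite lt_neqAle (metric_ge0 wm) andbT eq_sym; apply/eqP => e.
    by apply: xy; rewrite (wsep _ _ e).
  have w2 : 0 < weighted_sup x y / 2 by lra.
  exists (weighted_sup x y / 2) => //.
  exists ([set y' | weighted_sup y y' < weighted_sup x y / 2], setT) => /=.
    by split; [exact: weighted_sup_near|exact: filterT].
  move=> [y' z'] /= [h _] h'; exfalso.
  by have := wt x y' y; rewrite (ws y' y); lra.
- by exists r; [exact: r0|move=> z; exact: (h z z)].
Qed.

(** At scales from [beta k.+1] on it suffices to count classes for [rho k]
    alone, at the smaller scale [e'] that controls the earlier pseudometrics
    too. *)
Lemma weighted_sup_entropy k (A E G e l : R) (W : nat) : 0 <= A -> 0 < E -> 1 <= G ->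
  orbit_dimension T (rho k) (D + scale k) A E ->
  (forall j (x y : X) (t : R), (j <= k)%N -> 0 <= t ->
    (forall n, (n <= W)%N -> rho k (iter n T x) (iter n T y) <= t) -> rho j x y <= G * t) ->
  beta k.+1 <= e -> 0 < e <= 1 ->
  entropy_at_scale T weighted_sup (5 * e) = l%:E ->
  l * ln 2 <= A + (D + scale k) * (ln e^-1 + ln ((E + 1) * G)).
Proof.
move=> A0 E0 G1 dimk fac be /andP[e0 e1] lE.
have wc := weighted_sup_compatible.
have e50 : 0 < 5 * e by rewrite mulr_gt0.
have [l' [lE' l0 hl _]] := entropyP cX wc cT e50.
have {lE'} ll : l' = l by apply: EFin_inj; rewrite -lE -lE'.
rewrite ll in l0 hl.
pose H := (E + 1) * G.
have H1 : 1 <= H by rewrite /H -[1](mulr1 1); apply: ler_pM => //; lra.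
have H0 : 0 < H by lra.
pose e' := e / H.
have e'0 : 0 < e' by rewrite divr_gt0.
have e'1 : e' <= 1 by rewrite ler_pdivrMr // mul1r; lra.
have lne' : ln e'^-1 = ln e^-1 + ln H.
  by rewrite /e' invfM invrK lnM ?posrE ?invr_gt0.
set lam := ln e^-1 + ln H.
have lam0 : 0 <= lam by rewrite /lam -lne' ln_ge0 // invf_ge1.
pose c := D + scale k.
have c0 : 0 <= c by rewrite /c addr_ge0 // ltW.
(* classes for [rho k] along [N + W] times are small for the metric along [N] times *)
have main N : (0 < N)%N -> l * ln 2 * N%:R <=
    (A + c * lam) * N%:R + ((W%:R + 1) * A + (c * W%:R + A) * lam).
  move=> N0; have [|K [K0 [lab [labK labP]] lnK]] := dimk e' (N + W)%N; first by rewrite e'0.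
  have sc : small_cover (dynmetric T weighted_sup N) (5 * e) (maxn 1 #|'I_K|).
    apply: (partition_small_cover wc cT (l := fun x => Ordinal (labK x I))) => // x y /(congr1 val) /= lxy.
    apply/dynmetric_leP => [|n nN]; first exact: ltW.
    apply: (weighted_sup_le (k := k)) => // j jk.
    apply: le_trans (fac j _ _ (E * e') jk _ _) _.
    - by rewrite mulr_ge0 // ltW.
    - move=> m mW; rewrite -!iterD; apply: (labP x y I I lxy).
      by rewrite addnC leq_add // ltnW.
    - have -> : G * (E * e') = (E * G) * e / H by rewrite /e'; ring.
      by rewrite ler_pdivrMr // mulrC ler_wpM2l // ?(ltW e0) // /H mulrDl mul1r; lra.
  have := hl N _ N0 sc; rewrite card_ord (maxn_idPr K0) => h1.
  move: lnK; rewrite lne' -/lam -/c natrD => h2.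
  apply: le_trans h1 _; apply: le_trans h2 _.
  by rewrite le_eqVlt; apply/orP; left; apply/eqP; ring.
rewrite leNgt; apply/negP => gt.
set b := A + c * lam in main; rewrite -/c -/H -/lam -/b in gt.
set K0 := (W%:R + 1) * A + (c * W%:R + A) * lam in main.
have gap : 0 < l * ln 2 - b by lra.
have [N _ hN] := filterI (nbhs_infty_gt 0) (nbhs_infty_gtr (K0 / (l * ln 2 - b))).
have [N0 h] := hN N (leqnn N).
move: h; rewrite ltr_pdivrMr // => h.
have := main N N0.
have : K0 < N%:R * (l * ln 2 - b) := h.
by rewrite mulrBr (mulrC N%:R) (mulrC N%:R b); lra.
Qed.

End Weights.

Lemma scale_small (c : R) : 0 < c -> exists k, scale k < c.
Proof.
move=> c0; have [n _ hn] := nbhs_infty_gtr c^-1; have nc : c^-1 < n%:R := hn n (leqnn n).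
exists n; rewrite /scale invf_plt ?posrE ?ltr0n //; apply: lt_trans nc _.
by rewrite ltr_nat.
Qed.

(** The bound [beta k] is chosen after the constants [cst k] of the pseudometric
    [rho k].  A scale [e] between [beta k.+1] and [beta k] is so small that
    these constants are negligible against [ln (1 / e)]. *)
Lemma low_dimensional_metric :
  exists d', compatible_metric d' /\ (upper_mmdim T d' <= D%:E)%E.
Proof.
have dimP k : exists AE : R * R, [/\ 0 <= AE.1, 0 < AE.2 &
     orbit_dimension T (rho k) (D + scale k) AE.1 AE.2].
  by have [A [E h]] := rho_dim k; exists (A, E).
have facP k : exists GW : R * nat, 1 <= GW.1 /\
    forall j (x y : X) (t : R), (j <= k)%N -> 0 <= t ->
    (forall n, (n <= GW.2)%N -> rho k (iter n T x) (iter n T y) <= t) -> rho j x y <= GW.1 * t.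
  by have [G [W h]] := rho_factor_all k; exists (G, W).
have bndP k : exists B : R, 0 < B /\ forall x y, rho k x y <= B.
  by have [B B0 h] := rho_bounded k; exists B.
have [AE {}dimP] := choice dimP; have [GW {}facP] := choice facP.
have [B bP] := choice bndP.
have B0 k : 0 < B k by have [] := bP k.
have rhoB k x y : rho k x y <= B k by have [_ h] := bP k; exact: h.
have ln50 : 0 < ln (5 : R) by rewrite ln_gt0 // ltr1n.
pose cst k := (AE k).1 + (D + 1) * ln (((AE k).2 + 1) * (GW k).1).
pose F k := Num.min (scale k) (expR (- ((cst k + ln 5) / scale k + ln 5))).
have F0 k : 0 < F k by rewrite lt_min scale0 expR_gt0.
pose beta k := \big[Num.min/1]_(j < k.+1) F j.
have beta0 k : 0 < beta k by apply/bigmin_gtP; split => // j _.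
have beta1 k : beta k <= 1 by exact: bigmin_le_id.
have betaF k j : (j <= k)%N -> beta k <= F j.
  move=> jk; have /bigmin_geP[_ h] := lexx (beta k).
  by rewrite -ltnS in jk; exact: (h (Ordinal jk)).
have beta_mono j k : (j <= k)%N -> beta k <= beta j.
  move=> jk; apply/bigmin_geP; split => // i _; apply: betaF.
  by apply: leq_trans jk; rewrite -ltnS.
have beta_small (c : R) : 0 < c -> exists k, beta k < c.
  move=> c0; have [k hk] := scale_small c0; exists k.
  apply: le_lt_trans hk; apply: le_trans (betaF k k (leqnn k)) _.
  by rewrite ge_min lexx.
pose d' := weighted_sup beta B.
have dc' : compatible_metric d' by exact: weighted_sup_compatible.
exists d'; split => //.
apply/lee_addgt0Pr => delta delta0.
have D3 : 0 < D + 3 by apply: ltr_wpDl.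
have [k0 hk0] := scale_small (divr_gt0 delta0 D3).
rewrite -EFinD; apply: (limf_esup_le (r := 5 * beta k0)); first by rewrite mulr_gt0.
move=> e5 /andP[e50 e5b]; pose e := e5 / 5.
have e5E : e5 = 5 * e by rewrite /e; lra.
have e0 : 0 < e by rewrite divr_gt0.
have eb : e < beta k0 by rewrite e5E ltr_pM2l in e5b.
have e1 : e <= 1 by apply: le_trans (ltW eb) (beta1 k0).
have exm : exists m, beta m <= e by have [m hm] := beta_small e e0; exists m; exact: ltW.
case: (ex_minnP exm) => m me mmin.
have k0m : (k0 < m)%N.
  by rewrite ltnNge; apply/negP => mk; have := le_trans (beta_mono _ _ mk) me; rewrite leNgt eb.
case: m k0m me mmin => // k k0k me mmin; rewrite ltnS in k0k.
have ebk : e < beta k.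
  by rewrite ltNge; apply/negP => h; have := mmin k h; rewrite ltnn.
have [l [lE l0 _ _]] := entropyP cX dc' cT e50.
have [A0 E0 dimk] := dimP k; have [G1 fack] := facP k.
have e01 : 0 < e <= 1 by rewrite e0 e1.
have lE' : entropy_at_scale T d' (5 * e) = l%:E by rewrite -e5E.
have hl := weighted_sup_entropy beta0 beta1 beta_mono beta_small B0 rhoB
  A0 E0 G1 dimk fack me e01 lE'.
set s := scale k in hl; set lam := ln e^-1 in hl; set lH := ln (((AE k).2 + 1) * _) in hl.
have s0 : 0 < s by exact: scale0.
have s1 : s <= 1 by exact: scale1.
have ssmall : s * (D + 3) <= delta.
  rewrite -ler_pdivlMr; last exact: D3.
  apply: le_trans (ltW hk0); rewrite /s /scale lef_pV2 ?posrE ?ltr0n // ler_nat ltnS //.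
have lH0 : 0 <= lH.
  by rewrite /lH ln_ge0 // mulr_ege1 // lerDr ltW.
have lamP : (cst k + ln 5) / s + ln 5 <= lam.
  have : ln e <= - ((cst k + ln 5) / s + ln 5).
    rewrite -ler_expR lnK ?posrE //; apply: le_trans (ltW ebk) _.
    by apply: le_trans (betaF k k (leqnn k)) _; rewrite ge_min lexx orbT.
  by rewrite -lerN2 opprK /lam lnV ?posrE.
have D1 : 0 <= D + 1 by rewrite addr_ge0.
have Ds : 0 <= D + s by rewrite addr_ge0 // ltW.
have cst0 : 0 <= cst k by rewrite /cst addr_ge0 // mulr_ge0.
pose mu := lam - ln 5.
have muP : cst k + ln 5 <= s * mu.
  have : (cst k + ln 5) / s <= mu by rewrite /mu; lra.
  by rewrite ler_pdivrMr // mulrC.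
have mu0 : 0 < mu by rewrite -(pmulr_rgt0 _ s0); lra.
have muE : ln e5^-1 = mu.
  by rewrite e5E invfM lnM ?posrE ?invr_gt0 // lnV ?posrE // addrC.
rewrite lE -EFinM lee_fin ler_pdivrMr; last first.
  by rewrite /log2 divr_gt0 ?ln2_gt0 // muE.
rewrite /log2 muE mulrA ler_pdivlMr ?ln2_gt0 //.
apply: le_trans hl _.
(* [ln (1 / e)] is [mu + ln 5], and by [muP] the constants are at most [s * mu] *)
have b1 : s * lH <= lH by rewrite ler_piMl.
have cstE : cst k = (AE k).1 + (D + 1) * lH by [].
have b2 : (D + s) * ln 5 <= (D + s) * (s * mu) by apply: ler_wpM2l => //; lra.
have b3 : s * (D + 3) * mu <= delta * mu by rewrite ler_wpM2r // ltW.
have b4 : s * s * mu <= s * mu by rewrite ler_wpM2r ?(ltW mu0) // ler_piMl // ltW.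
have lamE : lam = mu + ln 5 by rewrite /mu; lra.
rewrite lamE; lra.
Qed.

End FinalMetric.

Theorem theorem3p12 (R : realType) (X : topologicalType) (T : X -> X)
  (hT : dynamical_system R T) (hm : marker_property T) :
  exists d : X -> X -> R,
    compatible_metric d /\ upper_mmdim T d = mdim R T.
Proof.
have [cX dex [S [TS ST cT cS]]] := hT.
set d0 : X -> X -> R := xget (fun _ _ => 0) [set d | compatible_metric d].
have dc : compatible_metric d0 by exact: (xgetPex _ dex).
have mE : mdim R T = mdim_of_metric T d0 by [].
have up d : compatible_metric d -> (mdim R T <= upper_mmdim T d)%E.
  by rewrite mE; exact: mdim_le_upper_mmdim.
have [l1 [l1E _ _]] := mean_widimP cX dc cT ltr01.
have := mdim_ge cX dc cT ltr01; rewrite -mE l1E => l1D.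
case: (mdim R T) l1D up mE => [D _ up mE|_ up _|//]; last first.
  by exists d0; split => //; apply/eqP; rewrite eq_le leey up.
have dimD (e c : R) : 0 < e -> D < c ->
    \forall N \near \oo, exists2 n, cube_embedding (dynmetric T d0 N) e n & n%:R < c * N%:R.
  move=> e0 Dc; have [l [lE _ h]] := mean_widimP cX dc cT e0; apply: h.
  by apply: le_lt_trans Dc; rewrite -lee_fin -lE mE mdim_ge.
have D0 : 0 <= D.
  rewrite leNgt; apply/negP => Dn.
  have [N _ hN] := dimD _ _ ltr01 Dn.
  by have [n _] := hN N (leqnn N); rewrite mul0r ltNge ler0n.
suff [d' [dc' h]] : exists d', compatible_metric d' /\ (upper_mmdim T d' <= D%:E)%E.
  by exists d'; split => //; apply/eqP; rewrite eq_le h up.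
have [[x0]|X0] := pselect (inhabited X).
  have [rho [h1 h2 h3 h4 h5]] := dimension_pseudometrics cX dc TS ST cT cS hm D0 dimD x0.
  exact: (low_dimensional_metric cX dc cT D0 h1 h2 h3 h4 h5).
have noX (x : X) : False by apply: X0; exists; exact: x.
(* on the empty space any pseudometrics will do *)
apply: (low_dimensional_metric (rho := fun _ _ _ => 0) cX dc cT D0).
- by move=> k [x y]; case: (noX x).
- by move=> k; split => x; case: (noX x).
- by move=> k; exists 0, 0%N; split => // x; case: (noX x).
- by move=> k x; case: (noX x).
- move=> k; exists 0, 1; split => // e N /andP[e0 e1]; exists 1%N; split => //.
    by exists (fun=> 0%N); split => x; case: (noX x).
  rewrite ln1 mulr0 add0r addr0 mulr_ge0 ?mulr_ge0 ?addr_ge0 ?invr_ge0 ?ler0n //.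
  by rewrite ln_ge0 // invf_ge1.
Qed.
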